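(* Let $M\ge3$ be an integer, let $a>0$, $\mu\in\mathbb{R}$, $g\in\mathbb{R}\setminus\{0\}$ be the parameters of an Alexander spiral, i.e. $a^2+1-2\mu+2a\mu i=-2a^2 g\coth(\pi A/M)$ with $A=-\frac{2ai}{a+i}$, and let $\alpha>0$, $\alpha\neq\frac1{2a}$. Suppose that smooth functions $X_m,Y_m:(0,\infty)\to\mathbb{C}$, $m\in\{0,\dots,M-1\}$, satisfy $$\sum_{k=0}^{M-1}X_k(t)e^{-i\theta_k}=\sum_{k=0}^{M-1}Y_k(t)e^{-i\theta_k}=0\quad\text{and}\quad \sum_{k=0}^{M-1}X_k(t)e^{-2i\theta_k}=\sum_{k=0}^{M-1}Y_k(t)e^{-2i\theta_k}=0$$ for all $t>0$. Then the perturbation $\zeta=(\zeta_0,\dots,\zeta_{M-1})$ given by $$\zeta_m(t,\theta)=X_m(t)\zeta_m^+(t,\theta)e^{i\theta}+Y_m(t)\zeta_m^-(t,\theta)e^{i\theta},\qquad \zeta_m^\pm(t,\theta)=e^{\pm i\alpha(2a(\theta-\theta_m)+(2\mu-1)\ln t)},$$ satisfies the linearized Birkhoff--Rott equation $$t\,\partial_t\zeta_m(t,\theta)^*-\frac{2\mu-1}{2a}\,\partial_\theta\zeta_m(t,\theta)^*=-\mathcal{H}_m\zeta(t,\theta),\qquad t>0,\ \theta\in\mathbb{R},\ m=0,\dots,M-1,$$ if and only if $$\begin{cases} t\,\partial_tX_m(t)+i\frac{1-2\mu}{2a}X_m(t)=-c_0^*\,Y_m(t)^*+g\sum_{k=0}^{M-1}c^-_{mk}(\alpha)^*\,Y_k(t)^*,\\[4pt]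 t\,\partial_tY_m(t)+i\frac{1-2\mu}{2a}Y_m(t)=-c_0^*\,X_m(t)^*+g\sum_{k=0}^{M-1}c^+_{mk}(\alpha)^*\,X_k(t)^*\end{cases}$$ for all $m=0,\dots,M-1$ and $t>0$.
   Context: Here $z^*$ denotes complex conjugation. Notation: $\theta_m=2\pi m/M$, $\Delta_{km}=\theta_k-\theta_m=2\pi(k-m)/M$. An Alexander spiral is the symmetric logarithmic spiral vortex sheet with branches $Z_m(\theta,t)=t^\mu e^{a(\theta-\theta_m)}e^{i\theta}$ and circulation $\Gamma_m(\theta,t)=g\,t^{2\mu-1}e^{2a(\theta-\theta_m)}$, $0\le m\le M-1$. Coefficients: $$A=-\frac{2ai}{a+i},\quad B_\pm=B_\pm(\alpha)=-a(\pm2i\alpha+1)\frac{1+ai}{1+a^2},\quad c_0=\frac{ga(a-i)}{(a+i)^2}\coth(\pi A/M),$$ $$c_{mk}^\pm(\alpha)=\frac{a^2(\pm2i\alpha+1)}{(a+i)^2}\,\frac{\mathcal{B}^\pm_{mk}}{\sinh(\pi B_\pm)},\qquad \mathcal{B}^\pm_{mk}=e^{\Delta_{km}B_\pm}\cdot\begin{cases}e^{-\pi B_\pm}&\text{if }\Delta_{km}>0,\\ \cosh(\pi B_\pm)&\text{if }\Delta_{km}=0,\\ e^{\pi B_\pm}&\text{if }\Delta_{km}<0.\end{cases}$$ Operator: $$\mathcal{H}_m\zeta(\theta)=\frac{ag}{\pi i}\,\mathrm{f.p.}\!\int_{-\infty}^{\infty}\sum_{k=0}^{M-1}\frac{(\zeta_m(\theta)-\zeta_k(\sigma+\theta+\Delta_{km}))\,e^{2a\sigma}e^{-2i\theta}}{(1-e^{(a+i)\sigma}e^{i\Delta_{km}})^2}\,d\sigma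 ,$$ applied to $\zeta(t,\cdot)$ for each fixed $t$. The integral over $\mathbb{R}$ is the limit as $R\to\infty$ of the finite part integral over $[-R,R]$ of the whole sum. Only the term $k=m$ is singular (at $\sigma=0$); there the finite part is taken with the curve $\gamma(\sigma)=e^{(a+i)\sigma}$ and $x=0$ in the following definition. Finite part (Hadamard regularization): for smooth $f$ on $[p,q]$ and $x\in(p,q)$, $$\mathrm{f.p.}\!\int_p^q\frac{f(t)}{(t-x)^2}dt=\lim_{\varepsilon\to0^+}\Big(\int_p^{x-\varepsilon}\frac{f(t)}{(t-x)^2}dt+\int_{x+\varepsilon}^q\frac{f(t)}{(t-x)^2}dt-\frac{f(x+\varepsilon)+f(x-\varepsilon)}{\varepsilon}\Big),$$ and for a smooth curve $\gamma:[p,q]\to\mathbb{C}$ with $\gamma'\neq0$, $\mathrm{f.p.}\int_p^q\frac{f(t)\,dt}{(\gamma(t)-\gamma(x))^2}:=\mathrm{f.p.}\int_p^q\frac{h(t)\,dt}{(t-x)^2}$ with $h(t)=f(t)\big(\frac{\gamma(t)-\gamma(x)}{t-x}\big)^{-2}$ (with value $f(x)\gamma'(x)^{-2}$ at $t=x$). *)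

(* Defs.v *)
From Stdlib Require Export Reals.
From Coquelicot Require Export Coquelicot.

Open Scope R_scope.

(** * Complex elementary functions *)

Definition Cexp (z : C) : C := (exp (Re z) * cos (Im z), exp (Re z) * sin (Im z)).
Definition Ccosh (z : C) : C := ((Cexp z + Cexp (- z)) / 2)%C.
Definition Csinh (z : C) : C := ((Cexp z - Cexp (- z)) / 2)%C.
Definition Ccoth (z : C) : C := (Ccosh z / Csinh z)%C.

(** Sums over [{0, ..., M-1}]; only used with [M >= 1]. *)
Definition Csum (M : nat) (u : nat -> C) : C := sum_n u (M - 1).

(** Smoothness on [(0, oo)]; values at [t <= 0] are irrelevant. *)
Definition smooth_pos (f : R -> C) : Prop :=
  forall (n : nat) (t : R), 0 < t ->
    ex_derive_n (fun s => Re (f s)) n t /\ ex_derive_n (fun s => Im (f s)) n t.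

(** [C] is viewed as a real normed space: the variable is real. *)
Definition is_derive_RC (f : R -> C) (t : R) (l : C) : Prop :=
  is_derive (K := R_AbsRing) (V := C_R_NormedModule) f t l.

Definition RInt_C (f : R -> C) (p q : R) : C :=
  RInt (V := C_R_CompleteNormedModule) f p q.

(** * Hadamard finite part *)

(** [l] is the finite part of the integral of [f t / (t - x)^2] over [[p, q]],
    where [p < x < q]. *)
Definition is_fp (f : R -> C) (p q x : R) (l : C) : Prop :=
  filterlim
    (fun eps : R =>
       (RInt_C (fun t => f t / RtoC ((t - x) ^ 2)) p (x - eps)
        + RInt_C (fun t => f t / RtoC ((t - x) ^ 2)) (x + eps) q
        - (f (x + eps)%R + f (x - eps)%R) / eps)%C)
    (at_right 0) (locally l).

(** [l] is the finite part of the integral of [f t / (gam t - gam x)^2] over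
    [[p, q]]. *)
Definition is_fp_curve (f gam : R -> C) (p q x : R) (l : C) : Prop :=
  exists dgam : C,
    is_derive_RC gam x dgam /\
    is_fp (fun t => if Req_EM_T t x then (f x / dgam ^ 2)%C
                    else (f t / ((gam t - gam x) / RtoC (t - x)) ^ 2)%C)
          p q x l.

(** * Alexander spirals and the coefficients of the linearization *)

Definition theta (M m : nat) : R := 2 * PI * INR m / INR M.
Definition Delta (M k m : nat) : R := theta M k - theta M m.

Definition A_coef (a : R) : C := (- (2 * a * Ci) / (a + Ci))%C.

Definition alexander_spiral (M : nat) (a mu g : R) : Prop :=
  (RtoC (a ^ 2 + 1 - 2 * mu) + RtoC (2 * a * mu) * Ci
   = RtoC (- (2 * a ^ 2 * g)) * Ccoth (PI * A_coef a / INR M))%C.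

(** In the next definitions [s = 1] or [s = -1] is the sign written as a
    superscript or subscript [+] or [-]. *)

Definition B_coef (s a alpha : R) : C :=
  (- a * (s * 2 * Ci * alpha + 1) * ((1 + a * Ci) / RtoC (1 + a ^ 2)))%C.

Definition calB (s : R) (M : nat) (a alpha : R) (m k : nat) : C :=
  let B := B_coef s a alpha in
  let D := Delta M k m in
  (Cexp (D * B) *
   (if Rlt_dec 0 D then Cexp (- (PI * B))
    else if Rlt_dec D 0 then Cexp (PI * B)
    else Ccosh (PI * B)))%C.

Definition c_coef (s : R) (M : nat) (a alpha : R) (m k : nat) : C :=
  (RtoC (a ^ 2) * (s * 2 * Ci * alpha + 1) / (a + Ci) ^ 2
   * (calB s M a alpha m k / Csinh (PI * B_coef s a alpha)))%C.

Definition c0_coef (M : nat) (a g : R) : C :=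
  (g * a * (a - Ci) / (a + Ci) ^ 2 * Ccoth (PI * A_coef a / INR M))%C.

(** * The linearized Birkhoff-Rott equation *)

Definition H_num (M : nat) (a : R) (zeta : nat -> R -> C) (m k : nat)
    (th sg : R) : C :=
  ((zeta m th - zeta k (sg + th + Delta M k m)%R)
   * Cexp (2 * a * sg) * Cexp (- (2 * Ci * th)))%C.

Definition H_den (M : nat) (a : R) (m k : nat) (sg : R) : C :=
  ((1 - Cexp ((a + Ci) * sg) * Cexp (Ci * Delta M k m)) ^ 2)%C.

(** [l] is the finite part over [[-r, r]] of the sum over [k] defining
    [H_m zeta (th)]. Only [k = m] is singular; the other terms are ordinary
    integrals. *)
Definition is_H_trunc (M : nat) (a : R) (zeta : nat -> R -> C) (m : nat)
    (th r : R) (l : C) : Prop :=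
  exists lm : C,
    is_fp_curve (H_num M a zeta m m th) (fun sg => Cexp ((a + Ci) * sg))
                (- r) r 0 lm /\
    l = (lm + Csum M (fun k =>
                if Nat.eqb k m then RtoC 0
                else RInt_C (fun sg => H_num M a zeta m k th sg
                                       / H_den M a m k sg) (- r) r))%C.

(** [h = H_m zeta (th)]; in particular all the finite parts and the limit
    defining [H_m zeta (th)] exist. *)
Definition is_H (M : nat) (a g : R) (zeta : nat -> R -> C) (m : nat)
    (th : R) (h : C) : Prop :=
  exists (J : R -> C) (l : C),
    (forall r : R, 0 < r -> is_H_trunc M a zeta m th r (J r)) /\
    filterlim J (Rbar_locally p_infty) (locally l) /\
    h = (a * g / (PI * Ci) * l)%C.

Definition linearized_BR (M : nat) (a mu g : R) (zeta : nat -> R -> R -> C)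
    : Prop :=
  forall (m : nat) (t th : R), (m < M)%nat -> 0 < t ->
    exists dt dth h : C,
      is_derive_RC (fun s => Cconj (zeta m s th)) t dt /\
      is_derive_RC (fun x => Cconj (zeta m t x)) th dth /\
      is_H M a g (fun k => zeta k t) m th h /\
      (t * dt - RtoC ((2 * mu - 1) / (2 * a)) * dth = - h)%C.

(** * The perturbation and the reduced system *)

Definition zeta_mode (s : R) (M : nat) (a mu alpha : R) (m : nat) (t th : R)
    : C :=
  Cexp (s * Ci * alpha
        * RtoC (2 * a * (th - theta M m) + (2 * mu - 1) * ln t))%C.

Definition perturbation (M : nat) (a mu alpha : R) (X Y : nat -> R -> C)
    (m : nat) (t th : R) : C :=
  (X m t * zeta_mode 1 M a mu alpha m t th * Cexp (Ci * th)
   + Y m t * zeta_mode (-1) M a mu alpha m t th * Cexp (Ci * th))%C.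

Definition reduced_system (M : nat) (a mu g alpha : R) (X Y : nat -> R -> C)
    : Prop :=
  forall (m : nat) (t : R), (m < M)%nat -> 0 < t ->
    exists dX dY : C,
      is_derive_RC (X m) t dX /\
      is_derive_RC (Y m) t dY /\
      (t * dX + Ci * RtoC ((1 - 2 * mu) / (2 * a)) * X m t
       = - (Cconj (c0_coef M a g) * Cconj (Y m t))
         + g * Csum M (fun k => Cconj (c_coef (-1) M a alpha m k)
                                * Cconj (Y k t)))%C /\
      (t * dY + Ci * RtoC ((1 - 2 * mu) / (2 * a)) * Y m t
       = - (Cconj (c0_coef M a g) * Cconj (X m t))
         + g * Csum M (fun k => Cconj (c_coef 1 M a alpha m k)
                                * Cconj (X k t)))%C.

(* Main.v *)
From Stdlib Require Import Lra Lia Compare_dec.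
Require Import Defs.

(** Write [p = a + i], [D = Delta M k m] and [w = e^{p s + i D}]. On an
    Alexander spiral both modes are exponentials in the integration variable,
    so that the [k]-th integrand of [H_m] is [e^{-i theta}] times a combination
    of the kernels [e^{c s} w / (1 - w)^2] with [c = a + i kappa]: the term
    [zeta_m] gives [kappa = -1], and the two modes of [zeta_k] give
    [kappa = 2 a alpha] and [kappa = - 2 a alpha] ([perturbation_H]).

    Integration by parts reduces this double pole to the simple one:
    [p e^{c s} w / (1 - w)^2 = (d/ds - c) (e^{c s} / (1 - w))]. Now
    [e^{c s} / (1 - w) = e^{B D} F(p s + i D)] with [F(u) = e^{b u} / (1 - e^u)],
    [b = c / p] and [B = - i b], so that a change of [D] only shifts the line on
    which the meromorphic function [F] is integrated. By Cauchy's theorem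
    ([cauchy_parallelogram]) the integral is [e^{B D}] times a constant, up to
    the contribution of the ends of the line, as long as no pole is met. At
    [D = 0] the line passes through the pole [u = 0]: the integrals just above
    and just below differ from the principal value by half a residue
    ([horizontal_line_pos], [horizontal_line_neg]). The constant is then forced
    by the period [2 i PI] of [1 - e^u], which makes the values for [D = PI] and
    [D = - PI] agree ([principal_value_lim]). This produces the factors
    [e^{D B}], [e^{- PI B}], [cosh (PI B)], [e^{PI B}] and [1 / sinh (PI B)] of the
    coefficients. Since [Re B] is a nonzero multiple of [kappa - 1], the denominator
    vanishes only for [kappa = 1], which [alpha > 0] and [alpha <> 1 / (2 a)]
    exclude.

    As [Re c = a], the integrand does not decay at [+ oo]: the integral over
    [[-r, r]] contains a term that oscillates with [r] and depends on the branch
    only through the factor [e^{- i D}] ([double_integral_lim]). It disappears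
    after summation over [k], for the modes because [sum_k X_k e^{- i theta_k}]
    and [sum_k Y_k e^{- i theta_k}] vanish, and for the term [zeta_m] because the
    squares of the [M]-th roots of unity sum to zero when [M >= 3]. The sum for
    [kappa = -1] telescopes to [coth (PI A / M)], which is the factor in [c_0]
    ([coth_sum]).

    Finally the transport operator on the left of the equation annihilates both
    modes, and conjugation exchanges them. The equation thus says that
    [zeta_m^+ P + zeta_m^- Q = 0], where [P] and [Q] are the residuals of the two
    reduced equations ([perturbation_BR]); two values of [theta] at which the
    modes are [(1, 1)] and [(i, - i)] show that [P = Q = 0]. *)

(** * The complex exponential *)

Lemma C_eq (z w : C) : Re z = Re w -> Im z = Im w -> z = w.
Proof. destruct z, w; simpl; intros; subst; reflexivity. Qed.

Lemma Cexp_plus (z w : C) : Cexp (z + w) = (Cexp z * Cexp w)%C.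
Proof.
  unfold Cexp; apply C_eq; unfold Cmult, Cplus, Re, Im; simpl; rewrite exp_plus, ?cos_plus, ?sin_plus; ring.
Qed.

Lemma Cexp_0 : Cexp 0 = 1.
Proof. unfold Cexp; simpl; rewrite exp_0, cos_0, sin_0, !Rmult_1_l; reflexivity. Qed.

Lemma Cmod_Cexp (z : C) : Cmod (Cexp z) = exp (Re z).
Proof.
  unfold Cmod, Cexp; simpl.
  replace (_ + _) with (Rsqr (exp (Re z))).
  { apply sqrt_Rsqr; left; apply exp_pos. }
  generalize (sin2_cos2 (Im z)); unfold Rsqr, Im; intros H.
  transitivity (exp (Re z) * exp (Re z) * (sin (snd z) * sin (snd z) + cos (snd z) * cos (snd z))).
  rewrite H; ring. simpl; ring.
Qed.

Lemma Cexp_neq_0 (z : C) : Cexp z <> 0.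
Proof.
  intros H; apply (Rlt_irrefl 0); rewrite <- Cmod_0 at 2; rewrite <- H, Cmod_Cexp; apply exp_pos.
Qed.

Lemma Cexp_opp (z : C) : Cexp (- z) = (/ Cexp z)%C.
Proof.
  assert (H := Cexp_neq_0 z).
  assert (E : (Cexp (- z) * Cexp z = 1)%C).
  { rewrite <- Cexp_plus, <- Cexp_0; f_equal; ring. }
  transitivity ((Cexp (- z) * Cexp z) * / Cexp z)%C; [field; auto | rewrite E; ring].
Qed.

Lemma Cexp_Ci (x : R) : Cexp (Ci * x) = (cos x, sin x).
Proof. apply C_eq; simpl; replace (0 * x - 1 * 0) with 0 by ring; rewrite exp_0;
 replace (0 * 0 + 1 * x) with x by ring; ring. Qed.

Lemma Cexp_2PI (z : C) : Cexp (z + Ci * RtoC (2 * PI)) = Cexp z.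
Proof.
  rewrite Cexp_plus, Cexp_Ci, cos_2PI, sin_2PI; exact (Cmult_1_r _).
Qed.

Lemma Cconj_Cexp (z : C) : Cconj (Cexp z) = Cexp (Cconj z).
Proof. apply C_eq; unfold Cexp, Cconj, Re, Im; simpl; rewrite ?cos_neg, ?sin_neg; ring. Qed.

Lemma Cexp_eq_1 (z : C) : Cexp z = 1 -> Re z = 0 /\ cos (Im z) = 1.
Proof.
  intros H.
  assert (H1 : Re z = 0).
  { apply exp_inv; rewrite <- Cmod_Cexp, H, Cmod_1, exp_0; reflexivity. }
  split; auto.
  apply (f_equal fst) in H; simpl in H; rewrite H1, exp_0 in H; lra.
Qed.

(** * Limits of complex-valued functions *)

Definition limC {T : Type} (F : (T -> Prop) -> Prop) (f : T -> C) (l : C) : Prop :=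
  filterlim f F (locally (T := C_UniformSpace) l).

Lemma limC_pair {T} (F : (T -> Prop) -> Prop) {FF : Filter F} (f : T -> C) (l : C) :
  filterlim (fun x => Re (f x)) F (locally (Re l)) ->
  filterlim (fun x => Im (f x)) F (locally (Im l)) -> limC F f l.
Proof.
  intros H1 H2; apply filterlim_locally; intros eps.
  specialize (proj1 (filterlim_locally _ _) H1 eps); intros K1.
  specialize (proj1 (filterlim_locally _ _) H2 eps); intros K2.
  generalize (filter_and _ _ K1 K2); apply filter_imp; intros y [A B]; split; assumption.
Qed.

Lemma limC_Re {T} (F : (T -> Prop) -> Prop) {FF : Filter F} (f : T -> C) (l : C) :
  limC F f l -> filterlim (fun x => Re (f x)) F (locally (Re l)).
Proof.
  intros H1; apply filterlim_locally; intros eps.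
  specialize (proj1 (filterlim_locally _ _) H1 eps); apply filter_imp; intros y [A B]; assumption.
Qed.

Lemma limC_Im {T} (F : (T -> Prop) -> Prop) {FF : Filter F} (f : T -> C) (l : C) :
  limC F f l -> filterlim (fun x => Im (f x)) F (locally (Im l)).
Proof.
  intros H1; apply filterlim_locally; intros eps.
  specialize (proj1 (filterlim_locally _ _) H1 eps); apply filter_imp; intros y [A B]; assumption.
Qed.

Lemma limR_plus {T} (F : (T -> Prop) -> Prop) {FF : Filter F} (f g : T -> R) (l m : R) :
  filterlim f F (locally l) -> filterlim g F (locally m) ->
  filterlim (fun x => f x + g x) F (locally (l + m)).
Proof.
  intros Hf Hg. apply (filterlim_comp_2 (G := locally l) (H := locally m) f g Rplus Hf Hg).
  apply (filterlim_plus (V := R_NormedModule)).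
Qed.

Lemma limR_mult {T} (F : (T -> Prop) -> Prop) {FF : Filter F} (f g : T -> R) (l m : R) :
  filterlim f F (locally l) -> filterlim g F (locally m) ->
  filterlim (fun x => f x * g x) F (locally (l * m)).
Proof.
  intros Hf Hg. apply (filterlim_comp_2 (G := locally l) (H := locally m) f g Rmult Hf Hg).
  apply (filterlim_mult (K := R_AbsRing)).
Qed.

Lemma limR_opp {T} (F : (T -> Prop) -> Prop) {FF : Filter F} (f : T -> R) (l : R) :
  filterlim f F (locally l) -> filterlim (fun x => - f x) F (locally (- l)).
Proof.
  intros Hf. apply (filterlim_comp _ _ _ f Ropp F (locally l)); auto.
  apply (filterlim_opp (V := R_NormedModule)).
Qed.

Lemma limC_plus {T} (F : (T -> Prop) -> Prop) {FF : Filter F} (f g : T -> C) (l m : C) :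
  limC F f l -> limC F g m -> limC F (fun x => f x + g x)%C (l + m)%C.
Proof.
  intros Hf Hg; apply limC_pair; auto; apply (limR_plus F); auto using limC_Re, limC_Im.
  all: first [apply limC_Re | apply limC_Im]; auto.
Qed.

Lemma limC_opp {T} (F : (T -> Prop) -> Prop) {FF : Filter F} (f : T -> C) (l : C) :
  limC F f l -> limC F (fun x => - f x)%C (- l)%C.
Proof.
  intros Hf; apply limC_pair; auto; apply (limR_opp F); [apply limC_Re | apply limC_Im]; auto.
Qed.

Lemma limC_minus {T} (F : (T -> Prop) -> Prop) {FF : Filter F} (f g : T -> C) (l m : C) :
  limC F f l -> limC F g m -> limC F (fun x => f x - g x)%C (l - m)%C.
Proof. intros; apply limC_plus; auto; apply limC_opp; auto. Qed.

Lemma limC_mult {T} (F : (T -> Prop) -> Prop) {FF : Filter F} (f g : T -> C) (l m : C) :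
  limC F f l -> limC F g m -> limC F (fun x => f x * g x)%C (l * m)%C.
Proof.
  intros Hf Hg; assert (H1 := limC_Re F f l Hf). assert (H2 := limC_Im F f l Hf).
  assert (H3 := limC_Re F g m Hg). assert (H4 := limC_Im F g m Hg).
  apply limC_pair; auto.
  - apply (limR_plus F); [|apply (limR_opp F)]; apply (limR_mult F); auto.
  - apply (limR_plus F); apply (limR_mult F); auto.
Qed.

Lemma limC_const {T} (F : (T -> Prop) -> Prop) {FF : Filter F} (l : C) :
  limC F (fun _ => l) l.
Proof. apply filterlim_const. Qed.

Lemma limC_scal {T} (F : (T -> Prop) -> Prop) {FF : Filter F} (z : C) (f : T -> C) (l : C) :
  limC F f l -> limC F (fun x => z * f x)%C (z * l)%C.
Proof. intros; apply limC_mult; auto using limC_const. Qed.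

Lemma limC_ext {T} (F : (T -> Prop) -> Prop) {FF : Filter F} (f g : T -> C) (l : C) :
  F (fun x => f x = g x) -> limC F f l -> limC F g l.
Proof. apply filterlim_ext_loc. Qed.

Lemma limC_unique {T} (F : (T -> Prop) -> Prop) {FF : ProperFilter F} (f : T -> C) (l m : C) :
  limC F f l -> limC F f m -> l = m.
Proof. apply (filterlim_locally_unique (V := C_R_NormedModule)). Qed.

Lemma limC_bound {T} (F : (T -> Prop) -> Prop) {FF : Filter F} (f : T -> C) (g : T -> R) (l : C) :
  F (fun x => Cmod (f x - l) <= g x) -> filterlim g F (locally 0) -> limC F f l.
Proof.
  intros H Hg; apply filterlim_locally; intros eps.
  generalize (filter_and _ _ H (proj1 (filterlim_locally _ _) Hg eps)).
  apply filter_imp; intros x [A B].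
  assert (B' : Rabs (g x - 0) < eps) by exact B.
  rewrite Rminus_0_r in B'. apply Rabs_def2 in B'.
  assert (M := Rmax_Cmod (f x - l)%C).
  split; simpl.
  - change (Rabs (fst (f x) - fst l) < eps).
    assert (X := Rmax_l (Rabs (fst (f x - l)%C)) (Rabs (snd (f x - l)%C))). simpl in X, M.
    unfold Rminus; lra.
  - change (Rabs (snd (f x) - snd l) < eps).
    assert (X := Rmax_r (Rabs (fst (f x - l)%C)) (Rabs (snd (f x - l)%C))). simpl in X, M.
    unfold Rminus; lra.
Qed.

(** * Continuity of complex-valued functions *)

Lemma continuous_pair_C {U : UniformSpace} (f : U -> C) (x : U) :
  continuous (U := R_UniformSpace) (fun y => Re (f y)) x ->
  continuous (U := R_UniformSpace) (fun y => Im (f y)) x ->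
  continuous (U := C_UniformSpace) f x.
Proof. apply limC_pair. typeclasses eauto. Qed.

Lemma continuous_Re {U : UniformSpace} (f : U -> C) (x : U) :
  continuous (U := C_UniformSpace) f x ->
  continuous (U := R_UniformSpace) (fun y => Re (f y)) x.
Proof. apply limC_Re. typeclasses eauto. Qed.

Lemma continuous_Im {U : UniformSpace} (f : U -> C) (x : U) :
  continuous (U := C_UniformSpace) f x ->
  continuous (U := R_UniformSpace) (fun y => Im (f y)) x.
Proof. apply limC_Im. typeclasses eauto. Qed.

Lemma continuous_Rmult {U : UniformSpace} (f g : U -> R) (x : U) :
  continuous f x -> continuous g x -> continuous (fun y => f y * g y) x.
Proof. intros; apply (continuous_mult (K := R_AbsRing)); assumption. Qed.

Lemma continuous_Rplus {U : UniformSpace} (f g : U -> R) (x : U) :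
  continuous f x -> continuous g x -> continuous (fun y => f y + g y) x.
Proof. intros; apply (continuous_plus (V := R_NormedModule)); assumption. Qed.

Lemma continuous_Ropp {U : UniformSpace} (f : U -> R) (x : U) :
  continuous f x -> continuous (fun y => - f y) x.
Proof. intros; apply (continuous_opp (V := R_NormedModule)); assumption. Qed.

Lemma continuous_Cplus {U : UniformSpace} (f g : U -> C) (x : U) :
  continuous f x -> continuous g x -> continuous (fun y => (f y + g y)%C) x.
Proof. apply limC_plus. typeclasses eauto. Qed.

Lemma continuous_Cminus {U : UniformSpace} (f g : U -> C) (x : U) :
  continuous f x -> continuous g x -> continuous (fun y => (f y - g y)%C) x.
Proof. apply limC_minus. typeclasses eauto. Qed.

Lemma continuous_Cmult {U : UniformSpace} (f g : U -> C) (x : U) :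
  continuous f x -> continuous g x -> continuous (fun y => (f y * g y)%C) x.
Proof. apply limC_mult. typeclasses eauto. Qed.

Lemma continuous_Cinv {U : UniformSpace} (f : U -> C) (x : U) :
  continuous f x -> f x <> 0 -> continuous (fun y => (/ f y)%C) x.
Proof.
  intros Hf Hx.
  assert (Hi : continuous (fun y => / (Re (f y) * Re (f y) + Im (f y) * Im (f y))) x).
  { apply (continuous_comp (fun y => Re (f y) * Re (f y) + Im (f y) * Im (f y)) Rinv).
    - apply continuous_Rplus; apply continuous_Rmult;
      first [apply (continuous_Re f) |apply (continuous_Im f)]; assumption.
    - apply continuous_Rinv. intros E; apply Hx.
      apply Rplus_sqr_eq_0 in E; apply C_eq; apply E. }
  apply continuous_pair_C.
  - apply (continuous_ext (fun y => Re (f y) * / (Re (f y) * Re (f y) + Im (f y) * Im (f y)))).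
    { intros y; simpl; unfold Re, Im, Rdiv; now rewrite !Rmult_1_r. }
    apply continuous_Rmult; auto using continuous_Re.
  - apply (continuous_ext (fun y => - Im (f y) * / (Re (f y) * Re (f y) + Im (f y) * Im (f y)))).
    { intros y; simpl; unfold Re, Im, Rdiv; now rewrite !Rmult_1_r. }
    apply continuous_Rmult; auto using continuous_Ropp, continuous_Im.
Qed.

Lemma limC_inv {T} (F : (T -> Prop) -> Prop) {FF : Filter F} (f : T -> C) (l : C) :
  limC F f l -> l <> 0 -> limC F (fun x => / f x)%C (/ l)%C.
Proof.
  intros H Hl. apply (filterlim_comp _ _ _ f Cinv F (locally (T := C_UniformSpace) l)); auto.
  apply (continuous_Cinv (U := C_UniformSpace) (fun z => z) l); auto. apply continuous_id.
Qed.

Lemma continuous_Cdiv {U : UniformSpace} (f g : U -> C) (x : U) :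
  continuous f x -> continuous g x -> g x <> 0 -> continuous (fun y => (f y / g y)%C) x.
Proof. intros; apply continuous_Cmult; [|apply continuous_Cinv]; assumption. Qed.

Lemma continuous_Cexp {U : UniformSpace} (f : U -> C) (x : U) :
  continuous f x -> continuous (fun y => Cexp (f y)) x.
Proof.
  intros Hf.
  assert (H1 : continuous (fun y => exp (Re (f y))) x).
  { apply (continuous_comp (fun y => Re (f y)) exp); [apply continuous_Re; auto|].
    apply continuity_pt_filterlim, derivable_continuous_pt, derivable_pt_exp. }
  assert (H2 : continuous (fun y => cos (Im (f y))) x).
  { apply (continuous_comp (fun y => Im (f y)) cos); [apply continuous_Im; auto| apply continuous_cos]. }
  assert (H3 : continuous (fun y => sin (Im (f y))) x).
  { apply (continuous_comp (fun y => Im (f y)) sin); [apply continuous_Im; auto| apply continuous_sin]. }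
  apply continuous_pair_C; apply continuous_Rmult; assumption.
Qed.

(** * Derivatives of complex-valued functions *)

Lemma is_derive_RC_pair (f : R -> C) (t : R) (l : C) :
  is_derive (fun s => Re (f s)) t (Re l) -> is_derive (fun s => Im (f s)) t (Im l) ->
  is_derive_RC f t l.
Proof.
  intros H1 H2.
  unfold is_derive_RC, is_derive.
  generalize (filterdiff_comp'_2 (fun s => Re (f s)) (fun s => Im (f s))
   (fun x y => (x, y) : C_R_NormedModule) t _ _ (fun x y => (x, y) : C_R_NormedModule) H1 H2).
  intros K.
  apply (filterdiff_ext (fun t => (Re (f t), Im (f t)))).
  { intros y; now destruct (f y). }
  eapply filterdiff_ext_lin.
  - apply K.
    apply (filterdiff_ext (U := prod_NormedModule _ R_NormedModule R_NormedModule) (V := C_R_NormedModule) (fun z => z)).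
    { now intros []. }
    apply (filterdiff_ext_lin _ (fun z => z)). apply filterdiff_id.
    now intros [].
  - intros y; destruct l; reflexivity.
Qed.

Lemma is_derive_RC_Re (f : R -> C) (t : R) (l : C) :
  is_derive_RC f t l -> is_derive (fun s => Re (f s)) t (Re l).
Proof.
  intros H. unfold is_derive.
  generalize (filterdiff_comp' f (fst : C_R_NormedModule -> R_NormedModule) t _ fst H
    (filterdiff_linear _ (is_linear_fst))).
  intros K; eapply filterdiff_ext_lin; [apply K|]. now intros y; destruct l.
Qed.

Lemma is_derive_RC_Im (f : R -> C) (t : R) (l : C) :
  is_derive_RC f t l -> is_derive (fun s => Im (f s)) t (Im l).
Proof.
  intros H. unfold is_derive.
  generalize (filterdiff_comp' f (snd : C_R_NormedModule -> R_NormedModule) t _ snd H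
    (filterdiff_linear _ (is_linear_snd))).
  intros K; eapply filterdiff_ext_lin; [apply K|]. now intros y; destruct l.
Qed.

Lemma is_derive_RC_unique (f : R -> C) (t : R) (l l' : C) :
  is_derive_RC f t l -> is_derive_RC f t l' -> l = l'.
Proof.
  intros H H'. apply C_eq.
  - rewrite <- (is_derive_unique _ _ _ (is_derive_RC_Re _ _ _ H)).
    apply (is_derive_unique _ _ _ (is_derive_RC_Re _ _ _ H')).
  - rewrite <- (is_derive_unique _ _ _ (is_derive_RC_Im _ _ _ H)).
    apply (is_derive_unique _ _ _ (is_derive_RC_Im _ _ _ H')).
Qed.

Lemma is_derive_RC_continuous (f : R -> C) (t : R) (l : C) :
  is_derive_RC f t l -> continuous f t.
Proof. intros H. apply (ex_derive_continuous (V := C_R_NormedModule)). exists l; exact H. Qed.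

Lemma is_derive_RC_const (z : C) (t : R) : is_derive_RC (fun _ => z) t 0.
Proof. apply (is_derive_const (V := C_R_NormedModule)). Qed.

Lemma is_derive_RC_plus (f g : R -> C) (t : R) (l m : C) :
  is_derive_RC f t l -> is_derive_RC g t m -> is_derive_RC (fun s => f s + g s)%C t (l + m)%C.
Proof. apply (is_derive_plus (V := C_R_NormedModule)). Qed.

Lemma is_derive_RC_mult (f g : R -> C) (t : R) (l m : C) :
  is_derive_RC f t l -> is_derive_RC g t m ->
  is_derive_RC (fun s => f s * g s)%C t (l * g t + f t * m)%C.
Proof.
  intros Hf Hg.
  assert (F1 := is_derive_RC_Re _ _ _ Hf). assert (F2 := is_derive_RC_Im _ _ _ Hf).
  assert (G1 := is_derive_RC_Re _ _ _ Hg). assert (G2 := is_derive_RC_Im _ _ _ Hg).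
  assert (M : forall (u v : R -> R) du dv, is_derive u t du -> is_derive v t dv ->
    is_derive (fun s => u s * v s) t (du * v t + u t * dv)).
  { intros; apply (is_derive_mult (K := R_AbsRing)); auto. intros; apply Rmult_comm. }
  apply is_derive_RC_pair.
  - match goal with |- is_derive _ _ ?r => replace r with ((Re l * Re (g t) + Re (f t) * Re m) - (Im l * Im (g t) + Im (f t) * Im m))
      by (unfold Re, Im; simpl; ring) end.
    apply (is_derive_minus (V := R_NormedModule)); apply M; assumption.
  - match goal with |- is_derive _ _ ?r => replace r with ((Re l * Im (g t) + Re (f t) * Im m) + (Im l * Re (g t) + Im (f t) * Re m))
      by (unfold Re, Im; simpl; ring) end.
    apply (is_derive_plus (V := R_NormedModule)); apply M; assumption.
Qed.

Lemma is_derive_RC_inv (f : R -> C) (t : R) (l : C) :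
  is_derive_RC f t l -> f t <> 0 -> is_derive_RC (fun s => / f s)%C t (- l / (f t * f t))%C.
Proof.
  intros Hf Hn.
  assert (F1 := is_derive_RC_Re _ _ _ Hf). assert (F2 := is_derive_RC_Im _ _ _ Hf).
  assert (N : Re (f t) * Re (f t) + Im (f t) * Im (f t) <> 0).
  { intros E; apply Hn; apply Rplus_sqr_eq_0 in E; apply C_eq; apply E. }
  assert (Q : forall (u v w : R -> R) du dv dw, is_derive u t du -> is_derive v t dv ->
    is_derive w t dw -> u t * u t + v t * v t <> 0 ->
    is_derive (fun s => w s / (u s * u s + v s * v s)) t
     ((dw * (u t * u t + v t * v t) - w t * (2 * u t * du + 2 * v t * dv))
       / (u t * u t + v t * v t) ^ 2)).
  { intros u v w du dv dw Hu Hv Hw HN.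
    assert (E1 : Derive (fun x => u x) t = du) by (apply is_derive_unique; exact Hu). assert (E2 : Derive (fun x => v x) t = dv) by (apply is_derive_unique; exact Hv).
    assert (E3 : Derive (fun x => w x) t = dw) by (apply is_derive_unique; exact Hw).
    auto_derive.
    - repeat split; auto; eexists; eassumption.
    - rewrite E1, E2, E3; field; auto. }
  apply is_derive_RC_pair.
  - apply (is_derive_ext (fun s => Re (f s) / (Re (f s) * Re (f s) + Im (f s) * Im (f s)))).
    { intros s; simpl; now rewrite !Rmult_1_r. }
    match goal with |- is_derive _ _ ?r => replace r with
     ((Re l * (Re (f t) * Re (f t) + Im (f t) * Im (f t)) - Re (f t) * (2 * Re (f t) * Re l + 2 * Im (f t) * Im l))
       / (Re (f t) * Re (f t) + Im (f t) * Im (f t)) ^ 2) end.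
    { apply (Q (fun s => Re (f s)) (fun s => Im (f s)) (fun s => Re (f s))); auto. }
    unfold Re, Im in *; simpl; field. split; [|exact N].
    match goal with |- ?x <> 0 =>
      replace x with ((fst (f t) * fst (f t) + snd (f t) * snd (f t)) ^ 2) by ring end.
    now apply pow_nonzero.
  - apply (is_derive_ext (fun s => - Im (f s) / (Re (f s) * Re (f s) + Im (f s) * Im (f s)))).
    { intros s; simpl; now rewrite !Rmult_1_r. }
    match goal with |- is_derive _ _ ?r => replace r with
     ((- Im l * (Re (f t) * Re (f t) + Im (f t) * Im (f t)) - - Im (f t) * (2 * Re (f t) * Re l + 2 * Im (f t) * Im l))
       / (Re (f t) * Re (f t) + Im (f t) * Im (f t)) ^ 2) end.
    { apply (Q (fun s => Re (f s)) (fun s => Im (f s)) (fun s => - Im (f s))); auto.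
      apply (is_derive_opp (V := R_NormedModule)); auto. }
    unfold Re, Im in *; simpl; field. split; [|exact N].
    match goal with |- ?x <> 0 =>
      replace x with ((fst (f t) * fst (f t) + snd (f t) * snd (f t)) ^ 2) by ring end.
    now apply pow_nonzero.
Qed.

Lemma is_derive_RC_Cexp (f : R -> C) (t : R) (l : C) :
  is_derive_RC f t l -> is_derive_RC (fun s => Cexp (f s)) t (l * Cexp (f t))%C.
Proof.
  intros Hf.
  assert (F1 := is_derive_RC_Re _ _ _ Hf). assert (F2 := is_derive_RC_Im _ _ _ Hf).
  assert (Q : forall (u v : R -> R) du dv, is_derive u t du -> is_derive v t dv ->
    is_derive (fun s => exp (u s) * cos (v s)) t (exp (u t) * (du * cos (v t) - dv * sin (v t))) /\
    is_derive (fun s => exp (u s) * sin (v s)) t (exp (u t) * (du * sin (v t) + dv * cos (v t)))).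
  { intros u v du dv Hu Hv.
    assert (E1 : Derive (fun x => u x) t = du) by (apply is_derive_unique; exact Hu). assert (E2 : Derive (fun x => v x) t = dv) by (apply is_derive_unique; exact Hv).
    split; auto_derive; try (repeat split; auto; eexists; eassumption);
      rewrite E1, E2; ring. }
  destruct (Q _ _ _ _ F1 F2) as [Q1 Q2].
  apply is_derive_RC_pair.
  - match goal with |- is_derive _ _ ?r => match type of Q1 with is_derive _ _ ?r' =>
     replace r with r' by (simpl; unfold Re, Im; ring) end end; exact Q1.
  - match goal with |- is_derive _ _ ?r => match type of Q2 with is_derive _ _ ?r' =>
     replace r with r' by (simpl; unfold Re, Im; ring) end end; exact Q2.
Qed.

Lemma is_derive_RC_RtoC (f : R -> R) (t l : R) :
  is_derive f t l -> is_derive_RC (fun s => RtoC (f s)) t l.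
Proof. intros H; apply is_derive_RC_pair; simpl; [assumption|]. apply (is_derive_const (V := R_NormedModule)). Qed.

Lemma is_derive_RC_conj (f : R -> C) (t : R) (l : C) :
  is_derive_RC f t l -> is_derive_RC (fun s => Cconj (f s)) t (Cconj l).
Proof.
  intros Hf; apply is_derive_RC_pair; simpl.
  - apply (is_derive_RC_Re _ _ _ Hf).
  - apply (is_derive_opp (V := R_NormedModule)), (is_derive_RC_Im _ _ _ Hf).
Qed.

(** * Integrals of complex-valued functions *)

Definition is_RInt_RC (f : R -> C) (p q : R) (l : C) : Prop :=
  is_RInt (V := C_R_NormedModule) f p q l.

Lemma is_RInt_RC_pair (f : R -> C) (p q : R) (l : C) :
  is_RInt (V := R_NormedModule) (fun s => Re (f s)) p q (Re l) ->
  is_RInt (V := R_NormedModule) (fun s => Im (f s)) p q (Im l) -> is_RInt_RC f p q l.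
Proof.
  intros H1 H2. destruct l.
  apply (is_RInt_fct_extend_pair (U := R_NormedModule) (V := R_NormedModule)); assumption.
Qed.

Lemma is_RInt_RC_Re (f : R -> C) (p q : R) (l : C) : is_RInt_RC f p q l ->
  is_RInt (V := R_NormedModule) (fun s => Re (f s)) p q (Re l).
Proof. apply (is_RInt_fct_extend_fst (U := R_NormedModule) (V := R_NormedModule)). Qed.

Lemma is_RInt_RC_Im (f : R -> C) (p q : R) (l : C) : is_RInt_RC f p q l ->
  is_RInt (V := R_NormedModule) (fun s => Im (f s)) p q (Im l).
Proof. apply (is_RInt_fct_extend_snd (U := R_NormedModule) (V := R_NormedModule)). Qed.

Lemma is_RInt_RC_unique (f : R -> C) (p q : R) (l : C) :
  is_RInt_RC f p q l -> RInt_C f p q = l.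
Proof. apply (is_RInt_unique (V := C_R_CompleteNormedModule)). Qed.

Lemma RInt_RC_correct (f : R -> C) (p q : R) :
  (forall s, Rmin p q <= s <= Rmax p q -> continuous f s) -> is_RInt_RC f p q (RInt_C f p q).
Proof.
  intros H; apply (RInt_correct (V := C_R_CompleteNormedModule)), ex_RInt_continuous; assumption.
Qed.

Lemma is_RInt_RC_plus (f g : R -> C) (p q : R) (l m : C) :
  is_RInt_RC f p q l -> is_RInt_RC g p q m -> is_RInt_RC (fun s => f s + g s)%C p q (l + m)%C.
Proof. apply (is_RInt_plus (V := C_R_NormedModule)). Qed.

Lemma is_RInt_RC_minus (f g : R -> C) (p q : R) (l m : C) :
  is_RInt_RC f p q l -> is_RInt_RC g p q m -> is_RInt_RC (fun s => f s - g s)%C p q (l - m)%C.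
Proof. apply (is_RInt_minus (V := C_R_NormedModule)). Qed.

Lemma is_RInt_RC_scal (z : C) (f : R -> C) (p q : R) (l : C) :
  is_RInt_RC f p q l -> is_RInt_RC (fun s => z * f s)%C p q (z * l)%C.
Proof.
  intros H. assert (H1 := is_RInt_RC_Re _ _ _ _ H). assert (H2 := is_RInt_RC_Im _ _ _ _ H).
  apply is_RInt_RC_pair.
  - apply (is_RInt_minus (V := R_NormedModule)); apply (is_RInt_scal (V := R_NormedModule)); assumption.
  - apply (is_RInt_plus (V := R_NormedModule)); apply (is_RInt_scal (V := R_NormedModule)); assumption.
Qed.

Lemma is_RInt_RC_ext (f g : R -> C) (p q : R) (l : C) :
  (forall s, Rmin p q < s < Rmax p q -> f s = g s) -> is_RInt_RC f p q l -> is_RInt_RC g p q l.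
Proof. apply (is_RInt_ext (V := C_R_NormedModule)). Qed.

Lemma is_RInt_RC_derive (f df : R -> C) (p q : R) :
  (forall s, Rmin p q <= s <= Rmax p q -> is_derive_RC f s (df s)) ->
  (forall s, Rmin p q <= s <= Rmax p q -> continuous df s) ->
  is_RInt_RC df p q (f q - f p)%C.
Proof. apply (is_RInt_derive (V := C_R_CompleteNormedModule)). Qed.

Lemma Cmod_RInt_le (f : R -> C) (p q K : R) (l : C) :
  p <= q -> (forall s, p <= s <= q -> Cmod (f s) <= K) -> is_RInt_RC f p q l ->
  Cmod l <= (q - p) * K.
Proof.
  intros Hpq HK H.
  rewrite Cmod_norm.
  apply (norm_RInt_le_const (V := C_R_NormedModule) f p q l K); auto.
  intros s Hs; rewrite <- (HK s Hs). rewrite Cmod_norm; apply Rle_refl.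
Qed.

(** * Cauchy's theorem on a parallelogram *)

Lemma locally_open_interval (lo hi y : R) (P : R -> Prop) :
  lo < y < hi -> (forall x, lo < x < hi -> P x) -> locally y P.
Proof.
  intros Hy HP.
  assert (H : 0 < Rmin (y - lo) (hi - y)) by (apply Rmin_pos; lra).
  exists (mkposreal _ H); intros x Hx; apply HP.
  assert (K : Rabs (x - y) < Rmin (y - lo) (hi - y)) by exact Hx.
  apply Rabs_def2 in K.
  generalize (Rmin_l (y - lo) (hi - y)) (Rmin_r (y - lo) (hi - y)); lra.
Qed.

(** The hypotheses are made on an open rectangle, larger than the domain of
    integration, because differentiation under the integral sign asks for the
    joint continuity of the derivative in a neighbourhood of each point. *)
Lemma is_derive_RInt_param_R (f df : R -> R -> R) (lo hi slo shi s1 s2 y : R) :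
  slo < s1 <= s2 -> s2 < shi -> lo < y < hi ->
  (forall s x, slo < s < shi -> lo < x < hi -> is_derive (fun x => f s x) x (df s x)) ->
  (forall s x, slo < s < shi -> lo < x < hi -> continuous (fun s => f s x) s) ->
  (forall s x, slo < s < shi -> lo < x < hi ->
     continuous (fun z : R * R => df (snd z) (fst z)) (x, s)) ->
  is_derive (fun x => RInt (fun s => f s x) s1 s2) y (RInt (fun s => df s y) s1 s2).
Proof.
  intros Hs Hs2 Hy Hd Hc Hdc.
  rewrite <- (RInt_ext (V := R_CompleteNormedModule) (fun s => Derive (fun x => f s x) y)).
  2:{ intros s; rewrite Rmin_left, Rmax_right by lra; intros Hs'.
      apply is_derive_unique, Hd; lra. }
  apply (is_derive_RInt_param (fun x s => f s x)).
  - apply (locally_open_interval lo hi); auto.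
    intros x Hx s; rewrite Rmin_left, Rmax_right by lra; intros Hs'.
    exists (df s x); apply Hd; lra.
  - intros s; rewrite Rmin_left, Rmax_right by lra; intros Hs'.
    apply (continuity_2d_pt_ext_loc (fun u v => df v u)).
    { assert (H1 : locally y (fun x => lo < x < hi)) by (apply (locally_open_interval lo hi); auto).
      assert (H2 : locally s (fun x => slo < x < shi)) by (apply (locally_open_interval slo shi); auto; lra).
      destruct H1 as [e1 H1], H2 as [e2 H2].
      assert (He : 0 < Rmin e1 e2) by (apply Rmin_pos; apply cond_pos).
      exists (mkposreal _ He); simpl; intros u v Hu Hv.
      symmetry; apply is_derive_unique, Hd.
      - apply H2. apply Rlt_le_trans with (1 := Hv), Rmin_r.
      - apply H1. apply Rlt_le_trans with (1 := Hu), Rmin_l. }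
    apply continuity_2d_pt_filterlim.
    apply (Hdc s y); lra.
  - apply (locally_open_interval lo hi); auto.
    intros x Hx; apply (ex_RInt_continuous (V := R_CompleteNormedModule)).
    intros s; rewrite Rmin_left, Rmax_right by lra; intros Hs'.
    apply (Hc s x); lra.
Qed.

Lemma RInt_C_comp (f : R -> C) (p q : R) :
  (forall s, Rmin p q <= s <= Rmax p q -> continuous f s) ->
  RInt_C f p q = (RInt (fun s => Re (f s)) p q, RInt (fun s => Im (f s)) p q).
Proof.
  intros H. apply is_RInt_RC_unique, is_RInt_RC_pair;
    apply (RInt_correct (V := R_CompleteNormedModule)), ex_RInt_continuous;
    intros s Hs; [apply continuous_Re | apply continuous_Im]; auto.
Qed.

Lemma is_derive_RInt_param_RC (f df : R -> R -> C) (lo hi slo shi s1 s2 y : R) :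
  slo < s1 <= s2 -> s2 < shi -> lo < y < hi ->
  (forall s x, slo < s < shi -> lo < x < hi -> is_derive_RC (fun x => f s x) x (df s x)) ->
  (forall s x, slo < s < shi -> lo < x < hi -> continuous (fun s => f s x) s) ->
  (forall s x, slo < s < shi -> lo < x < hi ->
     continuous (fun z : R * R => df (snd z) (fst z)) (x, s)) ->
  is_derive_RC (fun x => RInt_C (fun s => f s x) s1 s2) y (RInt_C (fun s => df s y) s1 s2).
Proof.
  intros Hs Hs2 Hy Hd Hc Hdc.
  assert (Hdc' : forall s x, slo < s < shi -> lo < x < hi -> continuous (fun s => df s x) s).
  { intros s x Hs' Hx.
    apply (continuous_comp (fun s => (x, s) : R * R) (fun z : R * R => df (snd z) (fst z))).
    - apply continuous_pair_C; simpl; [apply continuous_const | apply continuous_id].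
    - apply Hdc; auto. }
  rewrite (RInt_C_comp (fun s => df s y)).
  2:{ intros s; rewrite Rmin_left, Rmax_right by lra; intros; apply Hdc'; lra. }
  unfold is_derive_RC.
  apply (is_derive_ext_loc (V := C_R_NormedModule)
   (fun x => (RInt (fun s => Re (f s x)) s1 s2, RInt (fun s => Im (f s x)) s1 s2))).
  { apply (locally_open_interval lo hi); auto. intros x Hx; symmetry; apply RInt_C_comp.
    intros s; rewrite Rmin_left, Rmax_right by lra; intros; apply Hc; lra. }
  apply is_derive_RC_pair; simpl.
  - apply (is_derive_RInt_param_R (fun s x => Re (f s x)) (fun s x => Re (df s x)) lo hi slo shi); auto.
    + intros; apply (is_derive_RC_Re (fun x => f s x)); auto.
    + intros; apply continuous_Re; auto.
    + intros s x Hs' Hx; apply (continuous_Re (fun z : R * R => df (snd z) (fst z))), Hdc; auto.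
  - apply (is_derive_RInt_param_R (fun s x => Im (f s x)) (fun s x => Im (df s x)) lo hi slo shi); auto.
    + intros; apply (is_derive_RC_Im (fun x => f s x)); auto.
    + intros; apply continuous_Im; auto.
    + intros s x Hs' Hx; apply (continuous_Im (fun z : R * R => df (snd z) (fst z))), Hdc; auto.
Qed.

(** [Q s y] stands for [F (p s + i y)] and [D s y] for [F' (p s + i y)]. The
    [y]-derivative of [int Q s y ds] is [int i D s y ds], and [p D] is the
    [s]-derivative of [Q]: up to the factor [i / p] it is the difference of the
    values of [Q] at the two ends. Integrate this identity in [y]. *)
Lemma cauchy_parallelogram (p : C) (Q D : R -> R -> C) (lo hi slo shi s1 s2 y1 y2 : R) :
  slo < s1 <= s2 -> s2 < shi -> lo < y1 <= y2 -> y2 < hi ->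
  (forall s y, slo < s < shi -> lo < y < hi ->
     is_derive_RC (fun s => Q s y) s (p * D s y)%C) ->
  (forall s y, slo < s < shi -> lo < y < hi ->
     is_derive_RC (fun y => Q s y) y (Ci * D s y)%C) ->
  (forall s y, slo < s < shi -> lo < y < hi ->
     continuous (fun z : R * R => D (snd z) (fst z)) (y, s)) ->
  (p * (RInt_C (fun s => Q s y2) s1 s2 - RInt_C (fun s => Q s y1) s1 s2)
   = Ci * (RInt_C (fun y => Q s2 y) y1 y2 - RInt_C (fun y => Q s1 y) y1 y2))%C.
Proof.
  intros Hs Hs2 Hy Hy2 Hds Hdy HD.
  assert (HDs : forall s y, slo < s < shi -> lo < y < hi -> continuous (fun s => D s y) s).
  { intros s y Hs' Hx.
    apply (continuous_comp (fun s => (y, s) : R * R) (fun z : R * R => D (snd z) (fst z))).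
    - apply continuous_pair_C; simpl; [apply continuous_const | apply continuous_id].
    - apply HD; auto. }
  assert (Hg : forall y, y1 <= y <= y2 ->
    is_derive_RC (fun y => p * RInt_C (fun s => Q s y) s1 s2)%C y (Ci * (Q s2 y - Q s1 y))%C).
  { intros y Hy'.
    replace (Ci * (Q s2 y - Q s1 y))%C with
     (0 * RInt_C (fun s => Q s y) s1 s2 + p * RInt_C (fun s => Ci * D s y)%C s1 s2)%C.
    - apply (is_derive_RC_mult (fun _ => p) (fun y => RInt_C (fun s => Q s y) s1 s2)). apply is_derive_RC_const.
      apply (is_derive_RInt_param_RC Q (fun s y => Ci * D s y)%C lo hi slo shi); auto; try lra.
      + intros s x Hs' Hx; eapply is_derive_RC_continuous; apply Hds; auto.
      + intros s x Hs' Hx; apply continuous_Cmult; [apply continuous_const | apply HD; auto].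
    - assert (E : is_RInt_RC (fun s => p * D s y)%C s1 s2 (Q s2 y - Q s1 y)%C).
      { apply (is_RInt_RC_derive (fun s => Q s y) (fun s => p * D s y)%C);
        rewrite Rmin_left, Rmax_right by lra; intros s Hs'.
        - apply Hds; lra.
        - apply continuous_Cmult; [apply continuous_const | apply HDs; lra]. }
      assert (ED : is_RInt_RC (fun s => D s y) s1 s2 (RInt_C (fun s => D s y) s1 s2)).
      { apply RInt_RC_correct; rewrite Rmin_left, Rmax_right by lra; intros s Hs'. apply HDs; lra. }
      rewrite <- (is_RInt_RC_unique _ _ _ _ E).
      rewrite (is_RInt_RC_unique _ _ _ _ (is_RInt_RC_scal p _ _ _ _ ED)).
      rewrite (is_RInt_RC_unique _ _ _ _ (is_RInt_RC_scal Ci _ _ _ _ ED)). ring. }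
  assert (HQ : forall s, slo < s < shi -> forall y, y1 <= y <= y2 -> continuous (fun y => Q s y) y).
  { intros s Hs' y Hy'; eapply is_derive_RC_continuous; apply Hdy; lra. }
  assert (E : is_RInt_RC (fun y => Ci * (Q s2 y - Q s1 y))%C y1 y2
     (p * RInt_C (fun s => Q s y2) s1 s2 - p * RInt_C (fun s => Q s y1) s1 s2)%C).
  { apply (is_RInt_RC_derive (fun y => p * RInt_C (fun s => Q s y) s1 s2)%C);
     rewrite Rmin_left, Rmax_right by lra; intros y Hy'.
    - apply Hg; auto.
    - apply continuous_Cmult; [apply continuous_const |].
      apply continuous_Cminus; apply HQ; auto; lra. }
  assert (E2 : is_RInt_RC (fun y => Ci * (Q s2 y - Q s1 y))%C y1 y2
     (Ci * (RInt_C (fun y => Q s2 y) y1 y2 - RInt_C (fun y => Q s1 y) y1 y2))%C).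
  { apply is_RInt_RC_scal, is_RInt_RC_minus; apply RInt_RC_correct;
     rewrite Rmin_left, Rmax_right by lra; apply HQ; lra. }
  rewrite <- (is_RInt_RC_unique _ _ _ _ E2), (is_RInt_RC_unique _ _ _ _ E). ring.
Qed.

Lemma RInt_C_Chasles (f : R -> C) (p q r : R) :
  p <= q <= r -> (forall s, p <= s <= r -> continuous f s) ->
  (RInt_C f p q + RInt_C f q r = RInt_C f p r)%C.
Proof.
  intros H Hc.
  symmetry; apply is_RInt_RC_unique.
  apply (is_RInt_Chasles (V := C_R_NormedModule) f p q r); apply RInt_RC_correct;
    rewrite Rmin_left, Rmax_right by lra; intros; apply Hc; lra.
Qed.

(** * The meromorphic kernel *)

Definition kernel (b u : C) : C := (Cexp (b * u) / (1 - Cexp u))%C.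
Definition dkernel (b u : C) : C :=
  (kernel b u * (b + Cexp u / (1 - Cexp u)))%C.

Lemma is_derive_kernel (b l : C) (u : R -> C) (t : R) :
  is_derive_RC u t l -> (1 - Cexp (u t) <> 0)%C ->
  is_derive_RC (fun s => kernel b (u s)) t (l * dkernel b (u t))%C.
Proof.
  intros Hu Hn.
  assert (H1 : is_derive_RC (fun s => Cexp (b * u s))%C t ((0 * u t + b * l) * Cexp (b * u t))%C).
  { apply (is_derive_RC_Cexp (fun s => b * u s)%C), (is_derive_RC_mult (fun _ => b)); auto.
    apply is_derive_RC_const. }
  assert (H2 : is_derive_RC (fun s => 1 + (- (1)) * Cexp (u s))%C t
    (0 + (0 * Cexp (u t) + (- (1)) * (l * Cexp (u t))))%C).
  { apply is_derive_RC_plus. apply is_derive_RC_const.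
    apply (is_derive_RC_mult (fun _ => (- (1))%C) (fun s => Cexp (u s))).
    apply is_derive_RC_const. now apply is_derive_RC_Cexp. }
  assert (Hn' : (1 + - (1) * Cexp (u t) <> 0)%C).
  { intros E; apply Hn; rewrite <- E; ring. }
  apply is_derive_RC_inv in H2; auto.
  assert (H3 := is_derive_RC_mult _ _ _ _ _ H1 H2).
  unfold dkernel, kernel.
  match type of H3 with is_derive_RC _ _ ?r => match goal with |- is_derive_RC _ _ ?r' =>
    replace r' with r end end.
  - apply (is_derive_ext (V := C_R_NormedModule) (fun s => Cexp (b * u s) * / (1 + - (1) * Cexp (u s)))%C); auto.
    intros s. replace (1 - Cexp (u s))%C with (1 + - (1) * Cexp (u s))%C by ring. reflexivity.
  - field. repeat split; auto.
Qed.

Lemma continuous_kernel {U : UniformSpace} (b : C) (u : U -> C) (x : U) :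
  continuous u x -> (1 - Cexp (u x) <> 0)%C -> continuous (fun s => kernel b (u s)) x.
Proof.
  intros Hu Hn. apply continuous_Cdiv; auto.
  - apply continuous_Cexp, continuous_Cmult; auto. apply continuous_const.
  - apply continuous_Cminus; [apply continuous_const | apply continuous_Cexp; auto].
Qed.

Lemma continuous_dkernel {U : UniformSpace} (b : C) (u : U -> C) (x : U) :
  continuous u x -> (1 - Cexp (u x) <> 0)%C -> continuous (fun s => dkernel b (u s)) x.
Proof.
  intros Hu Hn. apply continuous_Cmult; [apply continuous_kernel; auto|].
  apply continuous_Cplus; [apply continuous_const|]. apply continuous_Cdiv; auto.
  - apply continuous_Cexp; auto.
  - apply continuous_Cminus; [apply continuous_const | apply continuous_Cexp; auto].
Qed.

(** The point [p s + i y] with [p = a + i]: for fixed [y] it runs through the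
    image of a line of integration, and [y] is an angle between branches. *)
Definition slant (a s y : R) : C := ((a + Ci) * s + Ci * y)%C.

Lemma slant_eq (a s y : R) : slant a s y = (a * s, s + y).
Proof. unfold slant, Ci, RtoC, Cmult, Cplus; simpl; f_equal; ring. Qed.

Lemma is_derive_slant_l (a s y : R) : is_derive_RC (fun s => slant a s y) s (a + Ci)%C.
Proof.
  apply (is_derive_ext (V := C_R_NormedModule) (fun s => (a * s, s + y))).
  { intros; symmetry; apply slant_eq. }
  apply is_derive_RC_pair; simpl; auto_derive; auto; ring.
Qed.

Lemma is_derive_slant_r (a s y : R) : is_derive_RC (fun y => slant a s y) y Ci.
Proof.
  apply (is_derive_ext (V := C_R_NormedModule) (fun y => (a * s, s + y))).
  { intros; symmetry; apply slant_eq. }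
  apply is_derive_RC_pair; simpl; auto_derive; auto; ring.
Qed.

Lemma continuous_slant {U : UniformSpace} (a : R) (f g : U -> R) (x : U) :
  continuous f x -> continuous g x -> continuous (fun z => slant a (f z) (g z)) x.
Proof.
  intros; apply (continuous_ext (fun z => (a * f z, f z + g z))).
  { intros; symmetry; apply slant_eq. }
  apply continuous_pair_C; simpl.
  - apply continuous_Rmult; auto; apply continuous_const.
  - apply continuous_Rplus; auto.
Qed.

Lemma cos_neq_1 (y : R) : 0 < Rabs y < 2 * PI -> cos y <> 1.
Proof.
  intros Hy E.
  assert (H : cos (Rabs y) = 1).
  { unfold Rabs; destruct Rcase_abs; rewrite ?cos_neg; auto. }
  replace (Rabs y) with (2 * (Rabs y / 2)) in H by field.
  rewrite cos_2a_sin in H.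
  assert (0 < sin (Rabs y / 2)) by (apply sin_gt_0; lra). nra.
Qed.

(** On these lines [e^u] has modulus [e^{a s}], so that the poles
    [2 i PI Z] of the kernel are met only at [s = 0]. *)
Lemma slant_regular (a s y : R) : 0 < a -> s <> 0 \/ cos y <> 1 ->
  (1 - Cexp (slant a s y) <> 0)%C.
Proof.
  intros Ha H E.
  assert (E1 : Cexp (slant a s y) = 1).
  { transitivity (1 - (1 - Cexp (slant a s y)))%C; [ring | rewrite E; ring]. }
  apply Cexp_eq_1 in E1; rewrite slant_eq in E1; simpl in E1; destruct E1 as [E1 E2].
  assert (s = 0) by nra. subst s. rewrite Rplus_0_l in E2. tauto.
Qed.

Lemma kernel_cauchy (a : R) (b : C) (lo hi slo shi s1 s2 y1 y2 : R) :
  0 < a -> slo < s1 <= s2 -> s2 < shi -> lo < y1 <= y2 -> y2 < hi ->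
  (forall s y, slo < s < shi -> lo < y < hi -> s <> 0 \/ cos y <> 1) ->
  ((a + Ci) * (RInt_C (fun s => kernel b (slant a s y2)) s1 s2
               - RInt_C (fun s => kernel b (slant a s y1)) s1 s2)
   = Ci * (RInt_C (fun y => kernel b (slant a s2 y)) y1 y2
           - RInt_C (fun y => kernel b (slant a s1 y)) y1 y2))%C.
Proof.
  intros Ha Hs Hs2 Hy Hy2 HR.
  apply (cauchy_parallelogram (a + Ci) (fun s y => kernel b (slant a s y))
    (fun s y => dkernel b (slant a s y)) lo hi slo shi s1 s2 y1 y2); auto.
  - intros; apply (is_derive_kernel b (a + Ci) (fun s => slant a s y)).
    apply is_derive_slant_l. apply slant_regular; auto.
  - intros; apply (is_derive_kernel b Ci (fun y => slant a s y)).
    apply is_derive_slant_r. apply slant_regular; auto.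
  - intros; apply (continuous_dkernel b (fun z : R * R => slant a (snd z) (fst z))).
    + apply continuous_slant; [apply continuous_snd | apply continuous_fst].
    + apply slant_regular; auto.
Qed.

Lemma Cmod_Cexp_le (z : C) : Cmod (Cexp z) <= exp (Cmod z).
Proof.
  rewrite Cmod_Cexp. destruct (Rle_lt_or_eq_dec (Re z) (Cmod z)) as [H|H].
  - apply Rle_trans with (1 := Rle_abs _), re_le_Cmod.
  - left; now apply exp_increasing.
  - rewrite H; apply Rle_refl.
Qed.

Lemma exp_le (x y : R) : x <= y -> exp x <= exp y.
Proof. intros [H| ->]; [left; now apply exp_increasing | apply Rle_refl]. Qed.

Lemma is_derive_lin (z : C) (t : R) : is_derive_RC (fun s : R => s * z)%C t z.
Proof.
  assert (E : is_derive_RC (fun s : R => s * z)%C t (1 * z + t * 0)%C).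
  2:{ replace (1 * z + t * 0)%C with z in E by ring. exact E. }
  apply (is_derive_RC_mult (fun s : R => RtoC s) (fun _ => z)).
  - apply is_derive_RC_RtoC, (is_derive_id (K := R_AbsRing)).
  - apply is_derive_RC_const.
Qed.

Lemma continuous_lin (z : C) (t : R) : continuous (fun s : R => s * z)%C t.
Proof. eapply is_derive_RC_continuous, is_derive_lin. Qed.

Lemma Cmod_lin_le (z : C) (s : R) : 0 <= s <= 1 -> Cmod (s * z) <= Cmod z.
Proof.
  intros Hs. rewrite Cmod_mult, Cmod_R, Rabs_pos_eq by lra.
  generalize (Cmod_ge_0 z); nra.
Qed.

Lemma Cexp_sub_1_bound (z : C) : Cmod (Cexp z - 1) <= Cmod z * exp (Cmod z).
Proof.
  assert (H : is_RInt_RC (fun s : R => z * Cexp (s * z))%C 0 1 (Cexp (1 * z) - Cexp (0 * z))%C).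
  { apply (is_RInt_RC_derive (fun s : R => Cexp (s * z))%C).
    - intros; apply (is_derive_RC_Cexp (fun s : R => s * z)%C), is_derive_lin.
    - intros; apply continuous_Cmult; [apply continuous_const | apply continuous_Cexp, continuous_lin]. }
  replace (Cexp (1 * z)) with (Cexp z) in H by (f_equal; ring).
  replace (Cexp (0 * z)) with (RtoC 1) in H by (rewrite <- Cexp_0; f_equal; ring).
  replace (Cmod z * _) with ((1 - 0) * (Cmod z * exp (Cmod z))) by ring.
  apply Cmod_RInt_le with (3 := H); [lra|].
  intros s Hs. rewrite Cmod_mult. apply Rmult_le_compat_l; [apply Cmod_ge_0|].
  apply Rle_trans with (1 := Cmod_Cexp_le _), exp_le, Cmod_lin_le; auto.
Qed.

Lemma Cexp_sub_1_sub_bound (z : C) : Cmod (Cexp z - 1 - z) <= Cmod z * Cmod z * exp (Cmod z).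
Proof.
  assert (H : is_RInt_RC (fun s : R => z * (Cexp (s * z) - 1))%C 0 1
    ((Cexp (1 * z) + (-(1)) * (1 * z)) - (Cexp (0 * z) + (-(1)) * (0 * z)))%C).
  { apply (is_RInt_RC_derive (fun s : R => Cexp (s * z) + (-(1)) * (s * z))%C).
    - intros.
      replace (z * (Cexp (s * z) - 1))%C with (z * Cexp (s * z) + (0 * (s * z) + (-(1)) * z))%C by ring.
      apply is_derive_RC_plus.
      + apply (is_derive_RC_Cexp (fun s : R => s * z)%C), is_derive_lin.
      + apply (is_derive_RC_mult (fun _ => (-(1))%C) (fun s : R => (s * z)%C)); [apply is_derive_RC_const | apply is_derive_lin].
    - intros; apply continuous_Cmult; [apply continuous_const |].
      apply continuous_Cminus; [apply continuous_Cexp, continuous_lin | apply continuous_const]. }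
  replace (Cexp (1 * z)) with (Cexp z) in H by (f_equal; ring).
  replace (Cexp (0 * z)) with (RtoC 1) in H by (rewrite <- Cexp_0; f_equal; ring).
  replace (Cexp z - 1 - z)%C with (Cexp z + - (1) * (1 * z) - (1 + - (1) * (0 * z)))%C by ring.
  replace (Cmod z * Cmod z * _) with ((1 - 0) * (Cmod z * Cmod z * exp (Cmod z))) by ring.
  apply Cmod_RInt_le with (3 := H); [lra|].
  intros s Hs. rewrite Cmod_mult, Rmult_assoc. apply Rmult_le_compat_l; [apply Cmod_ge_0|].
  apply Rle_trans with (1 := Cexp_sub_1_bound _).
  apply Rmult_le_compat; auto using Cmod_ge_0, Cmod_lin_le, exp_le.
  left; apply exp_pos.
Qed.

(** The residue at [0] is [-1]. The numerator of [kernel b u + 1 / u] is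
    [u (e^{b u} - 1) - (e^u - 1 - u)], of order [u^2]. *)
Lemma kernel_near_0 (b u : C) : u <> 0 -> Cmod u <= 1 / 6 ->
  Cmod (kernel b u + / u) <= 2 * (Cmod b * exp (Cmod b) + 3).
Proof.
  intros Hu Hs.
  assert (P : 0 < Cmod u) by now apply Cmod_gt_0.
  assert (E3 : exp (Cmod u) <= 3).
  { apply Rle_trans with (2 := exp_le_3), exp_le; lra. }
  assert (D : Cmod u / 2 <= Cmod (1 - Cexp u)).
  { assert (T := Cmod_triangle (1 - Cexp u) (Cexp u - 1 - u)).
    replace (1 - Cexp u + (Cexp u - 1 - u))%C with (- u)%C in T by ring.
    rewrite Cmod_opp in T. assert (B := Cexp_sub_1_sub_bound u).
    assert (Cmod u * Cmod u * exp (Cmod u) <= Cmod u * (1/6) * 3).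
    { apply Rmult_le_compat; try nra. left; apply exp_pos. }
    lra. }
  assert (Hd : (1 - Cexp u <> 0)%C).
  { intros E; rewrite E, Cmod_0 in D; lra. }
  replace (kernel b u + / u)%C with ((u * (Cexp (b * u) - 1) - (Cexp u - 1 - u)) / (u * (1 - Cexp u)))%C
    by (unfold kernel; field; auto).
  rewrite Cmod_div by (now apply Cmult_neq_0).
  rewrite Cmod_mult.
  assert (Nn : Cmod (u * (Cexp (b * u) - 1) - (Cexp u - 1 - u)) <= Cmod u * Cmod u * (Cmod b * exp (Cmod b) + 3)).
  { apply Rle_trans with (1 := Cmod_triangle _ _). rewrite Cmod_opp, Cmod_mult.
    assert (B := Cexp_sub_1_sub_bound u). assert (B2 := Cexp_sub_1_bound (b * u)%C).
    rewrite Cmod_mult in B2.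
    assert (exp (Cmod b * Cmod u) <= exp (Cmod b)).
    { apply exp_le. generalize (Cmod_ge_0 b); nra. }
    assert (Cmod b * Cmod u * exp (Cmod b * Cmod u) <= Cmod b * Cmod u * exp (Cmod b)).
    { apply Rmult_le_compat_l; auto. generalize (Cmod_ge_0 b); nra. }
    assert (Cmod u * Cmod u * exp (Cmod u) <= Cmod u * Cmod u * 3) by (apply Rmult_le_compat_l; nra).
    assert (Cmod u * Cmod (Cexp (b * u) - 1) <= Cmod u * (Cmod b * Cmod u * exp (Cmod b))).
    { apply Rmult_le_compat_l; lra. }
    nra. }
  assert (Q : 0 < Cmod (1 - Cexp u)) by lra.
  apply Rle_div_l; [nra|].
  apply Rle_trans with (1 := Nn).
  set (K := Cmod b * exp (Cmod b) + 3).
  assert (0 <= K) by (unfold K; generalize (Cmod_ge_0 b) (exp_pos (Cmod b)); nra).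
  assert (0 <= Cmod u * K) by nra.
  assert (Cmod u * K * Cmod u <= Cmod u * K * (2 * Cmod (1 - Cexp u))) by (apply Rmult_le_compat_l; lra).
  nra.
Qed.

(** * Half a turn around the pole *)

(** [int f du] along three sides of a small parallelogram: from [- p e] up to
    [- p e + i e], across to [p e + i e] and down to [p e]. *)
Definition box_path (a e : R) (f : C -> C) : C :=
  ((a + Ci) * RInt_C (fun s => f (slant a s e)) (- e) e
   + Ci * (RInt_C (fun y => f (slant a (- e) y)) 0 e - RInt_C (fun y => f (slant a e y)) 0 e))%C.

(** This branch of the logarithm lives off the imaginary axis; the next one,
    whose argument is shifted by [PI / 2], lives off the real axis. *)
Lemma is_derive_log_right (x y : R -> R) (dx dy t : R) :
  is_derive x t dx -> is_derive y t dy -> x t <> 0 ->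
  is_derive_RC (fun s => (ln (x s ^ 2 + y s ^ 2) / 2, atan (y s / x s))) t
    ((dx, dy) / (x t, y t))%C.
Proof.
  intros Hx Hy Hn.
  assert (E1 : Derive (fun s => x s) t = dx) by (apply is_derive_unique; exact Hx).
  assert (E2 : Derive (fun s => y s) t = dy) by (apply is_derive_unique; exact Hy).
  assert (P : 0 < x t ^ 2 + y t ^ 2) by (generalize (pow2_gt_0 _ Hn) (pow2_ge_0 (y t)); lra).
  apply is_derive_RC_pair; simpl.
  - auto_derive.
    + repeat split; try (eexists; eassumption). lra.
    + rewrite E1, E2. field. lra.
  - auto_derive.
    + repeat split; try (eexists; eassumption). auto.
    + rewrite E1, E2. field. split; lra.
Qed.

Lemma is_derive_log_up (x y : R -> R) (dx dy t : R) :
  is_derive x t dx -> is_derive y t dy -> y t <> 0 ->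
  is_derive_RC (fun s => (ln (x s ^ 2 + y s ^ 2) / 2, - atan (x s / y s))) t
    ((dx, dy) / (x t, y t))%C.
Proof.
  intros Hx Hy Hn.
  assert (E1 : Derive (fun s => x s) t = dx) by (apply is_derive_unique; exact Hx).
  assert (E2 : Derive (fun s => y s) t = dy) by (apply is_derive_unique; exact Hy).
  assert (P : 0 < x t ^ 2 + y t ^ 2) by (generalize (pow2_gt_0 _ Hn) (pow2_ge_0 (x t)); lra).
  apply is_derive_RC_pair; simpl.
  - auto_derive.
    + repeat split; try (eexists; eassumption). lra.
    + rewrite E1, E2. field. lra.
  - auto_derive.
    + repeat split; try (eexists; eassumption). auto.
    + rewrite E1, E2. field. split; lra.
Qed.

Lemma a_Ci_neq_0 (a : R) : (a + Ci <> 0)%C.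
Proof. intros E; apply (f_equal snd) in E; simpl in E; lra. Qed.

Lemma slant_neq_0 (a s y : R) : 0 < a -> s <> 0 \/ y <> 0 -> slant a s y <> 0.
Proof.
  intros Ha H E; rewrite slant_eq in E. injection E; intros E1 E2.
  assert (s = 0) by nra. subst s. lra.
Qed.

(** Division by [p] brings the three sides into the closed upper half plane,
    where the branches of the logarithm are easy to follow. *)
Lemma slant_factor (a s y : R) :
  slant a s y = ((a + Ci) * (s + y / (1 + a ^ 2), y * a / (1 + a ^ 2))%R)%C.
Proof.
  rewrite slant_eq. assert (1 + a ^ 2 <> 0) by nra.
  apply C_eq; unfold Ci, RtoC, Re, Im, Cmult, Cplus; simpl; field; nra.
Qed.

Lemma Ci_factor (a : R) : Ci = ((a + Ci) * (1 / (1 + a ^ 2), a / (1 + a ^ 2))%R)%C.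
Proof.
  assert (1 + a ^ 2 <> 0) by nra.
  apply C_eq; unfold Ci, RtoC, Re, Im, Cmult, Cplus; simpl; field; nra.
Qed.

(** After division by [p] each side is covered by one branch of the logarithm.
    The moduli cancel at the corners, and the arguments add up to a half turn by
    [atan (1 / x) = PI / 2 - atan x]. *)
Lemma box_path_inv (a e : R) : 0 < a -> 0 < e -> box_path a e (fun u => / u)%C = (- (PI * Ci))%C.
Proof.
  intros Ha He. unfold box_path.
  set (d := 1 + a ^ 2). assert (Hd : 0 < d) by (unfold d; nra).
  assert (Hd1 : 1 < d) by (unfold d; nra).
  set (q1 := / d). set (q2 := a / d).
  assert (Hq1 : 0 < q1 < 1). { unfold q1; split; [now apply Rinv_0_lt_compat|].
    apply (Rmult_lt_reg_l d); [lra|]. rewrite Rinv_r; lra. }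
  assert (Hq2 : 0 < q2) by (apply Rdiv_lt_0_compat; auto).
  assert (Hp := a_Ci_neq_0 a).
  assert (Hinv : forall s y, s <> 0 \/ y <> 0 ->
    (((s + y * q1, y * q2)%R : C) <> 0) /\ slant a s y = ((a + Ci) * (s + y * q1, y * q2)%R)%C).
  { intros s y H; split.
    - intros E; injection E; intros E1 E2. assert (y = 0) by nra. subst y. lra.
    - rewrite slant_factor; fold d; f_equal; apply C_eq; unfold q1, q2; simpl; field; lra. }
  assert (Hcont : forall s y, s <> 0 \/ y <> 0 -> continuous (fun s => / slant a s y)%C s).
  { intros s y H. apply continuous_Cinv; [|apply slant_neq_0; auto].
    apply continuous_slant; [apply continuous_id | apply continuous_const]. }
  assert (Hcont2 : forall s y, s <> 0 \/ y <> 0 -> continuous (fun y => / slant a s y)%C y).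
  { intros s y H. apply continuous_Cinv; [|apply slant_neq_0; auto].
    apply continuous_slant; [apply continuous_const| apply continuous_id]. }
  (* On the top side the real part changes sign, so that the argument is read
     from the quotient of the real part by the imaginary part. *)
  set (T := fun s => (ln ((s + e * q1) ^ 2 + (e * q2) ^ 2) / 2, - atan ((s + e * q1) / (e * q2)))%R : C).
  assert (HT : is_RInt_RC (fun s => (a + Ci) * / slant a s e)%C (- e) e (T e - T (- e)%R)%C).
  { apply is_RInt_RC_derive.
    - intros s _. replace ((a + Ci) * / slant a s e)%C with (RtoC 1 / (s + e * q1, e * q2)%R)%C.
      + apply (is_derive_log_up (fun s => s + e * q1) (fun _ => e * q2)); try (auto_derive; auto; ring).
        nra.
      + destruct (Hinv s e) as [H1 H2]; [right; lra|]. rewrite H2. field. auto.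
    - intros s _. apply continuous_Cmult; [apply continuous_const |apply Hcont; lra]. }
  assert (HT' : is_RInt_RC (fun s => (a + Ci) * / slant a s e)%C (- e) e
     ((a + Ci) * RInt_C (fun s => / slant a s e) (- e) e)%C).
  { apply is_RInt_RC_scal, RInt_RC_correct. intros; apply Hcont; lra. }
  (* On the other two sides the real part has a constant sign. *)
  set (V := fun s y => (ln ((s + y * q1) ^ 2 + (y * q2) ^ 2) / 2, atan ((y * q2) / (s + y * q1)))%R : C).
  assert (HV : forall s, s = e \/ s = - e ->
     is_RInt_RC (fun y => Ci * / slant a s y)%C 0 e (V s e - V s 0)%C).
  { intros s Hs; apply is_RInt_RC_derive; rewrite Rmin_left, Rmax_right by lra.
    - intros y Hy. replace (Ci * / slant a s y)%C with ((q1, q2) / (s + y * q1, y * q2)%R)%C.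
      + apply (is_derive_log_right (fun y => s + y * q1) (fun y => y * q2)); try (auto_derive; auto; ring).
        destruct Hs; nra.
      + destruct (Hinv s y) as [H1 H2]; [left; lra|]. rewrite H2.
        rewrite (Ci_factor a) at 1. fold d.
        replace (1 / d) with q1 by (unfold q1; field; lra). fold q2.
        field. auto.
    - intros y Hy. apply continuous_Cmult; [apply continuous_const |apply Hcont2; lra]. }
  assert (HV' : forall s, s = e \/ s = - e -> is_RInt_RC (fun y => Ci * / slant a s y)%C 0 e
     (Ci * RInt_C (fun y => / slant a s y) 0 e)%C).
  { intros s Hs; apply is_RInt_RC_scal, RInt_RC_correct. intros; apply Hcont2; lra. }
  assert (ET := eq_trans (eq_sym (is_RInt_RC_unique _ _ _ _ HT')) (is_RInt_RC_unique _ _ _ _ HT)).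
  assert (EV1 := eq_trans (eq_sym (is_RInt_RC_unique _ _ _ _ (HV' e (or_introl eq_refl))))
     (is_RInt_RC_unique _ _ _ _ (HV e (or_introl eq_refl)))).
  assert (EV2 := eq_trans (eq_sym (is_RInt_RC_unique _ _ _ _ (HV' (-e) (or_intror eq_refl))))
     (is_RInt_RC_unique _ _ _ _ (HV (-e)%R (or_intror eq_refl)))).
  replace (_ + _)%C with ((T e - T (- e)%R) + ((V (-e)%R e - V (-e)%R 0) - (V e e - V e 0)))%C
    by (rewrite <- ET, <- EV1, <- EV2; ring).
  unfold T, V. apply C_eq.
  - simpl. replace ((- e + 0 * q1) * ((- e + 0 * q1) * 1)) with ((e + 0 * q1) * ((e + 0 * q1) * 1)) by ring.
    ring.
  - simpl. replace (0 * q2 / (- e + 0 * q1)) with 0 by (field; repeat split; lra).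
    replace (0 * q2 / (e + 0 * q1)) with 0 by (field; lra). rewrite atan_0.
    (* The four arguments form two pairs of reciprocals. *)
    assert (N1 : - e + e * q1 < 0) by nra. assert (N2 : 0 < e + e * q1) by nra.
    replace (e * q2 / (- e + e * q1)) with (- / ((1 - q1) / q2)) by (field; repeat split; lra).
    replace ((- e + e * q1) / (e * q2)) with (- ((1 - q1) / q2)) by (field; repeat split; lra).
    replace (e * q2 / (e + e * q1)) with (/ ((1 + q1) / q2)) by (field; repeat split; lra).
    replace ((e + e * q1) / (e * q2)) with ((1 + q1) / q2) by (field; repeat split; lra).
    rewrite !atan_opp. rewrite atan_inv by (apply Rdiv_lt_0_compat; lra). rewrite atan_inv by (apply Rdiv_lt_0_compat; lra).
    field.
Qed.

(** * Passing from the principal value to a line above the pole *)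

Definition excised (a R0 : R) (b : C) (e : R) : C :=
  (RInt_C (fun s => kernel b (slant a s 0)) (- R0) (- e)
   + RInt_C (fun s => kernel b (slant a s 0)) e R0)%C.

Definition vertical_sides (a R0 : R) (b : C) (D : R) : C :=
  (Ci / (a + Ci) * (RInt_C (fun y => kernel b (slant a R0 y)) 0 D
                    - RInt_C (fun y => kernel b (slant a (- R0) y)) 0 D))%C.

Definition horizontal_line (a R0 : R) (b : C) (D : R) : C :=
  RInt_C (fun s => kernel b (slant a s D)) (- R0) R0.

Lemma cos_neq_1_pos (y : R) : 0 < y < 2 * PI -> cos y <> 1.
Proof. intros H; apply cos_neq_1. rewrite Rabs_pos_eq; lra. Qed.

Lemma continuous_kernel_l (a : R) (b : C) (s y : R) : 0 < a -> s <> 0 \/ cos y <> 1 ->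
  continuous (fun s => kernel b (slant a s y)) s.
Proof.
  intros Ha H; apply (continuous_kernel b (fun s => slant a s y)).
  - apply continuous_slant; [apply continuous_id | apply continuous_const].
  - apply slant_regular; auto.
Qed.

Lemma continuous_kernel_r (a : R) (b : C) (s y : R) : 0 < a -> s <> 0 \/ cos y <> 1 ->
  continuous (fun y => kernel b (slant a s y)) y.
Proof.
  intros Ha H; apply (continuous_kernel b (fun y => slant a s y)).
  - apply continuous_slant; [apply continuous_const | apply continuous_id].
  - apply slant_regular; auto.
Qed.

(** Cauchy's theorem in the two parallelograms of height [e] that flank the
    pole, and in the one between the heights [e] and [D]. What remains is the
    path around the pole. *)
Lemma excised_contour (a R0 : R) (b : C) (D e : R) : 0 < a -> 0 < e < R0 -> e < D < 2 * PI ->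
  ((a + Ci) * (horizontal_line a R0 b D - excised a R0 b e - vertical_sides a R0 b D) = box_path a e (kernel b))%C.
Proof.
  intros Ha He HD. assert (Hp := a_Ci_neq_0 a).
  assert (K1 := kernel_cauchy a b (-1) (e + 1) (- R0 - 1) 0 (- R0) (- e) 0 e).
  assert (K2 := kernel_cauchy a b (-1) (e + 1) 0 (R0 + 1) e R0 0 e).
  assert (K3 := kernel_cauchy a b 0 (2 * PI) (- R0 - 1) (R0 + 1) (- R0) R0 e D).
  assert (C1 : forall s y, s <> 0 -> continuous (fun s => kernel b (slant a s y)) s).
  { intros; apply continuous_kernel_l; auto. }
  assert (C2 : forall s y, s <> 0 -> continuous (fun y => kernel b (slant a s y)) y).
  { intros; apply continuous_kernel_r; auto. }
  assert (Ce : forall s, continuous (fun s => kernel b (slant a s e)) s).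
  { intros s; apply continuous_kernel_l; auto. right; apply cos_neq_1_pos; lra. }
  assert (Q1 := RInt_C_Chasles (fun s => kernel b (slant a s e)) (- R0) (- e) e).
  assert (Q2 := RInt_C_Chasles (fun s => kernel b (slant a s e)) (- R0) e R0).
  assert (Q3 := RInt_C_Chasles (fun y => kernel b (slant a R0 y)) 0 e D).
  assert (Q4 := RInt_C_Chasles (fun y => kernel b (slant a (- R0) y)) 0 e D).
  specialize (Q1 ltac:(lra) ltac:(auto)). specialize (Q2 ltac:(lra) ltac:(auto)).
  specialize (Q3 ltac:(lra) ltac:(intros; apply C2; lra)).
  specialize (Q4 ltac:(lra) ltac:(intros; apply C2; lra)).
  specialize (K1 Ha ltac:(lra) ltac:(lra) ltac:(lra) ltac:(lra) ltac:(intros; left; lra)).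
  specialize (K2 Ha ltac:(lra) ltac:(lra) ltac:(lra) ltac:(lra) ltac:(intros; left; lra)).
  specialize (K3 Ha ltac:(lra) ltac:(lra) ltac:(lra) ltac:(lra)
    ltac:(intros; right; apply cos_neq_1_pos; lra)).
  unfold horizontal_line, excised, vertical_sides, box_path.
  rewrite <- Q3, <- Q4.
  match goal with |- (_ * (?x - (?y1 + ?y2) - Ci / _ * (?z1 + ?z2 - (?w1 + ?w2))) = _)%C =>
    transitivity ((a + Ci) * (x - (y1 + y2)) - Ci * (z1 + z2 - (w1 + w2)))%C; [field; auto|] end.
  rewrite <- Q2, <- Q1 in K3.
  match type of K3 with (_ = ?r)%C => set (r3 := r) in * end.
  match type of K1 with (_ = ?r)%C => set (r1 := r) in * end.
  match type of K2 with (_ = ?r)%C => set (r2 := r) in * end.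
  match goal with |- (?l = ?r)%C =>
   assert (Z : (l - r = 0)%C); [|transitivity (l - r + r)%C; [ring| rewrite Z; ring]] end.
  match type of K1 with (?l1 = _)%C => match type of K2 with (?l2 = _)%C => match type of K3 with (?l3 = _)%C =>
   transitivity ((l1 - r1) + (l2 - r2) + (l3 - r3))%C; [unfold r1, r2, r3; ring | rewrite K1, K2, K3; ring] end end end.
Qed.

Lemma slant_bound (a s y e : R) : 0 < a -> 0 <= e -> Rabs s <= e -> Rabs y <= e ->
  Cmod (slant a s y) <= (Cmod (a + Ci) + 1) * e.
Proof.
  intros Ha He Hs Hy. unfold slant.
  apply Rle_trans with (1 := Cmod_triangle _ _). rewrite !Cmod_mult, !Cmod_R.
  assert (X : Cmod Ci = 1). { unfold Cmod, Ci; simpl. replace (0 * (0 * 1) + 1 * (1 * 1)) with 1 by ring. apply sqrt_1. }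
  rewrite X. generalize (Cmod_ge_0 (a + Ci)); nra.
Qed.

Lemma filter_at_right_lt (r : R) : 0 < r -> at_right 0 (fun e => 0 < e < r).
Proof.
  intros Hr. exists (mkposreal _ Hr). intros y Hy Hy0. split; auto.
  assert (K : Rabs (y - 0) < r) by exact Hy. apply Rabs_def2 in K; lra.
Qed.

Lemma filterlim_at_right_id : filterlim (fun e : R => e) (at_right 0) (locally 0).
Proof. intros P [d Hd]; exists d; intros y Hy _; apply Hd, Hy. Qed.

(** The path has length of order [e], so that only the polar part [- 1 / u] of
    the kernel contributes. *)
Lemma box_path_kernel_lim (a : R) (b : C) : 0 < a -> limC (at_right 0) (fun e => box_path a e (kernel b)) (PI * Ci)%C.
Proof.
  intros Ha.
  set (K := 2 * (Cmod b * exp (Cmod b) + 3)).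
  set (P := Cmod (a + Ci)).
  assert (HP : 0 <= P) by apply Cmod_ge_0.
  (* Keeps the path in the disc of radius [1 / 6] and below the next pole. *)
  set (r := Rmin 1 (/ (6 * (P + 1)))).
  assert (Hr : 0 < r) by (apply Rmin_pos; [lra | apply Rinv_0_lt_compat; lra]).
  apply (limC_bound _ _ (fun e => (2 * P * K + 2 * K) * e)).
  2:{ replace 0 with ((2 * P * K + 2 * K) * 0) at 2 by ring.
      apply limR_mult; [typeclasses eauto | apply filterlim_const | apply filterlim_at_right_id]. }
  generalize (filter_at_right_lt r Hr); apply filter_imp; intros e He.
  assert (He1 : e < 1) by (apply Rlt_le_trans with (1 := proj2 He), Rmin_l).
  assert (He6 : (P + 1) * e <= 1 / 6).
  { assert (e <= / (6 * (P + 1))). { left; apply Rlt_le_trans with (1 := proj2 He), Rmin_r. }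
    replace (1 / 6) with ((P + 1) * / (6 * (P + 1))) by (field; lra).
    apply Rmult_le_compat_l; lra. }
  assert (HPI := PI2_3_2).
  assert (G : forall s y, Rabs s <= e -> 0 <= y <= e -> s <> 0 \/ y <> 0 ->
    Cmod (kernel b (slant a s y) + / slant a s y) <= K).
  { intros s y Hs Hy H; apply kernel_near_0; [apply slant_neq_0; auto|].
    apply Rle_trans with (2 := He6), slant_bound; auto; try lra. rewrite Rabs_pos_eq; lra. }
  assert (Hreg : forall s y, 0 <= y <= e -> s <> 0 \/ y <> 0 -> s <> 0 \/ cos y <> 1).
  { intros s y Hy [H|H]; [left; auto | right; apply cos_neq_1_pos; lra]. }
  assert (Hi1 : forall s y, s <> 0 \/ y <> 0 -> continuous (fun s => / slant a s y)%C s).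
  { intros s y H. apply continuous_Cinv; [|apply slant_neq_0; auto].
    apply continuous_slant; [apply continuous_id | apply continuous_const]. }
  assert (Hi2 : forall s y, s <> 0 \/ y <> 0 -> continuous (fun y => / slant a s y)%C y).
  { intros s y H. apply continuous_Cinv; [|apply slant_neq_0; auto].
    apply continuous_slant; [apply continuous_const| apply continuous_id]. }
  assert (B1 : Cmod (RInt_C (fun s => kernel b (slant a s e)) (- e) e + RInt_C (fun s => / slant a s e)%C (- e) e) <= (e - - e) * K).
  { apply (Cmod_RInt_le (fun s => kernel b (slant a s e) + / slant a s e)%C); [lra| |].
    - intros s Hs; apply G; try lra. apply Rabs_le; lra.
    - apply is_RInt_RC_plus; apply RInt_RC_correct; intros s _;
       [apply continuous_kernel_l; auto; apply Hreg; lra | apply Hi1; lra]. }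
  assert (B2 : forall s, s = e \/ s = - e ->
    Cmod (RInt_C (fun y => kernel b (slant a s y)) 0 e + RInt_C (fun y => / slant a s y)%C 0 e) <= (e - 0) * K).
  { intros s Hs; apply (Cmod_RInt_le (fun y => kernel b (slant a s y) + / slant a s y)%C); [lra| |].
    - intros y Hy; apply G; try lra. apply Rabs_le; lra.
    - apply is_RInt_RC_plus; apply RInt_RC_correct; intros y _;
       [apply continuous_kernel_r; auto; left; lra | apply Hi2; lra]. }
  assert (X : Cmod Ci = 1). { unfold Cmod, Ci; simpl. replace (0 * (0 * 1) + 1 * (1 * 1)) with 1 by ring. apply sqrt_1. }
  replace (PI * Ci)%C with (- - (PI * Ci))%C by ring.
  rewrite <- (box_path_inv a e Ha (proj1 He)).
  unfold box_path.
  match goal with |- Cmod ((?p * ?x1 + Ci * (?x2 - ?x3)) - - (?p * ?y1 + Ci * (?y2 - ?y3))) <= _ =>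
    replace ((p * x1 + Ci * (x2 - x3)) - - (p * y1 + Ci * (y2 - y3)))%C
     with (p * (x1 + y1) + (Ci * (x2 + y2) + - (Ci * (x3 + y3))))%C by ring end.
  apply Rle_trans with (1 := Cmod_triangle _ _).
  assert (T1 : forall z w, Cmod (z + - w) <= Cmod z + Cmod w).
  { intros z w; apply Rle_trans with (1 := Cmod_triangle _ _); rewrite Cmod_opp; lra. }
  assert (B3 := B2 (- e) (or_intror eq_refl)). assert (B4 := B2 e (or_introl eq_refl)).
  match goal with |- _ + Cmod ?w <= _ => assert (W : Cmod w <= 2 * K * e) end.
  { apply Rle_trans with (1 := T1 _ _). rewrite !Cmod_mult, X. lra. }
  rewrite Cmod_mult. fold P.
  apply (Rmult_le_compat_l P) in B1; [|assumption]. lra.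
Qed.

(** The contour identity computes the principal value of [int F (p s) ds] over
    [[-R0, R0]] from the line at any height between [0] and [2 PI], which also
    proves that it exists; [PI] is one such height. *)
Definition principal_value (a R0 : R) (b : C) : C :=
  (horizontal_line a R0 b PI - vertical_sides a R0 b PI - PI * Ci / (a + Ci))%C.

Lemma excised_lim (a R0 D : R) (b : C) : 0 < a -> 0 < R0 -> 0 < D < 2 * PI ->
  limC (at_right 0) (excised a R0 b) (horizontal_line a R0 b D - vertical_sides a R0 b D - PI * Ci / (a + Ci))%C.
Proof.
  intros Ha HR HD. assert (Hp := a_Ci_neq_0 a).
  apply (limC_ext _ (fun e => (horizontal_line a R0 b D - vertical_sides a R0 b D) - / (a + Ci) * box_path a e (kernel b))%C).
  - assert (H : 0 < Rmin R0 D) by (apply Rmin_pos; lra).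
    generalize (filter_at_right_lt _ H); apply filter_imp; intros e He.
    rewrite <- (excised_contour a R0 b D e); auto.
    + field; auto.
    + generalize (Rmin_l R0 D); lra.
    + generalize (Rmin_r R0 D); lra.
  - replace (PI * Ci / (a + Ci))%C with (/ (a + Ci) * (PI * Ci))%C by (field; auto).
    apply limC_minus; [typeclasses eauto | apply limC_const; typeclasses eauto |].
    apply limC_scal; [typeclasses eauto|]. apply box_path_kernel_lim; auto.
Qed.

Lemma excised_principal_value (a R0 : R) (b : C) : 0 < a -> 0 < R0 -> limC (at_right 0) (excised a R0 b) (principal_value a R0 b).
Proof. intros; apply excised_lim; auto. generalize PI_RGT_0; lra. Qed.

Lemma horizontal_line_pos (a R0 D : R) (b : C) : 0 < a -> 0 < R0 -> 0 < D < 2 * PI ->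
  (horizontal_line a R0 b D = principal_value a R0 b + vertical_sides a R0 b D + PI * Ci / (a + Ci))%C.
Proof.
  intros Ha HR HD.
  rewrite (limC_unique (at_right 0) _ _ _ (excised_principal_value a R0 b Ha HR) (excised_lim a R0 D b Ha HR HD)).
  ring.
Qed.

(** * Lines below the pole *)

Lemma RInt_C_reflect (f g : R -> C) (p q : R) : p <= q ->
  (forall s, - q <= s <= - p -> continuous f s) ->
  (forall s, p < s < q -> g s = f (- s)) ->
  RInt_C g p q = RInt_C f (- q) (- p).
Proof.
  intros Hpq Hc Hg. apply is_RInt_RC_unique.
  apply (is_RInt_RC_ext (fun s => f (- s))).
  { rewrite Rmin_left, Rmax_right by lra; intros; symmetry; auto. }
  assert (H : is_RInt_RC f (- q) (- p) (RInt_C f (- q) (- p))).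
  { apply RInt_RC_correct; rewrite Rmin_left, Rmax_right by lra; auto. }
  apply (is_RInt_swap (V := C_R_NormedModule)) in H.
  apply (is_RInt_comp_opp (V := C_R_NormedModule)) in H.
  apply (is_RInt_opp (V := C_R_NormedModule)) in H.
  rewrite opp_opp in H. apply (is_RInt_ext (V := C_R_NormedModule) _ (fun s => f (- s)) _ _ _) in H; auto.
  intros s _; apply opp_opp.
Qed.

(** The map [u -> - u] exchanges the exponents [b] and [1 - b]. This transfers
    the results on lines above the pole to lines below it. *)
Lemma kernel_reflect (b u : C) : (1 - Cexp u <> 0)%C -> kernel b (- u) = (- kernel (1 - b) u)%C.
Proof.
  intros Hu. unfold kernel.
  replace (b * - u)%C with ((1 - b) * u + - u)%C by ring.
  rewrite Cexp_plus, Cexp_opp. field. assert (X := Cexp_neq_0 u).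
  repeat split; auto. intros E; apply Hu.
  transitivity (- (Cexp u - 1))%C; [ring | rewrite E; ring].
Qed.

Lemma slant_opp (a s y : R) : slant a (- s) (- y) = (- slant a s y)%C.
Proof. rewrite !slant_eq; apply C_eq; simpl; ring. Qed.

Lemma kernel_reflect_slant (a s y : R) (b : C) : 0 < a -> s <> 0 \/ cos y <> 1 ->
  kernel b (slant a s y) = ((-(1)) * kernel (1 - b) (slant a (- s) (- y)))%C.
Proof.
  intros Ha H. rewrite <- (Ropp_involutive s), <- (Ropp_involutive y) at 1.
  rewrite slant_opp, kernel_reflect; [ring|].
  apply slant_regular; auto. rewrite cos_neg. destruct H; [left; lra | right; auto].
Qed.

Lemma RInt_C_scal (z : C) (f : R -> C) (p q : R) :
  (forall s, Rmin p q <= s <= Rmax p q -> continuous f s) ->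
  RInt_C (fun s => z * f s)%C p q = (z * RInt_C f p q)%C.
Proof. intros H; apply is_RInt_RC_unique, is_RInt_RC_scal, RInt_RC_correct, H. Qed.

Lemma RInt_C_swap (f : R -> C) (p q : R) :
  (forall s, Rmin p q <= s <= Rmax p q -> continuous f s) ->
  RInt_C f p q = (- RInt_C f q p)%C.
Proof.
  intros H; apply is_RInt_RC_unique.
  apply (is_RInt_swap (V := C_R_NormedModule)). apply RInt_RC_correct.
  intros s; rewrite Rmin_comm, Rmax_comm; apply H.
Qed.

Lemma excised_reflect (a R0 e : R) (b : C) : 0 < a -> 0 < e < R0 ->
  excised a R0 b e = (- excised a R0 (1 - b) e)%C.
Proof.
  intros Ha He. unfold excised.
  assert (Hc : forall s, s <> 0 -> continuous (fun s => (-(1)) * kernel (1 - b) (slant a s 0))%C s).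
  { intros s H; apply continuous_Cmult; [apply continuous_const | apply continuous_kernel_l; auto]. }
  assert (Hg : forall s, s <> 0 -> kernel b (slant a s 0) = (- (1) * kernel (1 - b) (slant a (- s) 0))%C).
  { intros s H. rewrite kernel_reflect_slant, Ropp_0; auto. }
  rewrite (RInt_C_reflect (fun s => (-(1)) * kernel (1 - b) (slant a s 0))%C
    (fun s => kernel b (slant a s 0)) (- R0) (- e)); rewrite ?Ropp_involutive; try lra.
  2:{ intros; apply Hc; lra. } 2:{ intros; apply Hg; lra. }
  rewrite (RInt_C_reflect (fun s => (-(1)) * kernel (1 - b) (slant a s 0))%C
    (fun s => kernel b (slant a s 0)) e R0); try lra.
  2:{ intros; apply Hc; lra. } 2:{ intros; apply Hg; lra. }
  rewrite !RInt_C_scal; [ring| |]; [rewrite Rmin_left, Rmax_right by lra|rewrite Rmin_left, Rmax_right by lra];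
    intros; apply continuous_kernel_l; auto; left; lra.
Qed.

Lemma principal_value_reflect (a R0 : R) (b : C) : 0 < a -> 0 < R0 -> principal_value a R0 b = (- principal_value a R0 (1 - b))%C.
Proof.
  intros Ha HR. apply (limC_unique (at_right 0) (excised a R0 b)); [apply excised_principal_value; auto|].
  apply (limC_ext _ (fun e => - excised a R0 (1 - b) e)%C).
  - generalize (filter_at_right_lt _ HR); apply filter_imp; intros e He.
    symmetry; apply excised_reflect; auto.
  - apply limC_opp; [typeclasses eauto | apply excised_principal_value; auto].
Qed.

Lemma horizontal_line_reflect (a R0 D : R) (b : C) : 0 < a -> 0 < R0 -> 0 < D < 2 * PI ->
  horizontal_line a R0 b (- D) = (- horizontal_line a R0 (1 - b) D)%C.
Proof.
  intros Ha HR HD. unfold horizontal_line. assert (Hcos := cos_neq_1_pos D HD).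
  rewrite (RInt_C_reflect (fun s => (-(1)) * kernel (1 - b) (slant a s D))%C
    (fun s => kernel b (slant a s (- D))) (- R0) R0); try lra.
  - rewrite Ropp_involutive, RInt_C_scal; [ring|]. intros; apply continuous_kernel_l; auto.
  - intros; apply continuous_Cmult; [apply continuous_const | apply continuous_kernel_l; auto].
  - intros. rewrite kernel_reflect_slant, Ropp_involutive; auto. rewrite cos_neg; auto.
Qed.

Lemma vertical_sides_reflect (a R0 D : R) (b : C) : 0 < a -> 0 < R0 -> 0 < D ->
  vertical_sides a R0 b (- D) = (- vertical_sides a R0 (1 - b) D)%C.
Proof.
  intros Ha HR HD. unfold vertical_sides.
  assert (E : forall r, r <> 0 ->
    RInt_C (fun y => kernel b (slant a r y)) 0 (- D) = RInt_C (fun y => kernel (1 - b) (slant a (- r) y)) 0 D).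
  { intros r Hr. rewrite RInt_C_swap by (intros; apply continuous_kernel_r; auto).
    rewrite (RInt_C_reflect (fun y => (-(1)) * kernel (1 - b) (slant a (- r) y))%C); try lra.
    - rewrite Ropp_involutive, Ropp_0, RInt_C_scal; [ring|].
      intros; apply continuous_kernel_r; auto; left; lra.
    - intros; apply continuous_Cmult; [apply continuous_const | apply continuous_kernel_r; auto; left; lra].
    - intros; apply kernel_reflect_slant; auto. }
  rewrite !E by lra. rewrite Ropp_involutive. ring.
Qed.

Lemma horizontal_line_neg (a R0 D : R) (b : C) : 0 < a -> 0 < R0 -> 0 < D < 2 * PI ->
  (horizontal_line a R0 b (- D) = principal_value a R0 b + vertical_sides a R0 b (- D) - PI * Ci / (a + Ci))%C.
Proof.
  intros Ha HR HD.
  rewrite horizontal_line_reflect, vertical_sides_reflect, principal_value_reflect, horizontal_line_pos by (auto; lra).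
  field. apply a_Ci_neq_0.
Qed.

(** * The ends of the lines *)

Lemma Cmod_RInt_le_abs (f : R -> C) (D K : R) :
  (forall s, Rabs s <= Rabs D -> Cmod (f s) <= K) ->
  (forall s, continuous f s) -> Cmod (RInt_C f 0 D) <= Rabs D * K.
Proof.
  intros HK Hc. destruct (Rle_dec 0 D) as [H|H].
  - rewrite (Rabs_pos_eq D) by lra. replace (D * K) with ((D - 0) * K) by ring.
    apply (Cmod_RInt_le f); auto.
    + intros s Hs; apply HK. rewrite !Rabs_pos_eq; lra.
    + apply RInt_RC_correct; auto.
  - rewrite RInt_C_swap by auto. rewrite Cmod_opp.
    rewrite (Rabs_left D) by lra. replace (- D * K) with ((0 - D) * K) by ring.
    apply (Cmod_RInt_le f); auto; [lra| |].
    + intros s Hs; apply HK. rewrite !Rabs_left1; lra.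
    + apply RInt_RC_correct; auto.
Qed.

(** The exponents [c], [b = c / p] and [B = - i b] of a mode. *)
Definition mode_exponent (a kappa : R) : C := (a + Ci * kappa)%C.
Definition kernel_exponent (a kappa : R) : C := (mode_exponent a kappa / (a + Ci))%C.
Definition angular_exponent (a kappa : R) : C := (- (Ci * kernel_exponent a kappa))%C.
(** [e^{(c - p) r} / (c - p)], whose exponent [c - p = i (kappa - 1)] is purely
    imaginary. *)
Definition oscillation (a kappa r : R) : C :=
  (Cexp (RtoC r * (Ci * (kappa - 1))) / (Ci * (kappa - 1)))%C.

Lemma kappa_sub_1_neq_0 (kappa : R) : kappa <> 1 -> (kappa - 1 <> 0)%C.
Proof. intros H E; apply H; apply (f_equal fst) in E; simpl in E; lra. Qed.

Lemma Ci_neq_0 : Ci <> 0.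
Proof. intros E; apply (f_equal snd) in E; simpl in E; lra. Qed.

Lemma kernel_exponent_slant (a kappa s y : R) :
  (kernel_exponent a kappa * slant a s y = s * mode_exponent a kappa - y * angular_exponent a kappa)%C.
Proof. unfold kernel_exponent, angular_exponent, kernel_exponent, slant; field; apply a_Ci_neq_0. Qed.

(** For [b = c / p] the kernel does not decay at the right end of the line. The
    exponential subtracted here has an explicit integral, and the kernel of
    exponent [b - 1] decays. *)
Lemma kernel_shift (b u : C) : (1 - Cexp u <> 0)%C ->
  kernel b u = (kernel (b - 1) u - Cexp ((b - 1) * u))%C.
Proof.
  intros H. unfold kernel. replace (b * u)%C with ((b - 1) * u + u)%C by ring.
  rewrite Cexp_plus. field; auto.
Qed.

Lemma kernel_exponent_pred_slant (a kappa s y : R) :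
  ((kernel_exponent a kappa - 1) * slant a s y = s * (Ci * (kappa - 1)) - y * (angular_exponent a kappa + Ci))%C.
Proof. unfold kernel_exponent, angular_exponent, kernel_exponent, slant, mode_exponent; field; apply a_Ci_neq_0. Qed.

Lemma Re_Cmult_R (x : R) (z : C) : Re (x * z)%C = x * Re z.
Proof. unfold Re; simpl; ring. Qed.

Lemma Cmod_slant_lower (a s y : R) :
  Rabs (1 - exp (a * s)) <= Cmod (1 - Cexp (slant a s y)).
Proof.
  assert (M : Cmod (Cexp (slant a s y)) = exp (a * s)) by now rewrite Cmod_Cexp, slant_eq.
  rewrite <- M. apply Rabs_le; split.
  - assert (T := Cmod_triangle (1 - Cexp (slant a s y)) 1).
    assert (T2 := Cmod_triangle (Cexp (slant a s y) - 1) 1).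
    replace (Cexp (slant a s y) - 1 + 1)%C with (Cexp (slant a s y)) in T2 by ring.
    rewrite Cmod_1 in T2.
    replace (Cexp (slant a s y) - 1)%C with (- (1 - Cexp (slant a s y)))%C in T2 by ring.
    rewrite Cmod_opp in T2. lra.
  - assert (T := Cmod_triangle (1 - Cexp (slant a s y)) (Cexp (slant a s y))).
    replace (1 - Cexp (slant a s y) + Cexp (slant a s y))%C with (RtoC 1) in T by ring.
    rewrite Cmod_1 in T. lra.
Qed.

(** Convergence is exponential in [r]; the rate [1 / r] is enough. *)
Lemma decay_bound (a r x K d : R) : 0 < a -> 0 < r -> 0 <= x -> 0 <= K ->
  x <= K -> exp (a * r) - 1 <= d -> x / d <= K / a * / r.
Proof.
  intros Ha Hr Hx HK HxK Hd.
  assert (E := exp_ineq1_le (a * r)). assert (0 < a * r) by nra.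
  apply Rle_trans with (K / (a * r)).
  - unfold Rdiv. apply Rmult_le_compat; auto.
    + left; apply Rinv_0_lt_compat; lra.
    + apply Rinv_le_contravar; lra.
  - right; field; lra.
Qed.

Lemma filterlim_Rinv_p_infty : filterlim Rinv (Rbar_locally p_infty) (locally 0).
Proof.
  apply (is_lim_inv (fun x => x) p_infty p_infty); [apply is_lim_id | discriminate].
Qed.

Lemma p_infty_gt (r : R) : Rbar_locally p_infty (fun x => r < x).
Proof. exists r; auto. Qed.

Lemma kernel_right_bound (a kappa r y : R) : 0 < a -> 0 < r ->
  Cmod (kernel (kernel_exponent a kappa - 1) (slant a r y)) <= exp (Rabs y * Cmod (angular_exponent a kappa + Ci)) / a * / r.
Proof.
  intros Ha Hr. unfold kernel. rewrite Cmod_div by (apply slant_regular; auto; left; lra).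
  apply decay_bound; auto using Cmod_ge_0; try (left; apply exp_pos).
  - rewrite Cmod_Cexp. apply exp_le. rewrite kernel_exponent_pred_slant.
    apply Rle_trans with (Re (- (y * (angular_exponent a kappa + Ci)))%C).
    + right. unfold Re, Ci; simpl; ring.
    + apply Rle_trans with (1 := Rle_abs _). apply Rle_trans with (1 := re_le_Cmod _).
      rewrite Cmod_opp, Cmod_mult, Cmod_R; lra.
  - apply Rle_trans with (2 := Cmod_slant_lower a r y). rewrite Rabs_minus_sym. apply Rle_abs.
Qed.

Lemma kernel_left_bound (a kappa r y : R) : 0 < a -> 0 < r ->
  Cmod (kernel (kernel_exponent a kappa) (slant a (- r) y)) <= exp (Rabs y * Cmod (angular_exponent a kappa)) / a * / r.
Proof.
  intros Ha Hr. unfold kernel. rewrite Cmod_div by (apply slant_regular; auto; left; lra).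
  assert (L := Cmod_slant_lower a (- r) y).
  assert (N : Cmod (Cexp (kernel_exponent a kappa * slant a (- r) y)) <= exp (- (a * r)) * exp (Rabs y * Cmod (angular_exponent a kappa))).
  { rewrite Cmod_Cexp, <- exp_plus. apply exp_le. rewrite kernel_exponent_slant.
    apply Rle_trans with (- (a * r) + Re (- (y * angular_exponent a kappa))%C).
    - right. unfold Re, Ci, mode_exponent; simpl; ring.
    - apply Rplus_le_compat_l. apply Rle_trans with (1 := Rle_abs _). apply Rle_trans with (1 := re_le_Cmod _).
      rewrite Cmod_opp, Cmod_mult, Cmod_R; lra. }
  replace (a * - r) with (- (a * r)) in L by ring.
  assert (E := exp_ineq1_le (a * r)). assert (P : 0 < a * r) by nra.
  assert (E1 : exp (- (a * r)) * exp (a * r) = 1) by (rewrite <- exp_plus, <- exp_0; f_equal; ring).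
  assert (E2 := exp_pos (- (a * r))). assert (E3 := exp_pos (a * r)).
  assert (L2 : exp (- (a * r)) * (exp (a * r) - 1) <= Cmod (1 - Cexp (slant a (- r) y))).
  { apply Rle_trans with (2 := L), Rle_trans with (2 := Rle_abs _). lra. }
  assert (Q : 0 < exp (- (a * r)) * (exp (a * r) - 1)) by nra.
  set (d := Cmod (1 - Cexp (slant a (- r) y))) in *.
  set (x := Cmod (Cexp (kernel_exponent a kappa * slant a (- r) y))) in *.
  apply Rle_trans with ((exp (- (a * r)) * exp (Rabs y * Cmod (angular_exponent a kappa))) / (exp (- (a * r)) * (exp (a * r) - 1))).
  - unfold Rdiv. apply Rmult_le_compat; auto; try apply Cmod_ge_0.
    + left; apply Rinv_0_lt_compat; lra.
    + apply Rinv_le_contravar; auto.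
  - replace (_ / _) with (exp (Rabs y * Cmod (angular_exponent a kappa)) / (exp (a * r) - 1)) by (field; split; lra).
    apply decay_bound; auto; try lra; left; apply exp_pos.
Qed.

(** The right end is split by [kernel_shift]; the exponential part integrates to
    the oscillating term. *)
Lemma vertical_sides_eq (a kappa r D : R) : 0 < a -> 0 < r -> kappa <> 1 ->
  (vertical_sides a r (kernel_exponent a kappa) D =
   Ci / (a + Ci) * (RInt_C (fun y => kernel (kernel_exponent a kappa - 1) (slant a r y)) 0 D
                    - RInt_C (fun y => kernel (kernel_exponent a kappa) (slant a (- r) y)) 0 D)
   - oscillation a kappa r * (Cexp (- (D * (angular_exponent a kappa + Ci))) - 1))%C.
Proof.
  intros Ha Hr Hk. assert (Hp := a_Ci_neq_0 a). assert (Hk' := kappa_sub_1_neq_0 _ Hk).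
  assert (HC := Ci_neq_0).
  (* [q = i (b - 1)] is the exponent of the subtracted exponential in [y]. *)
  set (q := (- (angular_exponent a kappa + Ci))%C).
  assert (Hq : (q = Ci * (kernel_exponent a kappa - 1))%C) by (unfold q, angular_exponent; ring).
  assert (Hq2 : (q = Ci * (Ci * (kappa - 1)) / (a + Ci))%C).
  { rewrite Hq; unfold kernel_exponent, mode_exponent; field; auto. }
  set (E0 := Cexp (RtoC r * (Ci * (kappa - 1)))).
  assert (I1 : is_RInt_RC (fun y => q * (E0 * Cexp (y * q)))%C 0 D (E0 * Cexp (D * q) - E0 * Cexp (0 * q))%C).
  { apply (is_RInt_RC_derive (fun y : R => E0 * Cexp (y * q))%C).
    - intros y _. replace (q * (E0 * Cexp (y * q)))%C with (0 * Cexp (y * q) + E0 * (q * Cexp (y * q)))%C by ring.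
      apply (is_derive_RC_mult (fun _ => E0) (fun y : R => Cexp (y * q))).
      + apply is_derive_RC_const.
      + apply (is_derive_RC_Cexp (fun y : R => y * q)%C), is_derive_lin.
    - intros; repeat (apply continuous_Cmult; [apply continuous_const|]). apply continuous_Cexp, continuous_lin. }
  assert (I2 : is_RInt_RC (fun y => q * Cexp ((kernel_exponent a kappa - 1) * slant a r y))%C 0 D
     (q * RInt_C (fun y => Cexp ((kernel_exponent a kappa - 1) * slant a r y)) 0 D)%C).
  { apply is_RInt_RC_scal, RInt_RC_correct. intros; apply continuous_Cexp, continuous_Cmult; [apply continuous_const|].
    apply continuous_slant; [apply continuous_const | apply continuous_id]. }
  apply (is_RInt_RC_ext _ (fun y => q * Cexp ((kernel_exponent a kappa - 1) * slant a r y))%C) in I1.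
  2:{ intros y _. f_equal. unfold E0. rewrite <- Cexp_plus, kernel_exponent_pred_slant. f_equal. unfold q; ring. }
  assert (I3 := eq_trans (eq_sym (is_RInt_RC_unique _ _ _ _ I2)) (is_RInt_RC_unique _ _ _ _ I1)).
  replace (Cexp (0 * q)) with (RtoC 1) in I3 by (rewrite <- Cexp_0; f_equal; ring).
  assert (Ck : forall b y r, r <> 0 -> continuous (fun y => kernel b (slant a r y)) y).
  { intros; apply continuous_kernel_r; auto. }
  assert (I4 : RInt_C (fun y => kernel (kernel_exponent a kappa) (slant a r y)) 0 D =
    (RInt_C (fun y => kernel (kernel_exponent a kappa - 1) (slant a r y)) 0 D
      - RInt_C (fun y => Cexp ((kernel_exponent a kappa - 1) * slant a r y)) 0 D)%C).
  { apply is_RInt_RC_unique.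
    apply (is_RInt_RC_ext (fun y => kernel (kernel_exponent a kappa - 1) (slant a r y) - Cexp ((kernel_exponent a kappa - 1) * slant a r y))%C).
    - intros y _. symmetry; apply kernel_shift, slant_regular; auto; left; lra.
    - apply is_RInt_RC_minus; apply RInt_RC_correct; intros.
      + apply Ck; lra.
      + apply continuous_Cexp, continuous_Cmult; [apply continuous_const|].
        apply continuous_slant; [apply continuous_const | apply continuous_id]. }
  unfold vertical_sides. rewrite I4. unfold oscillation. fold E0.
  replace (- (D * (angular_exponent a kappa + Ci)))%C with (D * q)%C by (unfold q; ring).
  set (J := RInt_C (fun y => Cexp ((kernel_exponent a kappa - 1) * slant a r y)) 0 D) in *.
  set (J1 := RInt_C _ 0 D). set (J2 := RInt_C _ 0 D).
  assert (I5 : (Ci / (a + Ci) * J = E0 / (Ci * (kappa - 1)) * (Cexp (D * q) - 1))%C).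
  { transitivity (/ (Ci * (kappa - 1)) * (q * J))%C.
    - rewrite Hq2; field; auto.
    - rewrite I3; field; auto. }
  transitivity (Ci / (a + Ci) * (J1 - J2) - Ci / (a + Ci) * J)%C; [ring | rewrite I5; ring].
Qed.

(** * Limits of the truncated integrals *)

Lemma limC_bound_inv (f : R -> C) (K : R) :
  (forall r, 0 < r -> Cmod (f r) <= K * / r) -> limC (Rbar_locally p_infty) f 0.
Proof.
  intros H; apply (limC_bound _ _ (fun r => K * / r)).
  - generalize (p_infty_gt 0); apply filter_imp; intros r Hr.
    replace (f r - 0)%C with (f r) by ring. auto.
  - replace 0 with (K * 0) by ring. apply limR_mult; [typeclasses eauto | apply filterlim_const | apply filterlim_Rinv_p_infty].
Qed.

Lemma vertical_sides_lim (a kappa D : R) : 0 < a -> kappa <> 1 ->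
  limC (Rbar_locally p_infty)
    (fun r => vertical_sides a r (kernel_exponent a kappa) D + oscillation a kappa r * (Cexp (- (D * (angular_exponent a kappa + Ci))) - 1))%C 0.
Proof.
  intros Ha Hk.
  set (K1 := exp (Rabs D * Cmod (angular_exponent a kappa + Ci)) / a). set (K2 := exp (Rabs D * Cmod (angular_exponent a kappa)) / a).
  apply (limC_bound_inv _ (Cmod (Ci / (a + Ci)) * (Rabs D * K1 + Rabs D * K2))).
  intros r Hr. rewrite vertical_sides_eq by auto.
  match goal with |- Cmod ?x <= _ => match x with (?y - ?z + _)%C => replace x with y by ring end end.
  rewrite Cmod_mult, Rmult_assoc. apply Rmult_le_compat_l; [apply Cmod_ge_0|].
  apply Rle_trans with (1 := Cmod_triangle _ _). rewrite Cmod_opp, Rmult_plus_distr_r.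
  apply Rplus_le_compat; rewrite Rmult_assoc; apply Cmod_RInt_le_abs.
  - intros s Hs. apply Rle_trans with (1 := kernel_right_bound a kappa r s Ha Hr).
    apply Rmult_le_compat_r; [left; now apply Rinv_0_lt_compat|].
    unfold K1, Rdiv. apply Rmult_le_compat_r; [left; now apply Rinv_0_lt_compat|].
    apply exp_le, Rmult_le_compat_r; auto using Cmod_ge_0.
  - intros; apply continuous_kernel_r; auto; left; lra.
  - intros s Hs. apply Rle_trans with (1 := kernel_left_bound a kappa r s Ha Hr).
    apply Rmult_le_compat_r; [left; now apply Rinv_0_lt_compat|].
    unfold K2, Rdiv. apply Rmult_le_compat_r; [left; now apply Rinv_0_lt_compat|].
    apply exp_le, Rmult_le_compat_r; auto using Cmod_ge_0.
  - intros; apply continuous_kernel_r; auto; left; lra.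
Qed.

(** The kernel [e^{c s} / (1 - w)] of the integrals over one branch. *)
Definition simple_kernel (a kappa s D : R) : C := (Cexp (s * mode_exponent a kappa) / (1 - Cexp (slant a s D)))%C.

Lemma simple_kernel_slant (a kappa s D : R) :
  simple_kernel a kappa s D = (Cexp (D * angular_exponent a kappa) * kernel (kernel_exponent a kappa) (slant a s D))%C.
Proof.
  unfold simple_kernel, kernel. rewrite kernel_exponent_slant.
  replace (s * mode_exponent a kappa)%C with (D * angular_exponent a kappa + (s * mode_exponent a kappa - D * angular_exponent a kappa))%C at 1 by ring.
  rewrite Cexp_plus. unfold Cdiv; ring.
Qed.

Lemma simple_kernel_periodic (a kappa s D : R) : simple_kernel a kappa s (D + 2 * PI) = simple_kernel a kappa s D.
Proof.
  unfold simple_kernel. replace (slant a s (D + 2 * PI)) with (slant a s D + Ci * RtoC (2 * PI))%C.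
  - now rewrite Cexp_2PI.
  - unfold slant. rewrite (RtoC_plus D). ring.
Qed.

Lemma RInt_simple_kernel (a kappa r D : R) : 0 < a -> cos D <> 1 ->
  RInt_C (fun s => simple_kernel a kappa s D) (- r) r = (Cexp (D * angular_exponent a kappa) * horizontal_line a r (kernel_exponent a kappa) D)%C.
Proof.
  intros Ha HD. apply is_RInt_RC_unique.
  apply (is_RInt_RC_ext (fun s => Cexp (D * angular_exponent a kappa) * kernel (kernel_exponent a kappa) (slant a s D))%C).
  { intros; symmetry; apply simple_kernel_slant. }
  apply is_RInt_RC_scal, RInt_RC_correct. intros; apply continuous_kernel_l; auto.
Qed.

(** Half of [2 i PI] times [1 / p], which is up to sign the residue of
    [simple_kernel] at angle [0], as a function of [s]. *)
Definition half_res (a : R) : C := (PI * Ci / (a + Ci))%C.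

(** [Re B = a (kappa - 1) / (1 + a^2)] does not vanish, so that [e^{PI B}] and
    [e^{- PI B}] have different moduli. *)
Lemma Csinh_angular_exponent_neq_0 (a kappa : R) : 0 < a -> kappa <> 1 -> Csinh (PI * angular_exponent a kappa) <> 0.
Proof.
  intros Ha Hk E. unfold Csinh in E.
  assert (E1 : Cexp (PI * angular_exponent a kappa) = Cexp (- (PI * angular_exponent a kappa))).
  { transitivity (2 * ((Cexp (PI * angular_exponent a kappa) - Cexp (- (PI * angular_exponent a kappa))) / 2)
      + Cexp (- (PI * angular_exponent a kappa)))%C; [field | rewrite E; ring].
     }
  apply (f_equal Cmod) in E1. rewrite !Cmod_Cexp in E1. apply exp_inv in E1.
  assert (Re (PI * angular_exponent a kappa) = 0).
  { assert (Re (- (PI * angular_exponent a kappa)) = - Re (PI * angular_exponent a kappa)) by reflexivity. lra. }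
  rewrite Re_Cmult_R in H.
  assert (HB : Re (angular_exponent a kappa) = a * (kappa - 1) / (1 + a ^ 2)).
  { unfold angular_exponent, kernel_exponent, mode_exponent, Ci, RtoC, Re; simpl. field. nra. }
  rewrite HB in H. apply Rmult_integral in H. assert (X := PI_RGT_0). destruct H as [H|H]; [lra|].
  unfold Rdiv in H. apply Rmult_integral in H. destruct H as [H|H].
  - apply Rmult_integral in H. destruct H; lra.
  - revert H. apply Rinv_neq_0_compat. nra.
Qed.

(** [simple_kernel] has period [2 PI] in the angle, so that the lines at heights
    [PI] and [- PI], weighted by [e^{PI B}] and [e^{- PI B}], have equal
    integrals. Expressing both through the principal value gives a linear
    equation for it, in which the oscillating terms agree because
    [e^{i PI} = e^{- i PI}]. *)
Lemma principal_value_lim (a kappa : R) : 0 < a -> kappa <> 1 ->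
  limC (Rbar_locally p_infty) (fun r => principal_value a r (kernel_exponent a kappa) + oscillation a kappa r)%C
    (- (half_res a * (Ccosh (PI * angular_exponent a kappa) / Csinh (PI * angular_exponent a kappa))))%C.
Proof.
  intros Ha Hk. assert (Hs := Csinh_angular_exponent_neq_0 a kappa Ha Hk). assert (Hp := a_Ci_neq_0 a).
  assert (Hpi := PI_RGT_0).
  assert (L1 := vertical_sides_lim a kappa PI Ha Hk). assert (L2 := vertical_sides_lim a kappa (- PI) Ha Hk).
  set (rho1 := fun r => (vertical_sides a r (kernel_exponent a kappa) PI + _)%C) in L1.
  set (rho2 := fun r => (vertical_sides a r (kernel_exponent a kappa) (- PI) + _)%C) in L2.
  set (B := angular_exponent a kappa) in *.
  apply (limC_ext _ (fun r => / (2 * Csinh (PI * B)) *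
    ((Cexp (- (PI * B)) * rho2 r - Cexp (PI * B) * rho1 r) - half_res a * (2 * Ccosh (PI * B))))%C).
  - generalize (p_infty_gt 0); apply filter_imp; intros r Hr.
    assert (E : (Cexp (PI * B) * horizontal_line a r (kernel_exponent a kappa) PI = Cexp (- (PI * B)) * horizontal_line a r (kernel_exponent a kappa) (- PI))%C).
    { replace (- (PI * B))%C with (RtoC (- PI) * B)%C by (rewrite RtoC_opp; ring).
      unfold B. rewrite <- !RInt_simple_kernel; auto; rewrite ?cos_neg, ?cos_PI; try lra.
      apply (RInt_ext (V := C_R_CompleteNormedModule)). intros x _.
      transitivity (simple_kernel a kappa x (- PI + 2 * PI)); [f_equal; ring | apply simple_kernel_periodic]. }
    rewrite horizontal_line_pos, horizontal_line_neg in E by (auto; lra). fold (half_res a) in E.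
    assert (E1 : (Cexp (PI * B) * Cexp (- (PI * (B + Ci))) = - (1))%C).
    { rewrite <- Cexp_plus. replace (PI * B + - (PI * (B + Ci)))%C with (Ci * RtoC (- PI))%C by (rewrite RtoC_opp; ring).
      rewrite Cexp_Ci, cos_neg, sin_neg, cos_PI, sin_PI. apply C_eq; simpl; ring. }
    assert (E2 : (Cexp (- (PI * B)) * Cexp (- (RtoC (- PI) * (B + Ci))) = - (1))%C).
    { rewrite <- Cexp_plus. replace (- (PI * B) + - (RtoC (- PI) * (B + Ci)))%C with (Ci * PI)%C by (rewrite RtoC_opp; ring).
      rewrite Cexp_Ci, cos_PI, sin_PI. apply C_eq; simpl; ring. }
    assert (X1 : vertical_sides a r (kernel_exponent a kappa) PI = (rho1 r - oscillation a kappa r * (Cexp (- (PI * (B + Ci))) - 1))%C) by (unfold rho1; ring).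
    assert (X2 : vertical_sides a r (kernel_exponent a kappa) (- PI) = (rho2 r - oscillation a kappa r * (Cexp (- (RtoC (- PI) * (B + Ci))) - 1))%C) by (unfold rho2; ring).
    rewrite X1, X2 in E.
    set (v := principal_value a r (kernel_exponent a kappa)) in *. set (gr := oscillation a kappa r) in *.
    assert (E3 : (2 * Csinh (PI * B) * (v + gr) = (Cexp (- (PI * B)) * rho2 r - Cexp (PI * B) * rho1 r) - half_res a * (2 * Ccosh (PI * B)))%C).
    { unfold Csinh, Ccosh. set (e1 := Cexp (PI * B)) in *. set (e2 := Cexp (- (PI * B))) in *.
      set (f1 := Cexp (- (PI * (B + Ci)))) in *. set (f2 := Cexp (- (RtoC (- PI) * (B + Ci)))) in *.
      match type of E with (?l1 = ?l2)%C =>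
        transitivity (l1 - l2 + (e2 * rho2 r - e1 * rho1 r - half_res a * (e1 + e2)) + gr * ((e1 * f1) - (e2 * f2)))%C end.
      - field.
      - rewrite E, E1, E2. field. }
    rewrite <- E3. field. auto.
  - replace (- (half_res a * (Ccosh (PI * B) / Csinh (PI * B))))%C with
     (/ (2 * Csinh (PI * B)) * ((Cexp (- (PI * B)) * 0 - Cexp (PI * B) * 0) - half_res a * (2 * Ccosh (PI * B))))%C
     by (field; auto).
    apply limC_scal; [typeclasses eauto|]. apply limC_minus; [typeclasses eauto| |apply limC_const; typeclasses eauto].
    apply limC_minus; [typeclasses eauto| |]; apply limC_scal; auto; typeclasses eauto.
Qed.

(** The quotient of [calB] by [sinh (PI B)], as a function of the angle. *)
Definition mode_coef (B : C) (D : R) : C :=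
  (Cexp (D * B) *
   (if Rlt_dec 0 D then Cexp (- (PI * B))
    else if Rlt_dec D 0 then Cexp (PI * B)
    else Ccosh (PI * B)) / Csinh (PI * B))%C.

(** At angle [0] the integral is a principal value. *)
Definition simple_integral (a kappa r D : R) : C :=
  if Req_EM_T D 0 then principal_value a r (kernel_exponent a kappa) else RInt_C (fun s => simple_kernel a kappa s D) (- r) r.

(** The line at height [D] differs from the principal value by [half_res], with
    the sign of [D]. Since [cosh - sinh] and [cosh + sinh] are exponentials, the
    three cases are those of [mode_coef]. *)
Lemma simple_integral_lim (a kappa D : R) : 0 < a -> kappa <> 1 -> Rabs D < 2 * PI ->
  limC (Rbar_locally p_infty) (fun r => simple_integral a kappa r D + oscillation a kappa r * Cexp (- (Ci * D)))%C
    (- (half_res a * mode_coef (angular_exponent a kappa) D))%C.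
Proof.
  intros Ha Hk HD. assert (Hs := Csinh_angular_exponent_neq_0 a kappa Ha Hk).
  assert (HP := principal_value_lim a kappa Ha Hk). unfold simple_integral. set (B := angular_exponent a kappa) in *.
  destruct (Req_EM_T D 0) as [->|Hn].
  - unfold mode_coef. destruct (Rlt_dec 0 0); [lra|].
    replace (Cexp (0 * B)) with (RtoC 1) by (rewrite <- Cexp_0; f_equal; ring).
    replace (Cexp (- (Ci * 0))) with (RtoC 1) by (rewrite <- Cexp_0; f_equal; ring).
    replace (- (half_res a * (1 * Ccosh (PI * B) / Csinh (PI * B))))%C with
      (- (half_res a * (Ccosh (PI * B) / Csinh (PI * B))))%C by (field; auto).
    eapply limC_ext; [| |exact HP]. typeclasses eauto. apply filter_forall; intros; ring.
  - assert (HcD : cos D <> 1).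
    { apply cos_neq_1. split; auto. now apply Rabs_pos_lt. }
    assert (HV := vertical_sides_lim a kappa D Ha Hk). fold B in HV.
    assert (E1 : (Cexp (D * B) * Cexp (- (D * (B + Ci))) = Cexp (- (Ci * D)))%C).
    { rewrite <- Cexp_plus; f_equal; ring. }
    assert (G : forall sg : C, (forall r, 0 < r -> horizontal_line a r (kernel_exponent a kappa) D = (principal_value a r (kernel_exponent a kappa) + vertical_sides a r (kernel_exponent a kappa) D + sg * half_res a)%C) ->
      limC (Rbar_locally p_infty) (fun r => RInt_C (fun s => simple_kernel a kappa s D) (- r) r + oscillation a kappa r * Cexp (- (Ci * D)))%C
      (Cexp (D * B) * (- (half_res a * (Ccosh (PI * B) / Csinh (PI * B))) + 0 + sg * half_res a))%C).
    { intros sg Hsg.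
      eapply limC_ext; [typeclasses eauto| | apply limC_scal; [typeclasses eauto|]; apply limC_plus; [typeclasses eauto| |apply limC_const; typeclasses eauto];
       apply limC_plus; [typeclasses eauto| exact HP | exact HV]].
      generalize (p_infty_gt 0); apply filter_imp; intros r Hr.
      rewrite RInt_simple_kernel, Hsg by auto. fold B. rewrite <- E1. ring. }
    unfold mode_coef. destruct (Rlt_dec 0 D) as [H|H]; [|destruct (Rlt_dec D 0) as [H'|H']; [|lra]].
    + rewrite Rabs_pos_eq in HD by lra.
      match goal with |- limC _ _ ?x => replace x with (Cexp (D * B) * (- (half_res a * (Ccosh (PI * B) / Csinh (PI * B))) + 0 + 1 * half_res a))%C end.
      * apply G. intros. rewrite horizontal_line_pos; auto. unfold half_res; ring.
      * replace (Cexp (- (PI * B))) with (Ccosh (PI * B) - Csinh (PI * B))%C by (unfold Ccosh, Csinh; field).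
        field; auto.
    + rewrite Rabs_left in HD by lra.
      match goal with |- limC _ _ ?x => replace x with (Cexp (D * B) * (- (half_res a * (Ccosh (PI * B) / Csinh (PI * B))) + 0 + -(1) * half_res a))%C end.
      * apply G. intros. replace D with (- - D) by ring. rewrite horizontal_line_neg by (auto; lra).  unfold half_res; ring.
      * replace (Cexp (PI * B)) with (Ccosh (PI * B) + Csinh (PI * B))%C by (unfold Ccosh, Csinh; field).
        field; auto.
Qed.

(** The integral of [double_kernel] over [[-r, r]] after integration by parts.
    At angle [0] this is what remains of it when the terms diverging at the pole
    are dropped. *)
Definition double_integral (a kappa r D : R) : C :=
  ((simple_kernel a kappa r D - simple_kernel a kappa (- r) D - mode_exponent a kappa * simple_integral a kappa r D) / (a + Ci))%C.

Lemma simple_kernel_right_lim (a kappa D : R) : 0 < a -> kappa <> 1 ->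
  limC (Rbar_locally p_infty) (fun r => simple_kernel a kappa r D + Ci * (kappa - 1) * oscillation a kappa r * Cexp (- (Ci * D)))%C 0.
Proof.
  intros Ha Hk. assert (Hk' := kappa_sub_1_neq_0 _ Hk). assert (HC := Ci_neq_0).
  replace (RtoC 0) with (Cexp (D * angular_exponent a kappa) * 0)%C by ring.
  apply (limC_ext _ (fun r => Cexp (D * angular_exponent a kappa) * kernel (kernel_exponent a kappa - 1) (slant a r D))%C).
  - generalize (p_infty_gt 0); apply filter_imp; intros r Hr.
    rewrite simple_kernel_slant, (kernel_shift (kernel_exponent a kappa)) by (apply slant_regular; auto; left; lra).
    unfold oscillation. rewrite kernel_exponent_pred_slant.
    replace (r * (Ci * (kappa - 1)) - D * (angular_exponent a kappa + Ci))%C with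
       (r * (Ci * (kappa - 1)) + (- (D * angular_exponent a kappa) + - (Ci * D)))%C by ring.
    rewrite !Cexp_plus, !Cexp_opp. field.
    repeat split; auto; apply Cexp_neq_0.
  - apply limC_scal; [typeclasses eauto|].
    apply (limC_bound_inv _ (exp (Rabs D * Cmod (angular_exponent a kappa + Ci)) / a)).
    intros; apply kernel_right_bound; auto.
Qed.

Lemma simple_kernel_left_lim (a kappa D : R) : 0 < a ->
  limC (Rbar_locally p_infty) (fun r => simple_kernel a kappa (- r) D) 0.
Proof.
  intros Ha.
  replace (RtoC 0) with (Cexp (D * angular_exponent a kappa) * 0)%C by ring.
  apply (limC_ext _ (fun r => Cexp (D * angular_exponent a kappa) * kernel (kernel_exponent a kappa) (slant a (- r) D))%C).
  - apply filter_forall; intros r. symmetry; apply simple_kernel_slant.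
  - apply limC_scal; [typeclasses eauto|].
    apply (limC_bound_inv _ (exp (Rabs D * Cmod (angular_exponent a kappa)) / a)).
    intros; apply kernel_left_bound; auto.
Qed.

(** The oscillating terms of the boundary values and of [simple_integral] add
    up, by [(c - p) - c = - p], to a multiple of [e^{- i D}] with a factor
    independent of [D]. *)
Lemma double_integral_lim (a kappa D : R) : 0 < a -> kappa <> 1 -> Rabs D < 2 * PI ->
  limC (Rbar_locally p_infty) (fun r => double_integral a kappa r D - oscillation a kappa r * Cexp (- (Ci * D)))%C
    (half_res a * kernel_exponent a kappa * mode_coef (angular_exponent a kappa) D)%C.
Proof.
  intros Ha Hk HD. assert (Hp := a_Ci_neq_0 a).
  assert (L1 := simple_kernel_right_lim a kappa D Ha Hk). assert (L2 := simple_kernel_left_lim a kappa D Ha).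
  assert (L3 := simple_integral_lim a kappa D Ha Hk HD).
  apply (limC_scal _ (mode_exponent a kappa)) in L3.
  assert (L4 := limC_minus _ _ _ _ _ (limC_minus _ _ _ _ _ L1 L2) L3).
  apply (limC_scal _ (/ (a + Ci))) in L4.
  replace (half_res a * kernel_exponent a kappa * mode_coef (angular_exponent a kappa) D)%C with
    (/ (a + Ci) * (0 - 0 - mode_exponent a kappa * - (half_res a * mode_coef (angular_exponent a kappa) D)))%C
    by (unfold kernel_exponent; field; auto).
  refine (limC_ext _ _ _ _ _ L4).
  apply filter_forall; intros r. unfold double_integral.
  set (x := simple_kernel a kappa r D). set (y := simple_kernel _ _ _ _). set (z := simple_integral _ _ _ _). unfold mode_exponent. field; auto.
Qed.

(** * Finite sums *)

Lemma Csum_1 (u : nat -> C) : Csum 1 u = u 0%nat.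
Proof. unfold Csum; simpl. apply sum_O. Qed.

Lemma Csum_S (n : nat) (u : nat -> C) : Csum (S (S n)) u = (Csum (S n) u + u (S n))%C.
Proof. unfold Csum; simpl. rewrite Nat.sub_0_r, sum_Sn. reflexivity. Qed.

Lemma Csum_ext (M : nat) (u v : nat -> C) : (0 < M)%nat ->
  (forall k, (k < M)%nat -> u k = v k) -> Csum M u = Csum M v.
Proof.
  intros HM H. unfold Csum. apply sum_n_ext_loc. intros; apply H; lia.
Qed.

Lemma Csum_plus (M : nat) (u v : nat -> C) : (0 < M)%nat ->
  Csum M (fun k => u k + v k)%C = (Csum M u + Csum M v)%C.
Proof.
  destruct M as [|n]; [lia|]. intros _.
  induction n as [|n IH]; [now rewrite !Csum_1|]. rewrite !Csum_S, IH. ring.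
Qed.

Lemma Csum_scal (M : nat) (z : C) (u : nat -> C) : (0 < M)%nat ->
  Csum M (fun k => z * u k)%C = (z * Csum M u)%C.
Proof.
  destruct M as [|n]; [lia|]. intros _.
  induction n as [|n IH]; [now rewrite !Csum_1|]. rewrite !Csum_S, IH. ring.
Qed.

Lemma Csum_conj (M : nat) (u : nat -> C) : (0 < M)%nat ->
  Cconj (Csum M u) = Csum M (fun k => Cconj (u k)).
Proof.
  destruct M as [|n]; [lia|]. intros _.
  induction n as [|n IH]; [now rewrite !Csum_1|]. rewrite !Csum_S, Cplus_conj, IH. reflexivity.
Qed.

(** Adds back the one term that the truncated operator treats separately. *)
Lemma Csum_split (M m : nat) (u v : nat -> C) (z : C) : (m < M)%nat ->
  (forall k, (k < M)%nat -> k <> m -> u k = v k) -> u m = 0 -> v m = z ->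
  (z + Csum M u = Csum M v)%C.
Proof.
  destruct M as [|n]; [lia|].
  revert m; induction n as [|n IH]; intros m Hm H Hu Hv.
  - rewrite !Csum_1. replace m with 0%nat in * by lia. rewrite Hu, Hv; ring.
  - rewrite !Csum_S. destruct (Nat.eq_dec m (S n)) as [->|Hne].
    + rewrite Hu, Hv, (Csum_ext (S n) u v); [ring | lia |]. intros; apply H; lia.
    + assert (E : (z + Csum (S n) u = Csum (S n) v)%C) by (apply (IH m); auto; lia).
      rewrite <- E, (H (S n)) by lia. ring.
Qed.

Lemma Csum_lim {T} (F : (T -> Prop) -> Prop) {FF : Filter F} (M : nat) (u : T -> nat -> C) (l : nat -> C) :
  (0 < M)%nat -> (forall k, (k < M)%nat -> limC F (fun x => u x k) (l k)) ->
  limC F (fun x => Csum M (u x)) (Csum M l).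
Proof.
  destruct M as [|n]; [lia|]. intros _.
  induction n as [|n IH]; intros H.
  - rewrite Csum_1. apply (limC_ext F (fun x => u x 0%nat)).
    { apply filter_forall; intros; now rewrite Csum_1. } apply H; lia.
  - rewrite Csum_S. apply (limC_ext F (fun x => Csum (S n) (u x) + u x (S n))%C).
    { apply filter_forall; intros; now rewrite Csum_S. }
    apply limC_plus; auto; apply H; lia.
Qed.

Lemma Csum_telescope (M : nat) (U : nat -> C) : (0 < M)%nat ->
  Csum M (fun k => U (S k) - U k)%C = (U M - U 0%nat)%C.
Proof.
  destruct M as [|n]; [lia|]. intros _.
  induction n as [|n IH]; [now rewrite !Csum_1|]. rewrite !Csum_S, IH. ring.
Qed.

(** * Sums over the branches *)

Lemma theta_S (M k : nat) : (0 < M)%nat -> theta M (S k) = theta M k + 2 * PI / INR M.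
Proof. intros HM. unfold theta. rewrite S_INR. field. apply not_0_INR; lia. Qed.

Lemma theta_0 (M : nat) : theta M 0 = 0.
Proof. unfold theta; simpl. unfold Rdiv; ring. Qed.

Lemma theta_M (M : nat) : (0 < M)%nat -> theta M M = 2 * PI.
Proof. intros HM. unfold theta. field. apply not_0_INR; lia. Qed.

Lemma theta_lt (M k m : nat) : (0 < M)%nat -> (k < m)%nat -> theta M k < theta M m.
Proof.
  intros HM H. unfold theta, Rdiv. assert (0 < INR M) by (apply lt_0_INR; lia).
  apply Rmult_lt_compat_r; [now apply Rinv_0_lt_compat|].
  apply Rmult_lt_compat_l; [generalize PI_RGT_0; lra|]. now apply lt_INR.
Qed.

Lemma theta_range (M k : nat) : (k < M)%nat -> 0 <= theta M k < 2 * PI.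
Proof.
  intros H; split.
  - rewrite <- (theta_0 M). destruct k; [lra|]. left; apply theta_lt; lia.
  - rewrite <- (theta_M M) by lia. apply theta_lt; lia.
Qed.

Lemma Delta_bound (M k m : nat) : (k < M)%nat -> (m < M)%nat -> Rabs (Delta M k m) < 2 * PI.
Proof.
  intros Hk Hm. unfold Delta. generalize (theta_range M k Hk) (theta_range M m Hm); intros.
  apply Rabs_def1; lra.
Qed.

Lemma Delta_diag (M m : nat) : Delta M m m = 0.
Proof. unfold Delta; ring. Qed.

Lemma Delta_neq_0 (M k m : nat) : (0 < M)%nat -> k <> m -> Delta M k m <> 0.
Proof.
  intros HM H. unfold Delta. destruct (Nat.lt_total k m) as [L|[L|L]]; [|lia|];
   generalize (theta_lt M _ _ HM L); lra.
Qed.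

(** A geometric sum of ratio [e^{- 4 i PI / M}], which is not [1] as [M >= 3]. *)
Lemma sum_squared_roots (M m : nat) : (3 <= M)%nat ->
  Csum M (fun k => Cexp (- (Ci * Delta M k m)) * Cexp (- (Ci * Delta M k m)))%C = 0.
Proof.
  intros HM. assert (HM' : (0 < M)%nat) by lia.
  set (q := Cexp (- (2 * Ci * RtoC (2 * PI / INR M)))).
  assert (Hq : (q - 1 <> 0)%C).
  { intros E. assert (E1 : q = 1) by (transitivity (q - 1 + 1)%C; [ring | rewrite E; ring]).
    apply Cexp_eq_1 in E1. destruct E1 as [_ E1].
    replace (Im (- (2 * Ci * RtoC (2 * PI / INR M)))) with (- (4 * PI / INR M)) in E1
      by (unfold Im, Ci, RtoC; simpl; unfold Rdiv; ring).
    rewrite cos_neg in E1. revert E1. apply cos_neq_1_pos.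
    assert (HI : 3 <= INR M) by (replace 3 with (INR 3) by (simpl; ring); now apply le_INR).
    assert (X := PI_RGT_0). split.
    - apply Rdiv_lt_0_compat; lra.
    - apply Rlt_div_l; [lra|]. nra. }
  set (U := fun k => (Cexp (- (2 * Ci * RtoC (theta M k))) * Cexp (2 * Ci * RtoC (theta M m)) / (q - 1))%C).
  rewrite (Csum_ext M _ (fun k => U (S k) - U k)%C); auto.
  - rewrite Csum_telescope by auto. unfold U. rewrite theta_0, theta_M by auto.
    replace (Cexp (- (2 * Ci * RtoC (2 * PI)))) with (RtoC 1).
    + replace (Cexp (- (2 * Ci * 0))) with (RtoC 1) by (rewrite <- Cexp_0; f_equal; ring). ring.
    + rewrite Cexp_opp. replace (2 * Ci * RtoC (2 * PI))%C with (0 + Ci * RtoC (2 * PI) + Ci * RtoC (2 * PI))%C by ring.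
      rewrite !Cexp_2PI, Cexp_0. field.
  - intros k Hk. unfold U. rewrite theta_S by auto.
    rewrite (RtoC_plus (theta M k)).
    replace (- (2 * Ci * (theta M k + RtoC (2 * PI / INR M))))%C with
      (- (2 * Ci * theta M k) + - (2 * Ci * RtoC (2 * PI / INR M)))%C by ring.
    rewrite Cexp_plus. fold q. rewrite <- Cexp_plus.
    unfold Delta. rewrite RtoC_minus.
    replace (- (Ci * (theta M k - theta M m)) + - (Ci * (theta M k - theta M m)))%C
     with (- (2 * Ci * theta M k) + 2 * Ci * theta M m)%C by ring.
    rewrite Cexp_plus. field. auto.
Qed.

(** [A] and the exponent for [kappa = -1] differ by [i], which compensates the
    factor [e^{- i D}] in [coth_sum]. *)
Lemma angular_exponent_m1 (a : R) : angular_exponent a (-1) = (A_coef a + Ci)%C.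
Proof.
  unfold angular_exponent, kernel_exponent, mode_exponent, A_coef. assert (Hp := a_Ci_neq_0 a).
  transitivity ((- (Ci * (a + Ci * (-1)))) / (a + Ci))%C; [field; auto|].
  transitivity ((- (2 * a * Ci) + Ci * (a + Ci)) / (a + Ci))%C; [|field; auto].
  f_equal. apply C_eq; unfold Ci, RtoC, Re, Im; simpl; ring.
Qed.

(** With [h = e^{PI A / M}] the [k]-th term is, away from [k = m], a multiple of
    [h^{2 (k - m)}], by one constant for [k < m] and another one for [k > m].
    Multiplied by [h^2 - 1] the terms telescope on each side of [m], the two ends
    of the sum cancel as [h^M = e^{PI A}], and the jump of the constant together
    with the diagonal term leaves [h^2 + 1]. *)
Lemma coth_sum (M m : nat) (a : R) : (3 <= M)%nat -> (m < M)%nat -> 0 < a ->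
  Csum M (fun k => Cexp (- (Ci * Delta M k m)) * mode_coef (angular_exponent a (-1)) (Delta M k m))%C
   = Ccoth (PI * A_coef a / INR M).
Proof.
  intros HM Hm Ha. assert (HM' : (0 < M)%nat) by lia.
  assert (HI : INR M <> 0) by (apply not_0_INR; lia).
  assert (HIC : RtoC (INR M) <> 0) by (intros E; apply HI, RtoC_inj, E).
  assert (Hs := Csinh_angular_exponent_neq_0 a (-1) Ha ltac:(lra)). rewrite angular_exponent_m1 in *.
  set (A := A_coef a) in *.
  assert (Epi : Cexp (PI * (A + Ci)) = (- Cexp (PI * A))%C).
  { replace (PI * (A + Ci))%C with (PI * A + Ci * PI)%C by ring.
    rewrite Cexp_plus, Cexp_Ci, cos_PI, sin_PI. apply C_eq; simpl; ring. }
  assert (Emi : Cexp (- (PI * (A + Ci))) = (- / Cexp (PI * A))%C).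
  { rewrite Cexp_opp, Epi. field. apply Cexp_neq_0. }
  set (Q := Cexp (PI * A)) in *. assert (HQ : Q <> 0) by apply Cexp_neq_0.
  set (h := Cexp (PI * A / INR M)). assert (Hh : h <> 0) by apply Cexp_neq_0.
  assert (Esh : Csinh (PI * (A + Ci)) = (- ((Q - / Q) / 2))%C).
  { unfold Csinh. rewrite Epi, Emi. field. auto. }
  assert (Ech : Ccosh (PI * (A + Ci)) = (- ((Q + / Q) / 2))%C).
  { unfold Ccosh. rewrite Epi, Emi. field. auto. }
  rewrite Esh in Hs.
  assert (HQ2 : (Q * Q - 1 <> 0)%C).
  { intros E; apply Hs. transitivity (- ((Q * Q - 1) / (2 * Q)))%C; [field; auto | rewrite E; field; auto]. }
  set (e := fun k => Cexp (Delta M k m * A)).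
  assert (Estep : forall k, e (S k) = (e k * (h * h))%C).
  { intros k. unfold e, h. rewrite <- !Cexp_plus. f_equal. unfold Delta. rewrite theta_S by auto.
    unfold Rdiv. rewrite !RtoC_minus, !RtoC_plus, !RtoC_mult, RtoC_inv by auto. field; auto. }
  assert (EM : e M = (e 0%nat * (Q * Q))%C).
  { unfold e, Q. rewrite <- !Cexp_plus. f_equal. unfold Delta. rewrite theta_0, theta_M by auto.
    rewrite !RtoC_minus, RtoC_mult. ring. }
  assert (Em : e m = 1). { unfold e; rewrite Delta_diag, <- Cexp_0; f_equal; ring. }
  assert (Hhh : (h * h - 1 <> 0)%C).
  { intros E. apply HQ2.
    assert (E1 : (h * h = 1)%C) by (transitivity (h * h - 1 + 1)%C; [ring | rewrite E; ring]).
    assert (E2 : forall k, e k = e 0%nat).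
    { induction k as [|k IH]; auto. rewrite Estep, IH, E1; ring. }
    rewrite E2 in EM. rewrite E2 in Em. rewrite Em in EM.
    transitivity (1 * (Q * Q) - 1)%C; [ring | rewrite <- EM; ring]. }
  set (sh := ((Q - / Q) / 2)%C) in *.
  assert (Hsh : sh <> 0) by (intros E; apply Hs; rewrite E; ring).
  (* The antidifference of the terms, discontinuous after [k = m]. *)
  set (U := fun k => (e k * (if le_dec k m then Q else / Q) / ((h * h - 1) * sh))%C).
  rewrite <- (Csum_split M m (fun k => if Nat.eqb k m then RtoC 0 else
     (Cexp (- (Ci * Delta M k m)) * mode_coef (A + Ci) (Delta M k m))%C) _
     (Cexp (- (Ci * Delta M m m)) * mode_coef (A + Ci) (Delta M m m))%C); auto.
  2:{ intros k Hk Hne. apply Nat.eqb_neq in Hne; now rewrite Hne. }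
  2:{ now rewrite Nat.eqb_refl. }
  assert (Hterm : forall k, (k < M)%nat -> k <> m ->
    (Cexp (- (Ci * Delta M k m)) * mode_coef (A + Ci) (Delta M k m) = U (S k) - U k)%C).
  { intros k Hk Hne.
    assert (E0 : (Cexp (- (Ci * Delta M k m)) * Cexp (Delta M k m * (A + Ci)) = e k)%C).
    { unfold e. rewrite <- Cexp_plus; f_equal; ring. }
    unfold mode_coef, U. rewrite Estep, Esh.
    destruct (Nat.lt_total k m) as [L|[L|L]]; [|lia|].
    - assert (LD := theta_lt M _ _ HM' L).
      destruct (Rlt_dec 0 (Delta M k m)) as [D|D]; [unfold Delta in D; lra|].
      destruct (Rlt_dec (Delta M k m) 0) as [D'|D']; [|unfold Delta in D'; lra].
      destruct (le_dec k m); [|lia]. destruct (le_dec (S k) m); [|lia].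
      rewrite Epi, <- E0. field. auto.
    - assert (LD := theta_lt M _ _ HM' L).
      destruct (Rlt_dec 0 (Delta M k m)) as [D|D]; [|unfold Delta in D; lra].
      destruct (le_dec k m); [lia|]. destruct (le_dec (S k) m); [lia|].
      rewrite Emi, <- E0. field. auto. }
  assert (Hdiag : (Cexp (- (Ci * Delta M m m)) * mode_coef (A + Ci) (Delta M m m) =
     (U (S m) - U m) + (h * h + 1) / (h * h - 1))%C).
  { unfold mode_coef, U. rewrite Estep, Em, Delta_diag, Esh.
    destruct (Rlt_dec 0 0); [lra|]. destruct (le_dec m m); [|lia]. destruct (le_dec (S m) m); [lia|].
    replace (Cexp (- (Ci * 0))) with (RtoC 1) by (rewrite <- Cexp_0; f_equal; ring).
    replace (Cexp (0 * (A + Ci))) with (RtoC 1) by (rewrite <- Cexp_0; f_equal; ring).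
    rewrite Ech.
    unfold sh. field. repeat split; auto. }
  assert (Htel := Csum_telescope M U HM').
  assert (HU : U M = U 0%nat).
  { unfold U. rewrite EM. destruct (le_dec M m); [lia|]. destruct (le_dec 0 m); [|lia]. field; auto. }
  rewrite HU in Htel.
  transitivity ((h * h + 1) / (h * h - 1) + Csum M (fun k => U (S k) - U k))%C.
  - rewrite <- (Csum_split M m (fun k => if Nat.eqb k m then RtoC 0 else (U (S k) - U k)%C)
      (fun k => (U (S k) - U k)%C) (U (S m) - U m)%C); auto.
    + rewrite Hdiag, (Csum_ext M _ (fun k => if Nat.eqb k m then RtoC 0 else (U (S k) - U k)%C)); auto.
      * ring.
      * intros k Hk. destruct (Nat.eqb_spec k m); auto.
    + intros k Hk Hne. apply Nat.eqb_neq in Hne; now rewrite Hne.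
    + now rewrite Nat.eqb_refl.
  - rewrite Htel. unfold Ccoth, Ccosh, Csinh. rewrite Cexp_opp. fold h.
    field. auto.
Qed.

(** * From the double pole to the simple pole *)

Definition double_kernel (a kappa s D : R) : C :=
  (Cexp (s * mode_exponent a kappa) * Cexp (slant a s D) / (1 - Cexp (slant a s D)) ^ 2)%C.

Lemma is_derive_simple_kernel (a kappa s D : R) : 0 < a -> s <> 0 \/ cos D <> 1 ->
  is_derive_RC (fun s => simple_kernel a kappa s D) s (mode_exponent a kappa * simple_kernel a kappa s D + (a + Ci) * double_kernel a kappa s D)%C.
Proof.
  intros Ha H. assert (Hr := slant_regular a s D Ha H). assert (Hp := a_Ci_neq_0 a).
  assert (E : is_derive_RC (fun s => Cexp (D * angular_exponent a kappa) * kernel (kernel_exponent a kappa) (slant a s D))%C s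
    (0 * kernel (kernel_exponent a kappa) (slant a s D) + Cexp (D * angular_exponent a kappa) * ((a + Ci) * dkernel (kernel_exponent a kappa) (slant a s D)))%C).
  { apply (is_derive_RC_mult (fun _ => Cexp (D * angular_exponent a kappa)) (fun s => kernel (kernel_exponent a kappa) (slant a s D))).
    apply is_derive_RC_const.
    apply (is_derive_kernel _ _ (fun s => slant a s D)); auto. apply is_derive_slant_l. }
  apply (is_derive_ext (V := C_R_NormedModule) (fun s => Cexp (D * angular_exponent a kappa) * kernel (kernel_exponent a kappa) (slant a s D))%C).
  { intros; symmetry; apply simple_kernel_slant. }
  match goal with |- is_derive _ _ ?x => match type of E with is_derive_RC _ _ ?y => replace x with y; [exact E|] end end.
  unfold dkernel.
  transitivity ((a + Ci) * (kernel_exponent a kappa + Cexp (slant a s D) / (1 - Cexp (slant a s D))) * simple_kernel a kappa s D)%C.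
  - rewrite simple_kernel_slant; ring.
  - unfold double_kernel, simple_kernel, kernel_exponent. simpl. field. split; auto.
Qed.

Lemma continuous_simple_kernel (a kappa s D : R) : 0 < a -> s <> 0 \/ cos D <> 1 -> continuous (fun s => simple_kernel a kappa s D) s.
Proof. intros; eapply is_derive_RC_continuous, is_derive_simple_kernel; auto. Qed.

Lemma continuous_double_kernel (a kappa s D : R) : 0 < a -> s <> 0 \/ cos D <> 1 -> continuous (fun s => double_kernel a kappa s D) s.
Proof.
  intros Ha H. assert (Hr := slant_regular a s D Ha H).
  assert (Hc : continuous (fun s => slant a s D) s).
  { apply continuous_slant; [apply continuous_id | apply continuous_const]. }
  assert (Hd : continuous (fun s => 1 - Cexp (slant a s D))%C s).
  { apply continuous_Cminus; [apply continuous_const | apply continuous_Cexp; auto]. }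
  apply continuous_Cdiv; simpl.
  - apply continuous_Cmult; apply continuous_Cexp; auto. apply continuous_lin.
  - apply continuous_Cmult; auto. apply continuous_Cmult; auto. apply continuous_const.
  - apply Cmult_neq_0; auto. rewrite Cmult_1_r; auto.
Qed.

Lemma RInt_double_kernel (a kappa u v D : R) : 0 < a -> u <= v ->
  (forall s, u <= s <= v -> s <> 0 \/ cos D <> 1) ->
  RInt_C (fun s => double_kernel a kappa s D) u v =
   ((simple_kernel a kappa v D - simple_kernel a kappa u D - mode_exponent a kappa * RInt_C (fun s => simple_kernel a kappa s D) u v) / (a + Ci))%C.
Proof.
  intros Ha Huv H. assert (Hp := a_Ci_neq_0 a).
  assert (CK : is_RInt_RC (fun s => mode_exponent a kappa * simple_kernel a kappa s D)%C u v (mode_exponent a kappa * RInt_C (fun s => simple_kernel a kappa s D) u v)%C).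
  { apply is_RInt_RC_scal, RInt_RC_correct; rewrite Rmin_left, Rmax_right by lra; intros; apply continuous_simple_kernel; auto. }
  assert (CN : is_RInt_RC (fun s => (a + Ci) * double_kernel a kappa s D)%C u v ((a + Ci) * RInt_C (fun s => double_kernel a kappa s D) u v)%C).
  { apply is_RInt_RC_scal, RInt_RC_correct; rewrite Rmin_left, Rmax_right by lra; intros; apply continuous_double_kernel; auto. }
  assert (E := is_RInt_RC_plus _ _ _ _ _ _ CK CN).
  assert (E2 : is_RInt_RC (fun s => mode_exponent a kappa * simple_kernel a kappa s D + (a + Ci) * double_kernel a kappa s D)%C u v (simple_kernel a kappa v D - simple_kernel a kappa u D)%C).
  { apply (is_RInt_RC_derive (fun s => simple_kernel a kappa s D)); rewrite Rmin_left, Rmax_right by lra; intros.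
    - apply is_derive_simple_kernel; auto.
    - apply continuous_Cplus; apply continuous_Cmult; try apply continuous_const;
        [apply continuous_simple_kernel | apply continuous_double_kernel]; auto. }
  assert (E3 := eq_trans (eq_sym (is_RInt_RC_unique _ _ _ _ E)) (is_RInt_RC_unique _ _ _ _ E2)).
  rewrite <- E3. field. auto.
Qed.

Lemma quotient_lim_R (f : R -> R) (l : R) :
  is_derive f 0 l -> filterlim (fun e => (f e - f 0) / e) (at_right 0) (locally l).
Proof.
  intros H. apply is_derive_Reals in H.
  apply filterlim_locally; intros eps. destruct (H eps (cond_pos eps)) as [d Hd].
  exists d. intros y Hy Hy0. specialize (Hd y). rewrite Rplus_0_l in Hd.
  apply Hd; [lra|]. assert (K : Rabs (y - 0) < d) by exact Hy. now rewrite Rminus_0_r in K.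
Qed.

Lemma quotient_lim (f : R -> C) (l : C) :
  is_derive_RC f 0 l -> limC (at_right 0) (fun e => (f e - f 0%R) / e)%C l.
Proof.
  intros H. apply (limC_ext _ (fun e => ((Re (f e) - Re (f 0)) / e, (Im (f e) - Im (f 0)) / e)%R)).
  - generalize (filter_at_right_lt 1 Rlt_0_1); apply filter_imp; intros e He.
    apply C_eq; unfold Re, Im; simpl; field; lra.
  - apply limC_pair; [typeclasses eauto| |]; simpl.
    + apply (quotient_lim_R (fun e => Re (f e))), is_derive_RC_Re, H.
    + apply (quotient_lim_R (fun e => Im (f e))), is_derive_RC_Im, H.
Qed.

Lemma quotient_lim_neg (f : R -> C) (l : C) :
  is_derive_RC f 0 l -> limC (at_right 0) (fun e => (f (- e)%R - f 0%R) / e)%C (- l)%C.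
Proof.
  intros H.
  assert (H' : is_derive_RC (fun s => f (- s)) 0 (- l)%C).
  { rewrite <- Ropp_0 in H at 1.
    assert (Hc := is_derive_comp (K := R_AbsRing) (V := C_R_NormedModule) f Ropp 0 l (- 1) H).
    unfold is_derive_RC. replace (- l)%C with (scal (- 1) l : C_R_NormedModule).
    - apply Hc. apply (is_derive_opp (K := R_AbsRing) (V := R_NormedModule) (fun x => x) 0 1).
      apply (is_derive_id (K := R_AbsRing)).
    - destruct l as [l1 l2]. apply C_eq; simpl; unfold scal; simpl; unfold mult; simpl; ring. }
  apply quotient_lim in H'. rewrite Ropp_0 in H'. exact H'.
Qed.

Lemma is_derive_exp_lin (z : C) (t : R) : is_derive_RC (fun s : R => Cexp (s * z)) t (z * Cexp (t * z))%C.
Proof. apply (is_derive_RC_Cexp (fun s : R => s * z)%C), is_derive_lin. Qed.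

Lemma is_derive_exp_lin0 (z : C) : is_derive_RC (fun s : R => Cexp (s * z)) 0 z.
Proof.
  assert (E := is_derive_exp_lin z 0). replace (Cexp (0 * z)) with (RtoC 1) in E by (rewrite <- Cexp_0; f_equal; ring).
  now rewrite Cmult_1_r in E.
Qed.

Lemma slant_0 (a s : R) : slant a s 0 = (s * (a + Ci))%C.
Proof. unfold slant; ring. Qed.

Definition excised_double (a kappa r e : R) : C :=
  (RInt_C (fun s => double_kernel a kappa s 0) (- r) (- e) + RInt_C (fun s => double_kernel a kappa s 0) e r)%C.

Lemma excised_simple_kernel (a kappa r e : R) :
  (RInt_C (fun s => simple_kernel a kappa s 0) (- r) (- e) + RInt_C (fun s => simple_kernel a kappa s 0) e r)%C = excised a r (kernel_exponent a kappa) e.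
Proof.
  unfold excised. f_equal; apply (RInt_ext (V := C_R_CompleteNormedModule)); intros s _; rewrite simple_kernel_slant;
   (replace (Cexp (0 * angular_exponent a kappa)) with (RtoC 1) by (rewrite <- Cexp_0; f_equal; ring)); apply Cmult_1_l.
Qed.

(** Integration by parts on both sides of the pole leaves the values of the
    simple kernel at [e] and [- e], which diverge. For two exponents their
    difference [(e^{c s} - e^{c' s}) / (1 - e^{p s})] has a limit at [s = 0], hence
    takes nearly the same value at [e] and [- e]. *)
Lemma excised_double_lim (a kappa kap' r : R) : 0 < a -> 0 < r ->
  limC (at_right 0) (fun e => excised_double a kappa r e - excised_double a kap' r e)%C (double_integral a kappa r 0 - double_integral a kap' r 0)%C.
Proof.
  intros Ha Hr. assert (Hp := a_Ci_neq_0 a).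
  set (f := fun s : R => (Cexp (s * mode_exponent a kappa) + (- (1)) * Cexp (s * mode_exponent a kap'))%C).
  set (d := fun s : R => Cexp (s * (a + Ci))).
  assert (Hf : is_derive_RC f 0 (mode_exponent a kappa + (0 * Cexp (0 * mode_exponent a kap') + (- (1)) * mode_exponent a kap'))%C).
  { apply is_derive_RC_plus; [apply is_derive_exp_lin0|].
    apply (is_derive_RC_mult (fun _ => (- (1))%C) (fun s : R => Cexp (s * mode_exponent a kap'))).
    apply is_derive_RC_const. apply is_derive_exp_lin0. }
  set (f' := (_ + _)%C) in Hf.
  assert (Hd : is_derive_RC d 0 (a + Ci)%C) by apply is_derive_exp_lin0.
  assert (f0 : f 0 = 0).
  { unfold f. replace (Cexp (0 * mode_exponent a kappa)) with (RtoC 1) by (rewrite <- Cexp_0; f_equal; ring).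
    replace (Cexp (0 * mode_exponent a kap')) with (RtoC 1) by (rewrite <- Cexp_0; f_equal; ring). ring. }
  assert (d0 : d 0 = 1). { unfold d. rewrite <- Cexp_0; f_equal; ring. }
  assert (Q1 := quotient_lim f _ Hf). assert (Q2 := quotient_lim_neg f _ Hf).
  assert (Q3 := quotient_lim d _ Hd). assert (Q4 := quotient_lim_neg d _ Hd).
  rewrite f0 in Q1, Q2. rewrite d0 in Q3, Q4.
  assert (Hp2 : (- (a + Ci) <> 0)%C).
  { intros E; apply Hp; transitivity (- - (a + Ci))%C; [ring | rewrite E; ring]. }
  assert (Q3' := limC_inv _ _ _ Q3 Hp). assert (Q4' := limC_inv _ _ _ Q4 Hp2).
  assert (Q5 := limC_mult _ _ _ _ _ Q1 Q3'). assert (Q6 := limC_mult _ _ _ _ _ Q2 Q4').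
  assert (Q7 := limC_minus _ _ _ _ _ Q5 Q6).
  assert (C1 := excised_principal_value a r (kernel_exponent a kappa) Ha Hr). assert (C2 := excised_principal_value a r (kernel_exponent a kap') Ha Hr).
  apply (limC_scal _ (mode_exponent a kappa)) in C1. apply (limC_scal _ (mode_exponent a kap')) in C2.
  assert (C3 := limC_minus _ _ _ _ _ (limC_minus _ _ _ _ _ Q7 C1) (limC_opp _ _ _ C2)).
  assert (C4 := limC_plus _ _ _ _ _ (limC_const _ (simple_kernel a kappa r 0 - simple_kernel a kappa (- r) 0 - (simple_kernel a kap' r 0 - simple_kernel a kap' (- r) 0))%C) C3).
  apply (limC_scal _ (/ (a + Ci))) in C4.
  match type of C4 with limC _ _ ?x => match goal with |- limC _ _ ?y => replace y with x end end.
  - refine (limC_ext _ _ _ _ _ C4).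
    generalize (filter_at_right_lt r Hr); apply filter_imp; intros e He.
    unfold excised_double. rewrite !RInt_double_kernel by (auto; try lra; intros; left; lra).
    rewrite <- !excised_simple_kernel.
    assert (Hreg : forall s, s <> 0 -> (1 - d s <> 0)%C).
    { intros s Hs. unfold d. rewrite <- slant_0. apply slant_regular; auto. }
    assert (HK : forall s, s <> 0 -> (simple_kernel a kappa s 0 - simple_kernel a kap' s 0 = f s / (1 - d s))%C).
    { intros s Hs. unfold simple_kernel. rewrite slant_0. fold (d s). unfold f. field. apply Hreg; auto. }
    assert (R1 := HK e ltac:(lra)). assert (R2 := HK (- e) ltac:(lra)).
    assert (HeC : RtoC e <> 0) by (intros E; apply RtoC_inj in E; lra).
    assert (N1 := Hreg e ltac:(lra)). assert (N2 := Hreg (- e) ltac:(lra)).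
    assert (N1' : (d e - 1 <> 0)%C) by (intros E; apply N1; transitivity (- (d e - 1))%C; [ring | rewrite E; ring]).
    assert (N2' : (d (- e)%R - 1 <> 0)%C) by (intros E; apply N2; transitivity (- (d (- e)%R - 1))%C; [ring | rewrite E; ring]).
    set (k1 := simple_kernel a kappa e 0) in *. set (k2 := simple_kernel a kap' e 0) in *.
    set (k3 := simple_kernel a kappa (- e) 0) in *. set (k4 := simple_kernel a kap' (- e) 0) in *.
    replace ((f e - 0) / e * / ((d e - 1) / e))%C with (- (k1 - k2))%C by (rewrite R1; field; auto).
    replace ((f (- e)%R - 0) / e * / ((d (- e)%R - 1) / e))%C with (- (k3 - k4))%C by (rewrite R2; field; auto).
    field. auto.
  - unfold double_integral, simple_integral. destruct (Req_EM_T 0 0); [|lra]. field. auto.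
Qed.

Lemma RInt_double_kernel3 (a k1 k2 k3 u v D : R) (z1 z2 z3 : C) (F : R -> C) : 0 < a -> u <= v ->
  (forall s, u <= s <= v -> s <> 0 \/ cos D <> 1) ->
  (forall s, u < s < v -> F s = (z1 * double_kernel a k1 s D + z2 * double_kernel a k2 s D + z3 * double_kernel a k3 s D)%C) ->
  RInt_C F u v = (z1 * RInt_C (fun s => double_kernel a k1 s D) u v + z2 * RInt_C (fun s => double_kernel a k2 s D) u v
    + z3 * RInt_C (fun s => double_kernel a k3 s D) u v)%C.
Proof.
  intros Ha Huv Hr HF. apply is_RInt_RC_unique.
  apply (is_RInt_RC_ext (fun s => z1 * double_kernel a k1 s D + z2 * double_kernel a k2 s D + z3 * double_kernel a k3 s D)%C).
  { rewrite Rmin_left, Rmax_right by lra. intros; symmetry; auto. }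
  apply is_RInt_RC_plus; [apply is_RInt_RC_plus|]; apply is_RInt_RC_scal, RInt_RC_correct;
    rewrite Rmin_left, Rmax_right by lra; intros; apply continuous_double_kernel; auto.
Qed.

(** * The operator on sums of exponentials *)

(** The numerator vanishes at the singular point as [z1 + z2 + z3 = 0], so that
    the finite part is a principal value: the correction of Hadamard is a sum of
    two difference quotients whose limits are opposite. For the same reason the
    three excised integrals enter only through their differences. *)
Lemma fp_diag (a k1 k2 k3 r : R) (z1 z2 z3 : C) (num : R -> C) : 0 < a -> 0 < r ->
  (forall s, num s = (z1 * Cexp (s * mode_exponent a k1) + z2 * Cexp (s * mode_exponent a k2) + z3 * Cexp (s * mode_exponent a k3))
     * Cexp (slant a s 0))%C ->
  (z1 + z2 + z3 = 0)%C ->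
  is_fp_curve num (fun sg => Cexp ((a + Ci) * sg)) (- r) r 0
    (z1 * double_integral a k1 r 0 + z2 * double_integral a k2 r 0 + z3 * double_integral a k3 r 0)%C.
Proof.
  intros Ha Hr Hnum Hz. assert (Hp := a_Ci_neq_0 a).
  set (gam := fun sg : R => Cexp ((a + Ci) * sg)).
  assert (Hgam : forall s, gam s = Cexp (slant a s 0)).
  { intros s; unfold gam; f_equal; unfold slant; ring. }
  assert (g0 : gam 0 = 1). { unfold gam; rewrite <- Cexp_0; f_equal; ring. }
  assert (Hdg : is_derive_RC gam 0 (a + Ci)%C).
  { apply (is_derive_ext (V := C_R_NormedModule) (fun s : R => Cexp (s * (a + Ci)))).
    - intros s; unfold gam; f_equal; ring.
    - apply is_derive_exp_lin0. }
  exists (a + Ci)%C; split; [exact Hdg|].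
  set (f := fun t : R => if Req_EM_T t 0 then _ else _).
  assert (Hreg : forall s, s <> 0 -> (gam s - 1 <> 0)%C).
  { intros s Hs E. apply (slant_regular a s 0 Ha (or_introl Hs)). rewrite <- Hgam.
    transitivity (- (gam s - 1))%C; [ring | rewrite E; ring]. }
  assert (Hf : forall s, s <> 0 -> f s = (num s / ((gam s - 1) / s) ^ 2)%C).
  { intros s Hs. unfold f. destruct (Req_EM_T s 0); [lra|]. rewrite g0, Rminus_0_r. reflexivity. }
  assert (HfN : forall s, s <> 0 -> (f s / RtoC ((s - 0) ^ 2) = z1 * double_kernel a k1 s 0 + z2 * double_kernel a k2 s 0 + z3 * double_kernel a k3 s 0)%C).
  { intros s Hs. rewrite Hf, Hnum by auto. unfold double_kernel. rewrite <- Hgam. rewrite Rminus_0_r.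
    replace (RtoC (s ^ 2)) with (s * s)%C by (simpl; rewrite Rmult_1_r, RtoC_mult; ring).
    assert (RtoC s <> 0) by (intros E; apply RtoC_inj in E; auto).
    assert (N := Hreg s Hs).
    assert (N' : (1 - gam s <> 0)%C) by (intros E; apply N; transitivity (- (1 - gam s))%C; [ring | rewrite E; ring]).
    simpl. field. auto. }
  assert (n0 : num 0 = 0).
  { rewrite Hnum. assert (E : forall z, Cexp (0 * z) = 1) by (intros z; rewrite <- Cexp_0; f_equal; ring).
    rewrite !E, !Cmult_1_r, Hz. ring. }
  assert (Hterm : forall z w, is_derive_RC (fun s : R => z * Cexp (s * w))%C 0 (0 * Cexp (0 * w) + z * w)%C).
  { intros z w. apply (is_derive_RC_mult (fun _ => z) (fun s : R => Cexp (s * w))).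
    - apply is_derive_RC_const.
    - apply is_derive_exp_lin0. }
  assert (Hdn : exists l, is_derive_RC num 0 l).
  { eexists. apply (is_derive_ext (V := C_R_NormedModule)
     (fun s : R => (z1 * Cexp (s * mode_exponent a k1) + z2 * Cexp (s * mode_exponent a k2) + z3 * Cexp (s * mode_exponent a k3)) * Cexp (s * (a + Ci)))%C).
    { intros s; rewrite Hnum, slant_0; reflexivity. }
    exact (is_derive_RC_mult _ _ _ _ _
      (is_derive_RC_plus _ _ _ _ _ (is_derive_RC_plus _ _ _ _ _ (Hterm z1 (mode_exponent a k1)) (Hterm z2 (mode_exponent a k2)))
        (Hterm z3 (mode_exponent a k3))) (is_derive_exp_lin0 (a + Ci))). }
  destruct Hdn as [dn Hdn].
  assert (Hp2 : (- (a + Ci) <> 0)%C).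
  { intros E; apply Hp; transitivity (- - (a + Ci))%C; [ring | rewrite E; ring]. }
  assert (Q1 := quotient_lim _ _ Hdn). assert (Q2 := quotient_lim_neg _ _ Hdn).
  assert (Q3 := limC_inv _ _ _ (quotient_lim _ _ Hdg) Hp).
  assert (Q4 := limC_inv _ _ _ (quotient_lim_neg _ _ Hdg) Hp2).
  rewrite n0 in Q1, Q2. rewrite g0 in Q3, Q4.
  assert (Q5 := limC_mult _ _ _ _ _ Q1 (limC_mult _ _ _ _ _ Q3 Q3)).
  assert (Q6 := limC_mult _ _ _ _ _ Q2 (limC_mult _ _ _ _ _ Q4 Q4)).
  assert (Q7 := limC_plus _ _ _ _ _ Q5 Q6).
  assert (C1 := limC_scal _ z2 _ _ (excised_double_lim a k2 k1 r Ha Hr)).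
  assert (C2 := limC_scal _ z3 _ _ (excised_double_lim a k3 k1 r Ha Hr)).
  assert (C3 := limC_minus _ _ _ _ _ (limC_plus _ _ _ _ _ C1 C2) Q7).
  assert (Ez : z1 = (- (z2 + z3))%C).
  { transitivity ((z1 + z2 + z3) - (z2 + z3))%C; [ring | rewrite Hz; ring]. }
  unfold is_fp.
  match type of C3 with limC _ _ ?x => match goal with |- filterlim _ _ (locally ?y) => replace y with x end end.
  - refine (limC_ext _ _ _ _ _ C3).
    generalize (filter_at_right_lt r Hr); apply filter_imp; intros e He.
    rewrite (RInt_double_kernel3 a k1 k2 k3 (- r) (0 - e) 0 z1 z2 z3); auto; try lra.
    2:{ intros; left; lra. } 2:{ intros; apply HfN; lra. }
    rewrite (RInt_double_kernel3 a k1 k2 k3 (0 + e) r 0 z1 z2 z3); auto; try lra.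
    2:{ intros; left; lra. } 2:{ intros; apply HfN; lra. }
    rewrite Rplus_0_l. replace (0 - e) with (- e) by ring.
    rewrite !Hf by lra. unfold excised_double. rewrite Ez.
    assert (HeC : RtoC e <> 0) by (intros E; apply RtoC_inj in E; lra).
    assert (N1 := Hreg e ltac:(lra)). assert (N2 := Hreg (- e) ltac:(lra)).
    rewrite (RtoC_opp e). simpl. field. repeat split; auto.
  - rewrite Ez. field. repeat split; auto.
Qed.

(** The limit of [double_integral] once the oscillating term is removed. *)
Definition double_limit (a kappa D : R) : C := (half_res a * kernel_exponent a kappa * mode_coef (angular_exponent a kappa) D)%C.

(** The oscillating terms carry the weights [x k e^{- i D k}], of zero sum. *)
Lemma double_integral_sum_lim (M : nat) (a kappa : R) (x : nat -> C) (D : nat -> R) : (0 < M)%nat -> 0 < a -> kappa <> 1 ->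
  (forall k, (k < M)%nat -> Rabs (D k) < 2 * PI) ->
  Csum M (fun k => x k * Cexp (- (Ci * D k)))%C = 0 ->
  limC (Rbar_locally p_infty) (fun r => Csum M (fun k => x k * double_integral a kappa r (D k))%C)
    (Csum M (fun k => x k * double_limit a kappa (D k))%C).
Proof.
  intros HM Ha Hk HD Hx.
  apply (limC_ext _ (fun r => Csum M (fun k => x k * (double_integral a kappa r (D k) - oscillation a kappa r * Cexp (- (Ci * D k))))%C)).
  - apply filter_forall; intros r.
    rewrite (Csum_ext M _ (fun k => x k * double_integral a kappa r (D k) + (- oscillation a kappa r) * (x k * Cexp (- (Ci * D k))))%C);
      [|auto|intros; ring].
    rewrite Csum_plus, Csum_scal, Hx by auto. ring.
  - apply (Csum_lim _ M (fun r k => x k * (double_integral a kappa r (D k) - oscillation a kappa r * Cexp (- (Ci * D k))))%C); auto.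
    intros k Hk'. apply limC_scal; [typeclasses eauto|]. apply double_integral_lim; auto.
Qed.

Lemma is_H_modes (M : nat) (a g th k2 k3 : R) (zeta : nat -> R -> C) (m : nat) (z1 z2 z3 : nat -> C) :
  (3 <= M)%nat -> (m < M)%nat -> 0 < a -> k2 <> 1 -> k3 <> 1 ->
  (forall k s, (k < M)%nat -> H_num M a zeta m k th s =
     ((z1 k * Cexp (s * mode_exponent a (-1)) + z2 k * Cexp (s * mode_exponent a k2) + z3 k * Cexp (s * mode_exponent a k3))
      * Cexp (slant a s (Delta M k m)))%C) ->
  (z1 m + z2 m + z3 m = 0)%C ->
  Csum M (fun k => z1 k * Cexp (- (Ci * Delta M k m)))%C = 0 ->
  Csum M (fun k => z2 k * Cexp (- (Ci * Delta M k m)))%C = 0 ->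
  Csum M (fun k => z3 k * Cexp (- (Ci * Delta M k m)))%C = 0 ->
  is_H M a g zeta m th
   (a * g / (PI * Ci) * Csum M (fun k => z1 k * double_limit a (-1) (Delta M k m) + z2 k * double_limit a k2 (Delta M k m)
      + z3 k * double_limit a k3 (Delta M k m)))%C.
Proof.
  intros HM Hm Ha Hk2 Hk3 Hnum Hz S1 S2 S3. assert (HM' : (0 < M)%nat) by lia.
  set (term := fun r k => (z1 k * double_integral a (-1) r (Delta M k m) + z2 k * double_integral a k2 r (Delta M k m)
      + z3 k * double_integral a k3 r (Delta M k m))%C).
  exists (fun r => Csum M (term r)). eexists; split; [|split; [|reflexivity]].
  - intros r Hr. exists (term r m). split.
    + unfold term. rewrite Delta_diag. apply fp_diag; auto.
      intros s; rewrite Hnum, Delta_diag by auto. reflexivity.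
    + symmetry. apply (Csum_split M m); auto.
      2:{ now rewrite Nat.eqb_refl. }
      intros k Hk Hne. assert (Hb := proj2 (Nat.eqb_neq _ _) Hne). rewrite Hb.
      assert (HD := Delta_neq_0 M k m HM' Hne).
      assert (Hc : cos (Delta M k m) <> 1).
      { apply cos_neq_1; split; [now apply Rabs_pos_lt | apply Delta_bound; auto]. }
      rewrite (RInt_double_kernel3 a (-1) k2 k3 (- r) r (Delta M k m) (z1 k) (z2 k) (z3 k)); auto; try lra.
      * rewrite !RInt_double_kernel; auto; try lra. unfold term, double_integral, simple_integral.
        destruct (Req_EM_T (Delta M k m) 0); [contradiction|]. reflexivity.
      * intros s _. rewrite Hnum by auto. unfold H_den, double_kernel.
        replace (Cexp ((a + Ci) * s) * Cexp (Ci * Delta M k m))%C with (Cexp (slant a s (Delta M k m)))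
          by (unfold slant; apply Cexp_plus).
        field. apply slant_regular; auto.
  - assert (L1 := double_integral_sum_lim M a (-1) z1 (fun k => Delta M k m) HM' Ha ltac:(lra) (fun k Hk => Delta_bound M k m Hk Hm) S1).
    assert (L2 := double_integral_sum_lim M a k2 z2 (fun k => Delta M k m) HM' Ha Hk2 (fun k Hk => Delta_bound M k m Hk Hm) S2).
    assert (L3 := double_integral_sum_lim M a k3 z3 (fun k => Delta M k m) HM' Ha Hk3 (fun k Hk => Delta_bound M k m Hk Hm) S3).
    assert (L := limC_plus _ _ _ _ _ (limC_plus _ _ _ _ _ L1 L2) L3).
    rewrite <- !Csum_plus in L by auto.
    refine (limC_ext _ _ _ _ _ L). apply filter_forall; intros r.
    unfold term. rewrite !Csum_plus by auto. reflexivity.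
Qed.

Lemma is_H_unique (M : nat) (a g : R) (zeta : nat -> R -> C) (m : nat) (th : R) (h h' : C) :
  is_H M a g zeta m th h -> is_H M a g zeta m th h' -> h = h'.
Proof.
  intros (J & l & HJ & Hl & ->) (J' & l' & HJ' & Hl' & ->). f_equal.
  apply (limC_unique (Rbar_locally p_infty) J); [exact Hl|].
  refine (limC_ext _ _ _ _ _ Hl').
  generalize (p_infty_gt 0); apply filter_imp; intros r Hr.
  destruct (HJ r Hr) as (x & (d & Hd & Hx) & ->). destruct (HJ' r Hr) as (x' & (d' & Hd' & Hx') & ->).
  f_equal. rewrite (is_derive_RC_unique _ _ _ _ Hd' Hd) in Hx'.
  symmetry; apply (limC_unique (at_right 0) _ _ _ Hx Hx').
Qed.

(** * The operator on the perturbation *)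

Lemma angular_exponent_B_coef (s a alpha : R) : angular_exponent a (s * (2 * a * alpha)) = B_coef s a alpha.
Proof.
  unfold angular_exponent, kernel_exponent, mode_exponent, B_coef. assert (H : 1 + a ^ 2 <> 0) by nra.
  apply C_eq; unfold Ci, RtoC, Re, Im; simpl; field; nra.
Qed.

Lemma mode_coef_calB (s a alpha : R) (M m k : nat) :
  mode_coef (angular_exponent a (s * (2 * a * alpha))) (Delta M k m)
   = (calB s M a alpha m k / Csinh (PI * B_coef s a alpha))%C.
Proof. rewrite angular_exponent_B_coef. reflexivity. Qed.

Lemma PI_C_neq_0 : RtoC PI <> 0.
Proof. intros E; apply RtoC_inj in E; generalize PI_RGT_0; lra. Qed.

Lemma double_limit_c_coef (s a g alpha : R) (M m k : nat) :
  (a * g / (PI * Ci) * double_limit a (s * (2 * a * alpha)) (Delta M k m) = g * c_coef s M a alpha m k)%C.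
Proof.
  unfold double_limit, c_coef. rewrite mode_coef_calB. set (S := (calB _ _ _ _ _ _ / _)%C).
  unfold half_res, kernel_exponent, mode_exponent. rewrite !RtoC_mult.
  assert (Hp := a_Ci_neq_0 a). assert (HC := Ci_neq_0). assert (HP := PI_C_neq_0).
  replace (RtoC (a ^ 2)) with (a * a)%C by (simpl; rewrite Rmult_1_r, RtoC_mult; ring).
  simpl. field. auto.
Qed.

Lemma double_limit_c0_coef (M m : nat) (a g : R) : (3 <= M)%nat -> (m < M)%nat -> 0 < a ->
  (a * g / (PI * Ci) * Csum M (fun k => Cexp (- (Ci * Delta M k m)) * double_limit a (-1) (Delta M k m)) = c0_coef M a g)%C.
Proof.
  intros HM Hm Ha.
  rewrite (Csum_ext M _ (fun k => (half_res a * kernel_exponent a (-1)) *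
     (Cexp (- (Ci * Delta M k m)) * mode_coef (angular_exponent a (-1)) (Delta M k m)))%C);
    [|lia|intros; unfold double_limit; ring].
  rewrite Csum_scal, coth_sum by (auto; lia).
  unfold c0_coef, half_res, kernel_exponent, mode_exponent.
  assert (Hp := a_Ci_neq_0 a). assert (HC := Ci_neq_0). assert (HP := PI_C_neq_0).
  replace (RtoC (-1)) with (- (1))%C by (apply C_eq; simpl; ring). simpl. field. auto.
Qed.

Lemma zeta_mode_shift (s : R) (M : nat) (a mu alpha : R) (m k : nat) (t th sg : R) :
  zeta_mode s M a mu alpha k t (sg + th + Delta M k m)
  = (zeta_mode s M a mu alpha m t th * Cexp (sg * (Ci * RtoC (s * (2 * a * alpha)))))%C.
Proof.
  unfold zeta_mode. rewrite <- Cexp_plus. f_equal. unfold Delta.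
  rewrite !RtoC_plus, !RtoC_mult, !RtoC_minus, !RtoC_plus, !RtoC_minus. ring.
Qed.

Lemma zeta_mode_conj (s : R) (M : nat) (a mu alpha : R) (m : nat) (t th : R) :
  Cconj (zeta_mode s M a mu alpha m t th) = zeta_mode (- s) M a mu alpha m t th.
Proof.
  unfold zeta_mode. rewrite Cconj_Cexp. f_equal.
  apply C_eq; unfold Cconj, Ci, RtoC, Re, Im; simpl; ring.
Qed.

Lemma branch_moment (M m : nat) (x : nat -> C) : (0 < M)%nat ->
  Csum M (fun k => x k * Cexp (- (Ci * theta M k)))%C = 0 ->
  Csum M (fun k => x k * Cexp (- (Ci * Delta M k m)))%C = 0.
Proof.
  intros HM H.
  rewrite (Csum_ext M _ (fun k => Cexp (Ci * theta M m) * (x k * Cexp (- (Ci * theta M k))))%C); auto.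
  - rewrite Csum_scal, H by auto. ring.
  - intros k _. unfold Delta. rewrite RtoC_minus.
    replace (- (Ci * (theta M k - theta M m)))%C with (Ci * theta M m + - (Ci * theta M k))%C by ring.
    rewrite Cexp_plus. ring.
Qed.

(** The weights [z1], [z2], [z3] below belong to the exponents [-1],
    [2 a alpha], [- 2 a alpha]. The first comes from the factor
    [e^{2 a s} = e^{- i D} e^{(a - i) s} w]; in the other two the phase
    [e^{i (s + theta + D)}] of the perturbation supplies [w]. *)
Lemma perturbation_H (M : nat) (a mu g alpha : R) (X Y : nat -> R -> C) (m : nat) (t th : R) :
  (3 <= M)%nat -> 0 < a -> 0 < alpha -> alpha <> 1 / (2 * a) -> (m < M)%nat ->
  Csum M (fun k => X k t * Cexp (- (Ci * theta M k)))%C = 0 ->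
  Csum M (fun k => Y k t * Cexp (- (Ci * theta M k)))%C = 0 ->
  is_H M a g (fun k => perturbation M a mu alpha X Y k t) m th
   (Cexp (- (Ci * th)) *
     (zeta_mode 1 M a mu alpha m t th *
       (c0_coef M a g * X m t - g * Csum M (fun k => c_coef 1 M a alpha m k * X k t))
      + zeta_mode (-1) M a mu alpha m t th *
       (c0_coef M a g * Y m t - g * Csum M (fun k => c_coef (-1) M a alpha m k * Y k t))))%C.
Proof.
  intros HM Ha Hal Hal2 Hm HX HY. assert (HM' : (0 < M)%nat) by lia.
  assert (Hk2 : 1 * (2 * a * alpha) <> 1).
  { intros E; apply Hal2. field_simplify_eq; lra. }
  assert (Hk3 : -1 * (2 * a * alpha) <> 1) by nra.
  set (Zp := zeta_mode 1 M a mu alpha m t th). set (Zm := zeta_mode (-1) M a mu alpha m t th).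
  set (e := Cexp (- (Ci * th))).
  set (z1 := fun k => (e * (Zp * X m t + Zm * Y m t) * Cexp (- (Ci * Delta M k m)))%C).
  set (z2 := fun k => (- e * Zp * X k t)%C). set (z3 := fun k => (- e * Zm * Y k t)%C).
  assert (K := is_H_modes M a g th (1 * (2 * a * alpha)) (-1 * (2 * a * alpha))
    (fun k => perturbation M a mu alpha X Y k t) m z1 z2 z3 HM Hm Ha Hk2 Hk3).
  match type of K with _ -> _ -> _ -> _ -> _ -> is_H _ _ _ _ _ _ ?x => match goal with |- is_H _ _ _ _ _ _ ?y =>
    replace y with x; [apply K|] end end.
  - intros k s Hk. unfold H_num, perturbation. rewrite !zeta_mode_shift. fold Zp Zm.
    unfold z1, z2, z3, e. set (u2 := RtoC (1 * _)). set (u3 := RtoC (-1 * _)).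
    unfold mode_exponent, slant. fold u2 u3.
    replace (Ci * RtoC (s + th + Delta M k m))%C with (Ci * s + Ci * th + Ci * Delta M k m)%C
      by (rewrite !RtoC_plus; ring).
    replace (s * (a + Ci * (-1)))%C with (s * a + - (Ci * s))%C by (replace (RtoC (-1)) with (- (1))%C by (apply C_eq; simpl; ring); ring).
    replace (s * (a + Ci * u2))%C with (s * a + s * (Ci * u2))%C by ring.
    replace (s * (a + Ci * u3))%C with (s * a + s * (Ci * u3))%C by ring.
    replace ((a + Ci) * s + Ci * Delta M k m)%C with (s * a + Ci * s + Ci * Delta M k m)%C by ring.
    replace (2 * a * s)%C with (s * a + s * a)%C by ring.
    replace (2 * Ci * th)%C with (Ci * th + Ci * th)%C by ring.
    rewrite (Cexp_opp (Ci * th + Ci * th)), !Cexp_plus, !Cexp_opp.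
    assert (N1 := Cexp_neq_0 (Ci * th)). assert (N2 := Cexp_neq_0 (Ci * s)).
    assert (N3 := Cexp_neq_0 (Ci * Delta M k m)).
    field. auto.
  - unfold z1, z2, z3. rewrite Delta_diag.
    replace (Cexp (- (Ci * 0))) with (RtoC 1) by (rewrite <- Cexp_0; f_equal; ring). ring.
  - rewrite (Csum_ext M _ (fun k => (e * (Zp * X m t + Zm * Y m t)) *
      (Cexp (- (Ci * Delta M k m)) * Cexp (- (Ci * Delta M k m))))%C); auto.
    + rewrite Csum_scal, sum_squared_roots by auto. ring.
    + intros; unfold z1; ring.
  - rewrite (Csum_ext M _ (fun k => (- e * Zp) * (X k t * Cexp (- (Ci * Delta M k m))))%C); auto.
    + rewrite Csum_scal, (branch_moment M m (fun k => X k t)) by auto. ring.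
    + intros; unfold z2; ring.
  - rewrite (Csum_ext M _ (fun k => (- e * Zm) * (Y k t * Cexp (- (Ci * Delta M k m))))%C); auto.
    + rewrite Csum_scal, (branch_moment M m (fun k => Y k t)) by auto. ring.
    + intros; unfold z3; ring.
  - rewrite !Csum_plus by auto.
    rewrite (Csum_ext M (fun k => z1 k * _)%C (fun k => (e * (Zp * X m t + Zm * Y m t)) *
      (Cexp (- (Ci * Delta M k m)) * double_limit a (-1) (Delta M k m)))%C); [|auto|intros; unfold z1; ring].
    rewrite (Csum_scal M (e * _)%C) by auto.
    rewrite <- (double_limit_c0_coef M m a g) by auto.
    assert (HC := Ci_neq_0). assert (HP := PI_C_neq_0).
    assert (G : forall s Z x, (a * g / (PI * Ci) * Csum M (fun k => - e * Z * x k * double_limit a (s * (2 * a * alpha)) (Delta M k m))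
      = - (e * Z * (g * Csum M (fun k => c_coef s M a alpha m k * x k))))%C).
    { intros s Z x. rewrite <- !Csum_scal by auto.
      transitivity (Csum M (fun k => (- (e * Z)) * (g * (c_coef s M a alpha m k * x k)))%C).
      - apply Csum_ext; auto. intros k _.
        transitivity (- (e * Z) * x k * (g * c_coef s M a alpha m k))%C; [|ring].
        rewrite <- (double_limit_c_coef s a g). field; auto.
      - rewrite !Csum_scal by auto. ring. }
    assert (G2 := G 1 Zp (fun k => X k t)). assert (G3 := G (-1) Zm (fun k => Y k t)).
    unfold z2, z3. rewrite !Cmult_plus_distr_l, G2, G3. ring.
Qed.

(** * Comparison of the two systems *)

Lemma is_derive_zeta_mode_t (s : R) (M : nat) (a mu alpha : R) (m : nat) (t th : R) : 0 < t ->
  is_derive_RC (fun t => zeta_mode s M a mu alpha m t th) t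
    (s * Ci * alpha * RtoC ((2 * mu - 1) / t) * zeta_mode s M a mu alpha m t th)%C.
Proof.
  intros Ht. unfold zeta_mode.
  apply (is_derive_RC_Cexp (fun t => s * Ci * alpha * RtoC (2 * a * (th - theta M m) + (2 * mu - 1) * ln t))%C).
  replace (s * Ci * alpha * RtoC ((2 * mu - 1) / t))%C with
   (0 * RtoC (2 * a * (th - theta M m) + (2 * mu - 1) * ln t) + s * Ci * alpha * RtoC ((2 * mu - 1) / t))%C by ring.
  apply (is_derive_RC_mult (fun _ => s * Ci * alpha)%C
    (fun t => RtoC (2 * a * (th - theta M m) + (2 * mu - 1) * ln t))).
  - apply is_derive_RC_const.
  - apply is_derive_RC_RtoC. auto_derive; [auto | field; lra].
Qed.

Lemma is_derive_zeta_mode_th (s : R) (M : nat) (a mu alpha : R) (m : nat) (t th : R) :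
  is_derive_RC (fun th => zeta_mode s M a mu alpha m t th) th
    (s * Ci * alpha * RtoC (2 * a) * zeta_mode s M a mu alpha m t th)%C.
Proof.
  unfold zeta_mode.
  apply (is_derive_RC_Cexp (fun th => s * Ci * alpha * RtoC (2 * a * (th - theta M m) + (2 * mu - 1) * ln t))%C).
  replace (s * Ci * alpha * RtoC (2 * a))%C with
   (0 * RtoC (2 * a * (th - theta M m) + (2 * mu - 1) * ln t) + s * Ci * alpha * RtoC (2 * a))%C by ring.
  apply (is_derive_RC_mult (fun _ => s * Ci * alpha)%C
    (fun th => RtoC (2 * a * (th - theta M m) + (2 * mu - 1) * ln t))).
  - apply is_derive_RC_const.
  - apply is_derive_RC_RtoC. auto_derive; [auto | ring].
Qed.

Lemma smooth_pos_derive (f : R -> C) (t : R) : smooth_pos f -> 0 < t -> exists l, is_derive_RC f t l.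
Proof.
  intros H Ht. destruct (H 1%nat t Ht) as [H1 H2]. simpl in H1, H2.
  exists (Derive (fun s => Re (f s)) t, Derive (fun s => Im (f s)) t).
  apply is_derive_RC_pair; apply Derive_correct; assumption.
Qed.

(** Left minus right side of a reduced equation: [u] and [du] are the amplitude
    it governs and its derivative, [V] the amplitudes to which it is coupled. *)
Definition residual (s : R) (M : nat) (a mu g alpha : R) (V : nat -> R -> C) (m : nat) (t : R) (u du : C) : C :=
  (t * du + Ci * RtoC ((1 - 2 * mu) / (2 * a)) * u
   - (- (Cconj (c0_coef M a g) * Cconj (V m t))
      + g * Csum M (fun k => Cconj (c_coef s M a alpha m k) * Cconj (V k t))))%C.

(** The derivatives of the two modes cancel in the transport operator, as their
    phase depends only on [2 a theta + (2 mu - 1) ln t], and the factor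
    [e^{i theta}] leaves the term [i (1 - 2 mu) / (2 a)]. Conjugation exchanges
    the modes, so that the coefficient of each is the residual coupled to the
    other amplitude. *)
Lemma perturbation_BR (M : nat) (a mu g alpha : R) (X Y : nat -> R -> C) (m : nat) (t th : R) (dX dY : C) :
  (3 <= M)%nat -> 0 < a -> 0 < alpha -> alpha <> 1 / (2 * a) -> (m < M)%nat -> 0 < t ->
  Csum M (fun k => X k t * Cexp (- (Ci * theta M k)))%C = 0 ->
  Csum M (fun k => Y k t * Cexp (- (Ci * theta M k)))%C = 0 ->
  is_derive_RC (X m) t dX -> is_derive_RC (Y m) t dY ->
  exists dt dth h : C,
      is_derive_RC (fun s => Cconj (perturbation M a mu alpha X Y m s th)) t dt /\
      is_derive_RC (fun x => Cconj (perturbation M a mu alpha X Y m t x)) th dth /\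
      is_H M a g (fun k => perturbation M a mu alpha X Y k t) m th h /\
      (t * dt - RtoC ((2 * mu - 1) / (2 * a)) * dth + h =
        Cconj (Cexp (Ci * th) * (zeta_mode 1 M a mu alpha m t th * residual (-1) M a mu g alpha Y m t (X m t) dX
          + zeta_mode (-1) M a mu alpha m t th * residual 1 M a mu g alpha X m t (Y m t) dY)))%C.
Proof.
  intros HM Ha Hal Hal2 Hm Ht HX HY HdX HdY. assert (HM' : (0 < M)%nat) by lia.
  do 3 eexists. split; [|split; [|split]].
  - apply (is_derive_RC_conj (fun s => perturbation M a mu alpha X Y m s th)).
    apply (is_derive_RC_plus (fun s => X m s * zeta_mode 1 M a mu alpha m s th * Cexp (Ci * th))%C
      (fun s => Y m s * zeta_mode (-1) M a mu alpha m s th * Cexp (Ci * th))%C).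
    + apply (is_derive_RC_mult (fun s => X m s * zeta_mode 1 M a mu alpha m s th)%C (fun _ => Cexp (Ci * th))).
      * apply (is_derive_RC_mult (X m) (fun s => zeta_mode 1 M a mu alpha m s th)); [exact HdX | now apply is_derive_zeta_mode_t].
      * apply is_derive_RC_const.
    + apply (is_derive_RC_mult (fun s => Y m s * zeta_mode (-1) M a mu alpha m s th)%C (fun _ => Cexp (Ci * th))).
      * apply (is_derive_RC_mult (Y m) (fun s => zeta_mode (-1) M a mu alpha m s th)); [exact HdY | now apply is_derive_zeta_mode_t].
      * apply is_derive_RC_const.
  - assert (He : is_derive_RC (fun x : R => Cexp (Ci * x)) th (Ci * Cexp (th * Ci))%C).
    { apply (is_derive_ext (V := C_R_NormedModule) (fun x : R => Cexp (x * Ci))).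
      - intros; f_equal; ring.
      - apply is_derive_exp_lin. }
    apply (is_derive_RC_conj (fun x => perturbation M a mu alpha X Y m t x)).
    apply (is_derive_RC_plus (fun x => X m t * zeta_mode 1 M a mu alpha m t x * Cexp (Ci * x))%C
      (fun x => Y m t * zeta_mode (-1) M a mu alpha m t x * Cexp (Ci * x))%C).
    + apply (is_derive_RC_mult (fun x => X m t * zeta_mode 1 M a mu alpha m t x)%C (fun x : R => Cexp (Ci * x))); [|exact He].
      apply (is_derive_RC_mult (fun _ => X m t) (fun x => zeta_mode 1 M a mu alpha m t x)); [apply is_derive_RC_const | apply is_derive_zeta_mode_th].
    + apply (is_derive_RC_mult (fun x => Y m t * zeta_mode (-1) M a mu alpha m t x)%C (fun x : R => Cexp (Ci * x))); [|exact He].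
      apply (is_derive_RC_mult (fun _ => Y m t) (fun x => zeta_mode (-1) M a mu alpha m t x)); [apply is_derive_RC_const | apply is_derive_zeta_mode_th].
  - apply perturbation_H; auto.
  - set (Zp := zeta_mode 1 M a mu alpha m t th). set (Zm := zeta_mode (-1) M a mu alpha m t th).
    assert (CZp : Cconj Zp = Zm) by apply zeta_mode_conj.
    assert (CZm : Cconj Zm = Zp).
    { unfold Zm, Zp. rewrite zeta_mode_conj. f_equal. ring. }
    set (c0 := c0_coef M a g).
    set (SX := Csum M (fun k => c_coef 1 M a alpha m k * X k t)%C).
    set (SY := Csum M (fun k => c_coef (-1) M a alpha m k * Y k t)%C).
    assert (CSX : Csum M (fun k => Cconj (c_coef 1 M a alpha m k) * Cconj (X k t))%C = Cconj SX).
    { unfold SX; rewrite Csum_conj by auto. apply Csum_ext; auto. intros; now rewrite Cmult_conj. }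
    assert (CSY : Csum M (fun k => Cconj (c_coef (-1) M a alpha m k) * Cconj (Y k t))%C = Cconj SY).
    { unfold SY; rewrite Csum_conj by auto. apply Csum_ext; auto. intros; now rewrite Cmult_conj. }
    unfold residual. fold c0. rewrite CSX, CSY.
    set (e := Cexp (Ci * th)).
    replace (Cexp (th * Ci)) with e by (unfold e; f_equal; ring).
    replace (Cexp (- (Ci * th))) with (Cconj e).
    2:{ unfold e. rewrite Cconj_Cexp. f_equal. apply C_eq; unfold Cconj, Ci, RtoC, Re, Im; simpl; ring. }
    assert (Hh : (Cconj e * (Zp * (c0 * X m t - g * SX) + Zm * (c0 * Y m t - g * SY)) =
      Cconj (e * (Zm * (Cconj c0 * Cconj (X m t) - g * Cconj SX) + Zp * (Cconj c0 * Cconj (Y m t) - g * Cconj SY))))%C).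
    { repeat (rewrite ?Cmult_conj, ?Cplus_conj, ?Cminus_conj). rewrite !Cconj_conj, CZp, CZm.
      replace (Cconj g) with (RtoC g) by (apply C_eq; simpl; ring). ring. }
    rewrite Hh.
    assert (CR : forall x : R, Cconj x = RtoC x) by (intros; apply C_eq; simpl; ring).
    rewrite <- (CR t), <- (CR ((2 * mu - 1) / (2 * a))) at 1.
    rewrite <- !Cmult_conj, <- Cminus_conj, <- Cplus_conj. f_equal.
    rewrite !RtoC_div, !RtoC_minus, !RtoC_mult by lra.
    replace (RtoC (-1)) with (- (1))%C by (apply C_eq; simpl; ring).
    assert (RtoC t <> 0) by (intros E; apply RtoC_inj in E; lra).
    assert (RtoC a <> 0) by (intros E; apply RtoC_inj in E; lra).
    field. auto.
Qed.

Lemma two_phases (P Q : C) :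
  ((1, 0)%R * P + (1, 0)%R * Q = 0)%C -> ((0, 1)%R * P + (0, - (1))%R * Q = 0)%C -> P = 0 /\ Q = 0.
Proof.
  destruct P as [p1 p2], Q as [q1 q2]. unfold Cmult, Cplus, RtoC; simpl.
  intros E1 E2. injection E1; injection E2; intros. split; f_equal; lra.
Qed.

Theorem proposition1p2 :
  forall (M : nat) (a mu g alpha : R) (X Y : nat -> R -> C),
    (3 <= M)%nat -> 0 < a -> g <> 0 ->
    alexander_spiral M a mu g ->
    0 < alpha -> alpha <> 1 / (2 * a) ->
    (forall m : nat, (m < M)%nat -> smooth_pos (X m) /\ smooth_pos (Y m)) ->
    (forall t : R, 0 < t ->
       Csum M (fun k => (X k t * Cexp (- (Ci * theta M k)))%C) = RtoC 0 /\
       Csum M (fun k => (Y k t * Cexp (- (Ci * theta M k)))%C) = RtoC 0 /\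
       Csum M (fun k => (X k t * Cexp (- (2 * Ci * theta M k)))%C) = RtoC 0 /\
       Csum M (fun k => (Y k t * Cexp (- (2 * Ci * theta M k)))%C) = RtoC 0) ->
    (linearized_BR M a mu g (perturbation M a mu alpha X Y)
     <-> reduced_system M a mu g alpha X Y).
Proof.
  intros M a mu g alpha X Y HM Ha _ _ Hal Hal2 Hsm Hmom. split.
  - intros HBR m t Hm Ht. destruct (Hsm m Hm) as [SX SY].
    destruct (smooth_pos_derive _ t SX Ht) as [dX HdX]. destruct (smooth_pos_derive _ t SY Ht) as [dY HdY].
    destruct (Hmom t Ht) as (HX & HY & _).
    exists dX, dY. split; [auto|]. split; [auto|].
    set (P := residual (-1) M a mu g alpha Y m t (X m t) dX).
    set (Q := residual 1 M a mu g alpha X m t (Y m t) dY).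
    assert (Hall : forall th, (zeta_mode 1 M a mu alpha m t th * P + zeta_mode (-1) M a mu alpha m t th * Q = 0)%C).
    { intros th. destruct (HBR m t th Hm Ht) as (dt & dth & h & H1 & H2 & H3 & H4).
      destruct (perturbation_BR M a mu g alpha X Y m t th dX dY HM Ha Hal Hal2 Hm Ht HX HY HdX HdY)
        as (dt' & dth' & h' & H1' & H2' & H3' & H4').
      rewrite (is_derive_RC_unique _ _ _ _ H1' H1), (is_derive_RC_unique _ _ _ _ H2' H2), (is_H_unique _ _ _ _ _ _ _ _ H3' H3) in H4'.
      rewrite H4 in H4'. fold P Q in H4'.
      apply (f_equal Cconj) in H4'. rewrite Cconj_conj in H4'.
      assert (N := Cexp_neq_0 (Ci * th)).
      match goal with |- ?x = _ => transitivity (/ Cexp (Ci * th) * (Cexp (Ci * th) * x))%C; [field; auto|] end.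
      rewrite <- H4'. replace (- h + h)%C with (RtoC 0) by ring.
      replace (Cconj 0) with (RtoC 0) by (apply C_eq; simpl; ring). ring. }
    assert (Hmode : forall s phi, zeta_mode s M a mu alpha m t (theta M m + (phi / alpha - (2 * mu - 1) * ln t) / (2 * a))
       = Cexp (Ci * RtoC (s * phi))).
    { intros s phi. unfold zeta_mode.
      replace (2 * a * _ + _) with (phi / alpha) by (field; lra).
      rewrite RtoC_div, RtoC_mult by lra. f_equal. field. intros E; apply RtoC_inj in E; lra. }
    (* The values of [theta] at which the phase of the mode is [0] and [PI / 2]. *)
    assert (E1 := Hall (theta M m + (0 / alpha - (2 * mu - 1) * ln t) / (2 * a))).
    assert (E2 := Hall (theta M m + (PI / 2 / alpha - (2 * mu - 1) * ln t) / (2 * a))).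
    rewrite !Hmode in E1, E2. rewrite !Cexp_Ci in E1, E2.
    replace (-1 * 0) with 0 in E1 by ring. replace (1 * 0) with 0 in E1 by ring.
    rewrite cos_0, sin_0 in E1.
    replace (-1 * (PI / 2)) with (- (PI / 2)) in E2 by ring. replace (1 * (PI / 2)) with (PI / 2) in E2 by ring.
    rewrite cos_neg, sin_neg, cos_PI2, sin_PI2 in E2.
    destruct (two_phases P Q E1 E2) as [EP EQ].
    unfold P, residual in EP. unfold Q, residual in EQ.
    split; match goal with |- ?l = ?r => transitivity (l - r + r)%C; [ring|] end;
      [rewrite EP | rewrite EQ]; ring.
  - intros HR m t th Hm Ht. destruct (HR m t Hm Ht) as (dX & dY & HdX & HdY & EX & EY).
    destruct (Hmom t Ht) as (HX & HY & _).
    destruct (perturbation_BR M a mu g alpha X Y m t th dX dY HM Ha Hal Hal2 Hm Ht HX HY HdX HdY)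
        as (dt & dth & h & H1 & H2 & H3 & H4).
    exists dt, dth, h. split; [exact H1|]. split; [exact H2|]. split; [exact H3|].
    unfold residual in H4. rewrite EX, EY in H4.
    match type of H4 with ?l = _ => transitivity (l - h)%C; [ring|] end.
    rewrite H4.
    match goal with |- (Cconj ?x - _ = _)%C => replace x with (RtoC 0) by ring end.
    replace (Cconj 0) with (RtoC 0) by (apply C_eq; simpl; ring). ring.
Qed.
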